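(* For $p=1,\ldots,25$, the matrices $\mathbf{C}_n^p$ are invertible for $n$ sufficiently large. Moreover, for these values of $p$, the family of matrices $\{\mathbf{C}_n^p\}_n$ is weakly well-conditioned; in particular, $\kappa_1(\mathbf{C}_n^p)=\mathcal{O}(n)$ as $n\to\infty$, where $\kappa_1$ is the condition number in the matrix norm $\|\cdot\|_1$.
   Context: Fix $T>0$. For $N\in\mathbb{N}$ let $h=T/N$, and for $p\ge 1$ let $\{\varphi_j^p\}_{j=0}^{N+p-1}$ be the B-spline basis (Cox–de Boor) of degree $p$ and maximal regularity $C^{p-1}$ on the uniform mesh of $[0,T]$ with $N$ intervals, with open knot vector (the end points $0$ and $T$ are repeated $p+1$ times, the interior knots $h,2h,\ldots,T-h$ are simple). Throughout $N\ge 3p+1$. Define, for $\ell,j=1,\ldots,N+p-1$, $\mathbf{C}_h^p[\ell,j]=\int_0^T\partial_t\varphi_j^p\,\varphi_{\ell-1}^p\,dt$. With $n=N+p-1$ set $\mathbf{C}_n^p:=\mathbf{C}_h^p\in\mathbb{R}^{n\times n}$ (its entries do not depend on $h$ other than through the size). A family of matrices $\{\mathbf{A}_n\}_n$, $\mathbf{A}_n\in\mathbb{R}^{n\times n}$, is weakly well-conditioned if, for $n$ sufficiently large, the matrices $\mathbf{A}_n$ are invertible and their condition numbers $\kappa(\mathbf{A}_n)$ grow only algebraically in $n$, i.e. $\kappa(\mathbf{A}_n)=\mathcal{O}(n^{\alpha})$ for some $\alpha\ge0$ (this does not depend on which of the matrix norms $\|\cdot\|_1,\|\cdot\|_2,\|\cdot\|_\infty$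 is used). *)

(* Defs.v *)
From HB Require Import structures.
From mathcomp Require Import all_boot all_order all_algebra.
From mathcomp Require Import all_classical all_reals all_analysis.

Set Implicit Arguments.
Unset Strict Implicit.
Unset Printing Implicit Defensive.

Import Order.TTheory GRing.Theory Num.Theory.
Import numFieldNormedType.Exports.

Local Open Scope classical_set_scope.
Local Open Scope ring_scope.

Section Bsplines.
Variable R : realType.

(* Cox-de Boor recursion for the knot sequence tau, b being the right end point
   of the domain.  The degree-0 functions are indicators of half-open knot
   intervals, except that the last nonempty one also contains b.  The convention
   0/0 = 0 for repeated knots is automatic, since x / 0 = 0 here. *)
Fixpoint cox_de_boor (tau : nat -> R) (b : R) (q i : nat) (t : R) {struct q} : R :=
  match q with
  | 0%N =>
      if (tau i <= t < tau i.+1) || [&& t == b, tau i < b & tau i.+1 == b]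
      then 1 else 0
  | q'.+1 =>
      (t - tau i) / (tau (i + q'.+1)%N - tau i) * cox_de_boor tau b q' i t
      + (tau (i + q'.+2)%N - t) / (tau (i + q'.+2)%N - tau i.+1)
        * cox_de_boor tau b q' i.+1 t
  end.

(* 0 for i <= p, (i - p) h for p <= i <= N + p, and N h = T for i >= N + p,
   where h = T / N (the subtraction on nat is truncated). *)
Definition open_knot (T : R) (p N i : nat) : R :=
  (minn (i - p) N)%:R * (T / N%:R).

Definition bspline (T : R) (p N j : nat) : R -> R :=
  cox_de_boor (open_knot T p N) T p j.

(* l and j are 1-based.  The integrand is junk only at finitely many knots. *)
Definition Ch_entry (T : R) (p N l j : nat) : R :=
  \int[lebesgue_measure]_(t in `[0, T])
    (derive1 (bspline T p N j) t * bspline T p N l.-1 t).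

(* n = N + p - 1, i.e. N = n + 1 - p. *)
Definition Cmx (T : R) (p n : nat) : 'M[R]_n :=
  \matrix_(i < n, j < n) Ch_entry T p (n.+1 - p) i.+1 j.+1.

End Bsplines.

Inductive norm_kind := Norm1 | Norm2 | NormInf.

Section Conditioning.
Variable R : realType.

Definition vnorm (k : norm_kind) (n : nat) (x : 'cV[R]_n) : R :=
  match k with
  | Norm1 => \sum_(i < n) `|x i 0|
  | Norm2 => Num.sqrt (\sum_(i < n) x i 0 ^+ 2)
  | NormInf => \big[Num.max/0]_(i < n) `|x i 0|
  end.

Definition opnorm (k : norm_kind) (n : nat) (A : 'M[R]_n) : R :=
  sup [set vnorm k (A *m x) | x in [set x : 'cV[R]_n | vnorm k x <= 1]].

(* Meaningful for invertible A only: invmx A = A otherwise. *)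
Definition cond_num (k : norm_kind) (n : nat) (A : 'M[R]_n) : R :=
  opnorm k A * opnorm k (invmx A).

Definition weakly_well_conditioned (k : norm_kind)
    (A : forall n : nat, 'M[R]_n) : Prop :=
  (\forall n \near \oo, A n \in unitmx) /\
  exists2 alpha : R, 0 <= alpha &
    (fun n : nat => cond_num k (A n) : R^o)
      =O_\oo (fun n : nat => n%:R `^ alpha : R^o).

End Conditioning.

(* Main.v *)
Require Import Defs.
From HB Require Import structures.
From mathcomp Require Import all_boot all_order all_algebra all_fingroup.
From mathcomp Require Import all_classical all_reals all_analysis.
From mathcomp Require Import measurable_realfun.
From mathcomp Require Import ring lra zify.

(** Every entry of the matrix pairs the derivative of a B-spline with a B-spline,
    so the matrix applied to a vector [c] lists the pairings of [v'] with all the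
    B-splines but the last one, where [v] is the spline with coefficients [0, c].
    The core is a bound that is uniform in the size ([spline_inverse_bound]): if
    all these pairings vanish except the one of index [l], of value [Y], then all
    coefficients are at most [K |Y|], where [K] depends on the degree [p] only.  It
    follows that for [n] large the matrix is injective and that the entries of its
    inverse are bounded by [K].  The matrix being banded with bounded entries, its
    1-norm is bounded, that of its inverse is at most [K n], and the condition
    number is O(n).

    For the bound, let [f] be the p-fold antiderivative of [v] that vanishes to
    order [p] at 0.  The derivative of a B-spline is a difference of two normalised
    B-splines of lower degree, so that [p] integrations by parts turn the vanishing
    of the pairings of index less than [l] into the vanishing of [f] at the knots on
    the left of a knot [k0] close to [l] ([left_zero]).  In the same way, after
    subtraction of a polynomial [G] of degree [p] that matches [f] at the right end,
    [F = f - G] vanishes at the knots on the right of [k0] ([right_zero]).  Thus [f]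
    and [F] are null splines of degree [2 p].  Such a spline is determined
    by its derivatives of orders 1 to [2 p - 1] at one knot, its state, and states
    at consecutive knots are related by a fixed matrix [- P] ([state_null]).  The
    state of [f] has [p - 1] free coordinates at the left end, that of [F] has [p]
    free coordinates at the right end, and their mismatch at [k0] is the state of
    [G], which is O(|Y|) because the derivatives of [G] are orthogonal to B-splines
    supported near [k0] ([coef_bound_down]).

    What remains is to bound two chains of states by their mismatch
    ([transfer_chains]).  No spectral information on [P] is used.  Instead, [P] is
    totally positive, being built from binomial coefficients ([minor_transfer]),
    and its inverse is conjugate to [P] by alternating signs, because the reflection
    of a null spline is a null spline ([transfer_altsign_mx]).  Total positivity
    makes all the minors of a given order [r] of [P^k] comparable to one of them,
    [D_r(k)] ([minors_comparable]), with [D_r(a) D_r(b) <= K D_r(a+b)]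
    ([corner_mul]).  Jacobi's identity on complementary minors gives
    [D_(p-1) = D_p] ([corner_mid]) and, together with the log-concavity of
    [r |-> D_r], [D_(p-2) <= K D_(p-1)] ([corner_pred]).  By Cramer's rule these
    relations say that neither chain decreases away from its end by more than a
    constant factor ([chain_mono]), and that the linear system which matches the
    chains at [k0] has a bounded inverse ([chain_match]). *)

Set Implicit Arguments.
Unset Strict Implicit.
Unset Printing Implicit Defensive.

Import Order.TTheory GRing.Theory Num.Theory.
Import numFieldNormedType.Exports.

Local Open Scope classical_set_scope.
Local Open Scope ring_scope.

(** * Minors, the Cauchy-Binet formula and total positivity *)

Section Minors.
Variable R : realFieldType.

Definition minor r m n (A : 'M[R]_(m, n)) (f : 'I_r -> 'I_m) (g : 'I_r -> 'I_n) : R :=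
  \det (mxsub f g A).

Lemma eq_minor r m n (A : 'M[R]_(m, n)) (f f' : 'I_r -> 'I_m) (g g' : 'I_r -> 'I_n) :
  f =1 f' -> g =1 g' -> minor A f g = minor A f' g'.
Proof. by move=> ef eg; congr (\det _); apply/matrixP => i j; rewrite !mxE ef eg. Qed.

Lemma minor_trmx r m n (A : 'M[R]_(m, n)) (f : 'I_r -> 'I_m) (g : 'I_r -> 'I_n) :
  minor A^T g f = minor A f g.
Proof. by rewrite /minor -det_tr; congr (\det _); apply/matrixP => i j; rewrite !mxE. Qed.

Lemma minor_perml r m n (A : 'M[R]_(m, n)) (f : 'I_r -> 'I_m) (g : 'I_r -> 'I_n) (s : 'S_r) :
  minor A (f \o s) g = (-1) ^+ s * minor A f g.
Proof.
rewrite /minor -det_perm -det_mulmx -row_permE; congr (\det _).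
by apply/matrixP => i j; rewrite !mxE.
Qed.

Lemma minor_permr r m n (A : 'M[R]_(m, n)) (f : 'I_r -> 'I_m) (g : 'I_r -> 'I_n) (s : 'S_r) :
  minor A f (g \o s) = (-1) ^+ s * minor A f g.
Proof. by rewrite -minor_trmx minor_perml minor_trmx. Qed.

Lemma minor_noninjl r m n (A : 'M[R]_(m, n)) (f : 'I_r -> 'I_m) (g : 'I_r -> 'I_n) :
  ~~ injectiveb f -> minor A f g = 0.
Proof.
case/injectivePn => i [j nij eij].
by rewrite /minor (determinant_alternate nij) // => k; rewrite !mxE eij.
Qed.

Lemma minor_noninjr r m n (A : 'M[R]_(m, n)) (f : 'I_r -> 'I_m) (g : 'I_r -> 'I_n) :
  ~~ injectiveb g -> minor A f g = 0.
Proof. by move=> ng; rewrite -minor_trmx minor_noninjl. Qed.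

(** Multilinearity in the rows of the product, without sorting the indices: [h]
    runs over all maps, and those that are not injective contribute zero. *)
Lemma det_mulmx_sum r n (A : 'M[R]_(r, n)) (B : 'M[R]_(n, r)) :
  \det (A *m B) =
  \sum_(h : {ffun 'I_r -> 'I_n}) (\prod_i A i (h i)) * \det (rowsub h B).
Proof.
transitivity (\sum_(h : {ffun 'I_r -> 'I_n}) \sum_(s : 'S_r)
    (-1) ^+ s * \prod_i (A i (h i) * B (h i) (s i))).
  rewrite exchange_big; apply: eq_bigr => /= s _; rewrite -big_distrr /=.
  congr (_ * _); rewrite -(bigA_distr_bigA (fun i k => A i k * B k (s i))) /=.
  by apply: eq_bigr => x _; rewrite mxE.
apply: eq_bigr => h _; rewrite big_distrr /=; apply: eq_bigr => s _.
rewrite mulrCA big_split //=; congr (_ * (_ * _)).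
by apply: eq_bigr => x _; rewrite mxE.
Qed.

(** The sum runs over all index maps rather than over the increasing ones; each
    increasing map is then counted [r`!] times, whence the factor on the
    left. *)
Lemma cauchy_binet r m n p (A : 'M[R]_(m, n)) (B : 'M[R]_(n, p))
    (f : 'I_r -> 'I_m) (g : 'I_r -> 'I_p) :
  r`!%:R * minor (A *m B) f g =
  \sum_(h : {ffun 'I_r -> 'I_n}) minor A f h * minor B h g.
Proof.
have -> : minor (A *m B) f g = \det (rowsub f A *m colsub g B).
  by congr (\det _); apply/matrixP => i j; rewrite !mxE; apply: eq_bigr => k _; rewrite !mxE.
rewrite det_mulmx_sum -card_Sn -[in LHS](@sumr_const R) big_distrl /=.
(* Each of the [r`!] copies of the sum is reordered by its own permutation. *)
under eq_bigr => s _.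
  rewrite mul1r (reindex (fun h : {ffun 'I_r -> 'I_n} => [ffun i => h (s i)])); last first.
    exists (fun h : {ffun 'I_r -> 'I_n} => [ffun i => h ((s^-1)%g i)]) => h _;
      by apply/ffunP => i; rewrite !ffunE ?permKV ?permK.
  over.
rewrite exchange_big /=; apply: eq_bigr => h _.
rewrite /minor [X in _ = X * _]/determinant big_distrl /=; apply: eq_bigr => s _.
have -> : \det (rowsub [ffun i => h (s i)] (colsub g B)) = (-1) ^+ s * minor B h g.
  rewrite -minor_perml; congr (\det _); apply/matrixP => i j; rewrite !mxE ffunE //.
rewrite mulrCA mulrA; congr (_ * _ * _).
by apply: eq_bigr => i _; rewrite !mxE ffunE.
Qed.

(** It carries a sign: positive on increasing maps, alternating under
    permutation of the indices and zero on maps that are not injective, exactly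
    as a minor behaves in its row (or column) indices. *)
Definition vdm r m (f : 'I_r -> 'I_m) : R := \det (Vandermonde r (\row_j (f j)%:R)).

Lemma vdmE r m (f : 'I_r -> 'I_m) :
  vdm f = \prod_(i < r) \prod_(j < r | (i < j)%N) ((f j)%:R - (f i)%:R).
Proof.
rewrite /vdm det_Vandermonde; apply: eq_bigr => i _; apply: eq_bigr => j _.
by rewrite !mxE.
Qed.

Definition incr r m (f : 'I_r -> 'I_m) := forall i j : 'I_r, (i < j)%N -> (f i < f j)%N.

Lemma vdm_gt0 r m (f : 'I_r -> 'I_m) : incr f -> 0 < vdm f.
Proof.
move=> If; rewrite vdmE; apply: prodr_gt0 => i _; apply: prodr_gt0 => j ij.
by rewrite subr_gt0 ltr_nat If.
Qed.

Lemma vdm_perm r m (f : 'I_r -> 'I_m) (s : 'S_r) : vdm (f \o s) = (-1) ^+ s * vdm f.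
Proof.
rewrite /vdm -[in LHS]det_tr -[in RHS]det_tr -det_perm -det_mulmx -row_permE.
by congr (\det _); apply/matrixP => i j; rewrite !mxE.
Qed.

Lemma vdm_eq0 r m (f : 'I_r -> 'I_m) : ~~ injectiveb f -> vdm f = 0.
Proof.
case/injectivePn => i [j nij eij].
rewrite /vdm -det_tr (determinant_alternate nij) // => k; by rewrite !mxE eij.
Qed.

Lemma sort_inj r m (f : 'I_r -> 'I_m) : injectiveb f -> exists s : 'S_r, incr (f \o s).
Proof.
move=> /injectiveP fI.
pose t : r.-tuple 'I_m := [tuple f i | i < r].
pose s := sort (fun x y : 'I_m => (x <= y)%N) t.
have Es : perm_eq s t by rewrite perm_sort.
have Us : uniq s by rewrite (perm_uniq Es) map_inj_uniq ?enum_uniq.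
have zs : size s = r by rewrite size_sort size_tuple.
have [q qE] : exists q : 'S_r, s = [tuple tnth t (q i) | i < r] by exact/tuple_permP.
have So : sorted (fun x y : 'I_m => (x <= y)%N) s by apply: sort_sorted => x y; exact: leq_total.
exists q => i j ij /=.
have tr : transitive (fun x y : 'I_m => (x <= y)%N) by move=> x y z; exact: leq_trans.
have H (k : 'I_r) : nth (f i) s k = f (q k).
  by rewrite qE -tnth_nth tnth_mktuple tnth_mktuple.
have := sorted_leq_nth tr (fun x => leqnn x) (f i) So.
move=> /(_ i j); rewrite !inE zs !ltn_ord => /(_ isT isT (ltnW ij)).
rewrite !H leq_eqVlt => /orP[/eqP e|//].
by move: (perm_inj (fI _ _ (val_inj e))) ij => ->; rewrite ltnn.
Qed.

Lemma vdm_neq0 r m (f : 'I_r -> 'I_m) : injectiveb f -> vdm f != 0.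
Proof.
move=> /sort_inj[s /vdm_gt0]; rewrite vdm_perm => /lt0r_neq0.
by apply: contraNN => /eqP ->; rewrite mulr0.
Qed.

(** Total positivity, all minors with increasing indices being nonnegative
    ([totpos_incr]).  The Vandermonde factors extend the condition to arbitrary
    index maps, which is what the sums of [cauchy_binet] require. *)
Definition totpos m n (A : 'M[R]_(m, n)) := forall r (f : 'I_r -> 'I_m) (g : 'I_r -> 'I_n),
  0 <= vdm f * vdm g * minor A f g.

Lemma totpos_incr m n (A : 'M[R]_(m, n)) :
  (forall r (f : 'I_r -> 'I_m) (g : 'I_r -> 'I_n), incr f -> incr g -> 0 <= minor A f g) ->
  totpos A.
Proof.
move=> H r f g.
have [/sort_inj [s sf]|/vdm_eq0 ->] := boolP (injectiveb f); last by rewrite !mul0r.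
have [/sort_inj [t tg]|/vdm_eq0 ->] := boolP (injectiveb g); last by rewrite mulr0 mul0r.
have : 0 <= vdm (f \o s) * vdm (g \o t) * minor A (f \o s) (g \o t).
  by apply: mulr_ge0; [apply: mulr_ge0; exact/ltW/vdm_gt0|exact: (H _ _ _ sf tg)].
rewrite !vdm_perm minor_perml minor_permr.
have -> : forall a b x y z : R, a * x * (b * y) * (a * (b * z)) = a ^+ 2 * b ^+ 2 * (x * y * z).
  by move=> *; ring.
by rewrite !sqrr_sign !mul1r.
Qed.

Lemma totpos_minor_ge0 m n (A : 'M[R]_(m, n)) r (f : 'I_r -> 'I_m) (g : 'I_r -> 'I_n) :
  totpos A -> incr f -> incr g -> 0 <= minor A f g.
Proof. by move=> /(_ r f g) + If Ig; rewrite pmulr_rge0 // mulr_gt0 ?vdm_gt0. Qed.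

(** No cancellation occurs in the Cauchy-Binet sum of totally positive factors.
    This is what turns total positivity into two-sided estimates of minors. *)
Lemma abs_cauchy_binet r m n p (A : 'M[R]_(m, n)) (B : 'M[R]_(n, p))
    (f : 'I_r -> 'I_m) (g : 'I_r -> 'I_p) : totpos A -> totpos B ->
  r`!%:R * `|minor (A *m B) f g| =
  \sum_(h : {ffun 'I_r -> 'I_n}) `|minor A f h| * `|minor B h g|.
Proof.
move=> tA tB.
have [fI|nf] := boolP (injectiveb f); last first.
  rewrite minor_noninjl // normr0 mulr0 big1 // => h _.
  by rewrite minor_noninjl // normr0 mul0r.
have [gI|ng] := boolP (injectiveb g); last first.
  rewrite minor_noninjr // normr0 mulr0 big1 // => h _.
  by rewrite (minor_noninjr B) // normr0 mulr0.
have nz : `|vdm f * vdm g| != 0 by rewrite normr_eq0 mulf_neq0 ?vdm_neq0.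
apply: (mulfI nz).
have -> : r`!%:R = `|r`!%:R| :> R by rewrite ger0_norm.
rewrite -!normrM cauchy_binet mulr_sumr.
have H (h : {ffun 'I_r -> 'I_n}) : 0 <= vdm f * vdm g * (minor A f h * minor B h g).
  have [hI|nh] := boolP (injectiveb h); last by rewrite minor_noninjr // mul0r mulr0.
  rewrite -(pmulr_rge0 (x := vdm h ^+ 2)); last by rewrite exprn_even_gt0 // vdm_neq0.
  have -> : vdm h ^+ 2 * (vdm f * vdm g * (minor A f h * minor B h g)) =
     (vdm f * vdm h * minor A f h) * (vdm h * vdm g * minor B h g) by ring.
  by apply: mulr_ge0; [exact: tA|exact: tB].
rewrite [RHS]mulr_sumr ger0_norm; last by apply: sumr_ge0 => h _; exact: H.
by apply: eq_bigr => h _; rewrite -!normrM ger0_norm.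
Qed.

Lemma totpos_mulmx m n p (A : 'M[R]_(m, n)) (B : 'M[R]_(n, p)) : totpos A -> totpos B -> totpos (A *m B).
Proof.
move=> tA tB; apply: totpos_incr => r f g If Ig.
have r0 : 0 < r`!%:R :> R by rewrite ltr0n fact_gt0.
rewrite -(pmulr_rge0 _ r0) cauchy_binet; apply: sumr_ge0 => h _.
have [hI|nh] := boolP (injectiveb h); last by rewrite minor_noninjr // mul0r.
have [s Ih] := sort_inj hI.
have -> : minor A f h * minor B h g = minor A f (h \o s) * minor B (h \o s) g.
  rewrite minor_perml minor_permr mulrACA -expr2 sqrr_sign; ring.
by apply: mulr_ge0; exact: totpos_minor_ge0.
Qed.

End Minors.

(** * Minors of the Pascal matrix *)

Section Pascal.
Variable R : realFieldType.

Definition incn r (F : nat -> nat) := forall i j, (i < j)%N -> (j < r)%N -> (F i < F j)%N.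

(** Summation is left multiplication by a unitriangular matrix. *)
Lemma det_partial_sums r (Y : 'M[R]_r) :
  \det (\matrix_(i < r, j < r) \sum_(k < r | (k <= i)%N) Y k j) = \det Y.
Proof.
pose L : 'M[R]_r := \matrix_(i, k) (k <= i)%:R.
have dL : \det L = 1.
  rewrite det_trig; last by apply/is_trig_mxP => i j ij; rewrite mxE leqNgt ij.
  by rewrite big1 // => i _; rewrite mxE leqnn.
rewrite -[RHS]mul1r -dL -det_mulmx; congr (\det _); apply/matrixP => i j; rewrite !mxE.
rewrite big_mkcond; apply: eq_bigr => k _; rewrite mxE.
by case: ifP => _; rewrite (mul1r, mul0r).
Qed.

(** Multilinearity again: the sum runs over the choices of one point in every
    cell [lo i, hi i). *)
Lemma det_cells r (lo hi : nat -> nat) (K : nat -> 'I_r -> R) n :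
  (forall i, (i < r)%N -> (hi i <= n)%N) ->
  \det (\matrix_(i < r, j < r) \sum_(lo i <= t < hi i) K t j) =
  \sum_(h : {ffun 'I_r -> 'I_n} | [forall i : 'I_r, (lo i <= h i < hi i)%N])
     \det (\matrix_(i < r, j < r) K (h i) j).
Proof.
move=> hin.
pose A : 'M[R]_(r, n) := \matrix_(i, t) (lo i <= t < hi i)%:R.
pose B : 'M[R]_(n, r) := \matrix_(t, j) K t j.
have -> : \matrix_(i < r, j < r) \sum_(lo i <= t < hi i) K t j = A *m B.
  apply/matrixP => i j; rewrite !mxE.
  under [RHS]eq_bigr => t _ do rewrite !mxE.
  rewrite -(big_mkord xpredT (fun t => (lo i <= t < hi i)%:R * K t j)).
  have := hin i (ltn_ord i); set H := hi i; set L := lo i => Hn.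
  rewrite (big_nat_widenl _ 0%N) // big_mkord /=.
  rewrite (big_ord_widen_cond n (fun t => (L <= t)%N) (fun t => K t j) Hn) big_mkcond.
  rewrite [RHS]big_mkord; apply: eq_bigr => t _ /=.
  by case: ifP => _; rewrite (mul1r, mul0r).
rewrite det_mulmx_sum [RHS]big_mkcond; apply: eq_bigr => h _ /=.
have -> : rowsub h B = \matrix_(i < r, j < r) K (h i) j.
  by apply/matrixP => i j; rewrite !mxE.
case: ifPn => [/forallP hc|/forallPn[i hi']].
  rewrite big1 ?mul1r // => i _; by rewrite mxE hc.
by rewrite (bigD1 i) //= mxE (negbTE hi') !mul0r.
Qed.

(** When the cells are consecutive, every choice of one point per cell is
    increasing, so all the terms of [det_cells] are nonnegative. *)
Lemma cells_ge0 r (lo hi : nat -> nat) (K : nat -> 'I_r -> R) :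
  (forall i j, (i < j)%N -> (j < r)%N -> (hi i <= lo j)%N) ->
  (forall H : nat -> nat, incn r H -> 0 <= \det (\matrix_(i < r, j < r) K (H i) j)) ->
  0 <= \det (\matrix_(i < r, j < r) \sum_(lo i <= t < hi i) K t j).
Proof.
move=> hl HK.
pose n := (\max_(i < r) hi i)%N.
rewrite (@det_cells _ _ _ _ n); last by move=> i ir; apply: (leq_bigmax (Ordinal ir)).
apply: sumr_ge0 => h /forallP hh.
pose H k := if insub k is Some i then h i : nat else 0%N.
have HE (i : 'I_r) : H i = h i by rewrite /H valK.
have -> : \matrix_(i < r, j < r) K (h i) j = \matrix_(i < r, j < r) K (H i) j.
  by apply/matrixP => i j; rewrite !mxE HE.
apply: HK => i j ij jr.
have ir : (i < r)%N by apply: ltn_trans jr.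
have := hh (Ordinal ir); have := hh (Ordinal jr).
rewrite -!HE /= => /andP[a _] /andP[_ b].
exact: leq_trans b (leq_trans (hl _ _ ij jr) a).
Qed.

(** One choice of points with a positive determinant suffices, the others
    contributing nonnegative terms. *)
Lemma cells_gt0 r (lo hi : nat -> nat) (K : nat -> 'I_r -> R) (H0 : nat -> nat) :
  (forall i j, (i < j)%N -> (j < r)%N -> (hi i <= lo j)%N) ->
  (forall H : nat -> nat, incn r H -> 0 <= \det (\matrix_(i < r, j < r) K (H i) j)) ->
  (forall i, (i < r)%N -> (lo i <= H0 i < hi i)%N) ->
  0 < \det (\matrix_(i < r, j < r) K (H0 i) j) ->
  0 < \det (\matrix_(i < r, j < r) \sum_(lo i <= t < hi i) K t j).
Proof.
move=> hl HK Hc H0p.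
pose n := (\max_(i < r) hi i)%N.
have hin i (ir : (i < r)%N) : (hi i <= n)%N by apply: (leq_bigmax (Ordinal ir)).
rewrite (@det_cells _ _ _ _ n) //.
have H0n (i : 'I_r) : (H0 i < n)%N.
  by have /andP[_ a] := Hc i (ltn_ord i); apply: leq_trans a (hin _ (ltn_ord i)).
pose h0 : {ffun 'I_r -> 'I_n} := [ffun i => Ordinal (H0n i)].
rewrite (bigD1 h0) /=; last by apply/forallP => i; rewrite ffunE /= Hc.
apply: ltr_wpDr; last first.
  suff -> : \matrix_(i < r, j < r) K (h0 i) j = \matrix_(i < r, j < r) K (H0 i) j by [].
  by apply/matrixP => i j; rewrite !mxE ffunE.
apply: sumr_ge0 => h /andP[/forallP hh _].
pose H k := if insub k is Some i then h i : nat else 0%N.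
have HE (i : 'I_r) : H i = h i by rewrite /H valK.
have -> : \matrix_(i < r, j < r) K (h i) j = \matrix_(i < r, j < r) K (H i) j.
  by apply/matrixP => i j; rewrite !mxE HE.
apply: HK => i j ij jr.
have ir : (i < r)%N by apply: ltn_trans jr.
have := hh (Ordinal ir); have := hh (Ordinal jr).
rewrite -!HE /= => /andP[a _] /andP[_ b].
exact: leq_trans b (leq_trans (hl _ _ ij jr) a).
Qed.

(** The hockey-stick identity. *)
Lemma bin_sum_range a b k : (a <= b)%N ->
  \sum_(a <= t < b) 'C(t, k)%:R = 'C(b, k.+1)%:R - 'C(a, k.+1)%:R :> R.
Proof.
move=> ab; rewrite -(subnKC ab); elim: (b - a)%N => [|d IH].
  by rewrite addn0 big_geq // subrr.
by rewrite addnS big_nat_recr ?leq_addr //= IH binS natrD; ring.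
Qed.

Definition pascal_det r (F G : nat -> nat) : R :=
  \det (\matrix_(i < r, j < r) 'C(G i, F j)%:R).

Lemma big_cells (K : nat -> R) (G : nat -> nat) r (i : 'I_r) :
  (forall a b, (a < b)%N -> (b < r)%N -> (G a <= G b)%N) ->
  \sum_(k < r | (k <= i)%N) \sum_((if (k : nat) is k'.+1 then G k' else 0%N) <= t < G k) K t =
  \sum_(0 <= t < G i) K t.
Proof.
move=> incG.
rewrite -[LHS](big_ord_widen r (fun k => \sum_((if k is k'.+1 then G k' else 0%N) <= t < G k) K t) (ltn_ord i)) /=.
have := ltn_ord i; elim: {i}(i : nat) => [|i IH] ir; first by rewrite big_ord1.
rewrite big_ord_recr /= IH ?(ltnW ir) //.
by rewrite [RHS](big_cat_nat (n := G i)) //= incG.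
Qed.

(** Double induction, on the order of the minor and on [F 0].  Differences of
    consecutive rows are sums, over consecutive cells, of binomial coefficients
    whose lower index has dropped by one ([bin_sum_range]).  When [F 0 > 0]
    this decreases [F 0]; when [F 0 = 0] the first column is constant, and the
    differences kill all of it but one entry, which decreases the order. *)
Lemma pascal_minor r (F G : nat -> nat) : incn r F -> incn r G ->
  0 <= pascal_det r F G /\ ((forall i, (i < r)%N -> (F i <= G i)%N) -> 0 < pascal_det r F G).
Proof.
elim: r F G => [|r IHr] F G; first by move=> _ _; rewrite /pascal_det det_mx00.
move: {2}(F 0%N) (erefl (F 0%N)) => F0.
elim: F0 F G => [|m IHm] F G F0 IF IG.
- pose Y : 'M[R]_r.+1 := \matrix_(i, j)
    if (i : nat) is i'.+1 then \sum_(G i' <= t < G i) (if (j : nat) is j'.+1 then 'C(t, (F j).-1)%:R else 0)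
    else 'C(G 0%N, F j)%:R.
  have Ge a b : (a <= b)%N -> (b < r.+1)%N -> (G a <= G b)%N.
    by rewrite leq_eqVlt => /orP[/eqP ->|ab br] //; apply: ltnW; apply: IG.
  have Fp j : (0 < j < r.+1)%N -> (0 < F j)%N.
    by move=> /andP[j0 jr]; apply: leq_ltn_trans (IF 0%N j j0 jr).
  have YE (i j : 'I_r.+1) : \sum_(k < r.+1 | (k <= i)%N) Y k j = 'C(G i, F j)%:R.
    under eq_bigr do rewrite mxE.
    rewrite -[LHS](big_ord_widen r.+1 (fun k =>
       if k is k'.+1 then \sum_(G k' <= t < G k) (if (j : nat) is j'.+1 then 'C(t, (F j).-1)%:R else 0)
       else 'C(G 0%N, F j)%:R) (ltn_ord i)) /=.
    have := ltn_ord i; elim: {i}(i : nat) => [|i IH] ir; first by rewrite big_ord1.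
    rewrite big_ord_recr /= IH ?(ltnW ir) //.
    case E : (j : nat) => [|j'].
      by rewrite big1 ?F0 ?bin0 ?addr0.
    rewrite bin_sum_range ?Ge //.
    rewrite prednK -?E ?Fp ?ltn_ord ?E //; ring.
  have -> : pascal_det r.+1 F G = \det (\matrix_(i < r, j < r)
      \sum_(G i <= t < G i.+1) 'C(t, (F j.+1).-1)%:R).
    rewrite /pascal_det.
    have -> : \matrix_(i < r.+1, j < r.+1) 'C(G i, F j)%:R =
       \matrix_(i, j) \sum_(k < r.+1 | (k <= i)%N) Y k j.
      by apply/matrixP => i j; rewrite mxE [RHS]mxE YE.
    rewrite det_partial_sums (expand_det_col _ 0) big_ord_recl big1 ?addr0; last first.
      by move=> i _; rewrite mxE /= big1 ?mul0r.
    rewrite mxE /= F0 bin0 mul1r /cofactor /= expr0 mul1r; congr (\det _).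
    by apply/matrixP => i j; rewrite !mxE.
  have hl i j : (i < j)%N -> (j < r)%N -> (G i.+1 <= G j)%N.
    by move=> ij jr; apply: Ge => //; apply: ltnW.
  have IF' : incn r (fun j => (F j.+1).-1).
    move=> i j ij jr; have := IF i.+1 j.+1 ij jr.
    have : (0 < F i.+1)%N by apply: Fp; rewrite /= ltnS (ltn_trans ij jr).
    lia.
  have HK (H : nat -> nat) : incn r H -> 0 <= pascal_det r (fun j => (F j.+1).-1) H.
    by move=> IH; have [] := IHr (fun j => (F j.+1).-1) H IF' IH.
  split; first exact: (cells_ge0 (hi := fun i => G i.+1) hl HK).
  move=> FG; apply: (cells_gt0 (hi := fun i => G i.+1) (H0 := fun i => (G i.+1).-1) hl HK).
    move=> i ir; have := IG i i.+1 (ltnSn i) ir; lia.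
  (* The largest point of each cell still dominates the lower index. *)
  apply: (IHr (fun j => (F j.+1).-1) (fun i => (G i.+1).-1) IF' _).2 => [i j ij jr|i ir].
    have := IG i.+1 j.+1 ij jr; have := IG i i.+1 (ltnSn i) (ltn_trans ij jr); lia.
  have := FG i.+1 ir; lia.
- have Fp j : (j < r.+1)%N -> (0 < F j)%N.
    case: j => [|j] jr; first by rewrite F0.
    by apply: leq_ltn_trans (IF 0%N j.+1 _ jr).
  have Ge a b : (a < b)%N -> (b < r.+1)%N -> (G a <= G b)%N by move=> *; apply/ltnW/IG.
  pose lo k := if k is k'.+1 then G k' else 0%N.
  have -> : pascal_det r.+1 F G = \det (\matrix_(i < r.+1, j < r.+1)
      \sum_(lo i <= t < G i) 'C(t, (F j).-1)%:R).
    rewrite -det_partial_sums; congr (\det _); apply/matrixP => i j; rewrite !mxE.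
    under eq_bigr do rewrite mxE.
    rewrite (big_cells (fun t => 'C(t, (F j).-1)%:R) i Ge).
    by rewrite bin_sum_range // prednK ?Fp // bin0n gtn_eqF ?Fp // subr0.
  have hl i j : (i < j)%N -> (j < r.+1)%N -> (G i <= lo j)%N.
    case: j => // j; rewrite ltnS leq_eqVlt => /orP[/eqP ->|ij jr] //.
    by apply: Ge => //; apply: ltnW.
  have IF' : incn r.+1 (fun j => (F j).-1).
    move=> i j ij jr; have := IF i j ij jr; have := Fp i (ltn_trans ij jr); lia.
  have F0' : (F 0%N).-1 = m by rewrite F0.
  have HK (H : nat -> nat) : incn r.+1 H -> 0 <= pascal_det r.+1 (fun j => (F j).-1) H.
    by move=> IH; have [] := IHm (fun j => (F j).-1) H F0' IF' IH.
  split; first exact: (cells_ge0 hl HK).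
  move=> FG; apply: (cells_gt0 (H0 := fun i => (G i).-1) hl HK).
    move=> [|i] ir /=; first by have := FG 0%N isT; rewrite F0; lia.
    have := IG i i.+1 (ltnSn i) ir; lia.
  apply: (IHm (fun j => (F j).-1) (fun i => (G i).-1) F0' IF' _).2 => [i j ij jr|i ir].
    have := IG i j ij jr; have := FG i (ltn_trans ij jr); have := Fp i (ltn_trans ij jr); lia.
  have := FG i ir; lia.
Qed.

End Pascal.

(** * The transfer matrix of null splines and its positivity *)

Section Transfer.
Variable R : realFieldType.

Fixpoint mxpow m (A : 'M[R]_m) (k : nat) : 'M[R]_m :=
  if k is k'.+1 then A *m mxpow A k' else 1%:M.

Lemma mxpowD m (A : 'M[R]_m) a b : mxpow A (a + b) = mxpow A a *m mxpow A b.
Proof. by elim: a => [|a IH] /=; rewrite ?mul1mx // IH mulmxA. Qed.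

Lemma mxpow1 m (A : 'M[R]_m) : mxpow A 1 = A.
Proof. by rewrite /= mulmx1. Qed.

Lemma mxpowSr m (A : 'M[R]_m) k : mxpow A k.+1 = mxpow A k *m A.
Proof. by rewrite -addn1 mxpowD mxpow1. Qed.

Lemma totpos_mxpow m (A : 'M[R]_m) k : totpos A -> (0 < k)%N -> totpos (mxpow A k).
Proof.
move=> tA; case: k => // k _; elim: k => [|k IH]; first by rewrite mxpow1.
by apply: totpos_mulmx.
Qed.

(** A polynomial [f] of degree at most [m.+1] with [f(0) = f(1) = 0] has Taylor
    coefficients of orders 1 to [m] at 1 equal to minus this matrix applied to
    those at 0 ([coef_tail_shift]).  Row [i] stands for the order [i.+1], and
    the coefficient of order [m.+1] has been eliminated by means of
    [f(1) = 0]. *)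
Definition transfer m : 'M[R]_m := \matrix_(i, k) ('C(m.+1, i.+1)%:R - 'C(k.+1, i.+1)%:R).

Lemma det_partial_sums_up r (Y : 'M[R]_r) :
  \det (\matrix_(i < r, j < r) \sum_(k < r | (i <= k)%N) Y k j) = \det Y.
Proof.
pose L : 'M[R]_r := \matrix_(i, k) (i <= k)%:R.
have dL : \det L = 1.
  rewrite -det_tr det_trig; last by apply/is_trig_mxP => i j ij; rewrite !mxE leqNgt ij.
  by rewrite big1 // => i _; rewrite !mxE leqnn.
rewrite -[RHS]mul1r -dL -det_mulmx; congr (\det _); apply/matrixP => i j; rewrite !mxE.
rewrite big_mkcond; apply: eq_bigr => k _; rewrite mxE.
by case: ifP => _; rewrite (mul1r, mul0r).
Qed.

Lemma big_cells_up (K : nat -> R) (lo : nat -> nat) r i : (i <= r)%N ->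
  (forall a, (a < r)%N -> (lo a <= lo a.+1)%N) ->
  \sum_(i <= k < r) \sum_(lo k <= t < lo k.+1) K t = \sum_(lo i <= t < lo r) K t.
Proof.
elim: r => [|r IH] ir inc; first by move: ir; rewrite leqn0 => /eqP ->; rewrite !big_geq.
move: ir; rewrite leq_eqVlt => /orP[/eqP ->|ir]; first by rewrite !big_geq.
rewrite big_nat_recr //= IH // => [|a ar]; last by apply/inc/leqW.
rewrite [RHS](big_cat_nat (n := lo r)) //=; last exact: inc.
have : forall b, (b <= r)%N -> (i <= b)%N -> (lo i <= lo b)%N; last by apply.
elim=> [|b IHb] br; first by rewrite leqn0 => /eqP ->.
rewrite leq_eqVlt => /orP[/eqP ->|ib] //.
by apply: leq_trans (IHb (ltnW br) ib) (inc _ (leqW br)).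
Qed.

(** The entry (i, k) is the sum of ['C(t, i)] for [k < t <= m], so partial
    summation of the columns turns a minor into a determinant of sums of Pascal
    rows over the consecutive cells cut by the column indices.  It is positive
    as soon as each row index is at most the next column index. *)
Lemma minor_transfer m r (f g : 'I_r -> 'I_m) : incr f -> incr g ->
  0 <= minor (transfer m) f g /\
  ((forall a b : 'I_r, b = a.+1 :> nat -> (f a <= g b)%N) -> 0 < minor (transfer m) f g).
Proof.
move=> If Ig.
pose lo k := if insub k is Some b then (g (b : 'I_r)).+1 else m.+1.
have loE (b : 'I_r) : lo b = (g b).+1 by rewrite /lo valK.
have lor : lo r = m.+1 by rewrite /lo insubN // ltnn.
pose F k := if insub k is Some b then (f (b : 'I_r) : nat) else 0%N.
have FE (b : 'I_r) : F b = f b by rewrite /F valK.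
have lo_incr a : (a < r)%N -> (lo a < lo a.+1)%N.
  move=> ar; rewrite (loE (Ordinal ar)).
  have [a1r|] := ltnP a.+1 r; first by rewrite (loE (Ordinal a1r)) ltnS Ig.
  by move=> ra; rewrite /lo insubN ?ltnS -?leqNgt // ltn_ord.
have lo_le a b : (a <= b <= r)%N -> (lo a <= lo b)%N.
  move=> /andP[]; elim: b => [|b IHb]; first by rewrite leqn0 => /eqP ->.
  rewrite leq_eqVlt => /orP[/eqP -> //|ab br].
  by apply: leq_trans (IHb ab (ltnW br)) (ltnW (lo_incr _ br)).
have IF : incn r F.
  move=> i j ij jr; rewrite (FE (Ordinal jr)) (FE (Ordinal (ltn_trans ij jr))).
  exact: If.
have -> : minor (transfer m) f g = \det (\matrix_(i < r, j < r)
      \sum_(lo i <= t < lo i.+1) 'C(t, F j)%:R).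
  rewrite -det_partial_sums_up /minor -det_tr; congr (\det _).
  apply/matrixP => i j; rewrite !mxE.
  under [RHS]eq_bigr do rewrite mxE.
  have -> : \sum_(k < r | (i <= k)%N) \sum_(lo k <= t < lo k.+1) 'C(t, F j)%:R =
     \sum_(i <= k < r) \sum_(lo k <= t < lo k.+1) 'C(t, F j)%:R :> R.
    by rewrite (big_nat_widenl _ 0%N) // big_mkord.
  rewrite (big_cells_up (fun t => 'C(t, F j)%:R)) ?(ltnW (ltn_ord i)) // => [|a ar]; last exact/ltnW/lo_incr.
  by rewrite bin_sum_range ?lor ?loE ?FE // ltnS ltnW.
have hl i j : (i < j)%N -> (j < r)%N -> (lo i.+1 <= lo j)%N.
  by move=> ij jr; apply: lo_le; rewrite ij ltnW.
have HK (H : nat -> nat) : incn r H -> 0 <= pascal_det R r F H.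
  by move=> IH; have [] := pascal_minor R IF IH.
split; first exact: (cells_ge0 (hi := fun i => lo i.+1) hl HK).
move=> fg; apply: (cells_gt0 (hi := fun i => lo i.+1) (H0 := fun i => (lo i.+1).-1) hl HK).
  move=> i ir; have := lo_incr i ir; lia.
have IH : incn r (fun i => (lo i.+1).-1).
  move=> i j ij jr; have := lo_le i.+1 j; have := lo_incr j jr.
  have := lo_incr _ (ltn_trans ij jr); rewrite ij (ltnW jr) => ? ? /(_ isT); lia.
apply: (pascal_minor R IF IH).2 => i ir.
rewrite (FE (Ordinal ir)).
have [a1r|] := ltnP i.+1 r; first by rewrite (loE (Ordinal a1r)) fg.
by move=> ra; rewrite /lo insubN ?ltnS -?leqNgt //= ltnW.
Qed.

Lemma totpos_transfer m : totpos (transfer m).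
Proof. by apply: totpos_incr => r f g If Ig; have [] := minor_transfer If Ig. Qed.

(** One nonzero term suffices in a Cauchy-Binet sum without cancellation. *)
Lemma minor_mulmx_gt0 m n q r (A : 'M[R]_(m, n)) (B : 'M[R]_(n, q))
   (f : 'I_r -> 'I_m) (h : 'I_r -> 'I_n) (g : 'I_r -> 'I_q) : totpos A -> totpos B ->
  incr f -> incr g -> minor A f h * minor B h g != 0 -> 0 < minor (A *m B) f g.
Proof.
move=> tA tB If Ig hne.
have r0 : 0 < r`!%:R :> R by rewrite ltr0n fact_gt0.
rewrite lt_def totpos_minor_ge0 ?andbT //; last exact: totpos_mulmx.
rewrite -normr_eq0 -(inj_eq (mulfI (lt0r_neq0 r0))) mulr0 (abs_cauchy_binet _ _ tA tB).
rewrite psumr_neq0; last by move=> k _; apply: mulr_ge0.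
apply/hasP; exists [ffun i => h i]; first by rewrite mem_index_enum.
rewrite /= -normrM normr_gt0.
rewrite (eq_minor A (f' := f) (g' := h)) // ?(eq_minor B (f' := h) (g' := g)) // => i;
  by rewrite ffunE.
Qed.

Fact window_subproof r m a (h : (a + r <= m)%N) (i : 'I_r) : (a + i < m)%N.
Proof. by apply: leq_trans h; rewrite ltn_add2l. Qed.
Definition window r m a (h : (a + r <= m)%N) (i : 'I_r) : 'I_m := Ordinal (window_subproof h i).

Lemma window_incr r m a (h : (a + r <= m)%N) : incr (window h).
Proof. by move=> i j; rewrite /= ltn_add2l. Qed.

Lemma incr_lb r m (f : 'I_r -> 'I_m) (i : 'I_r) : incr f -> (i <= f i)%N.
Proof.
move=> If; case: i => i ir /=; elim: i ir => // i IH ir.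
have := IH (ltnW ir); have := If (Ordinal (ltnW ir)) (Ordinal ir) (ltnSn i); lia.
Qed.

Lemma incr_ub r m (f : 'I_r -> 'I_m) (i : 'I_r) : incr f -> (f i + r <= m + i)%N.
Proof.
move=> If.
have : forall d (i : 'I_r), (i + d < r)%N -> (f i + d < m)%N.
  elim=> [|d IH] j; first by rewrite !addn0 ltn_ord.
  move=> jd; have jr : (j.+1 < r)%N by lia.
  have := IH (Ordinal jr); rewrite /= addSnnS => /(_ jd).
  have := If j (Ordinal jr) (ltnSn _); lia.
move=> /(_ (r - i).-1 i); have := ltn_ord i; lia.
Qed.

(** Three kinds of positive minors are composed: any rows with the last [r]
    columns, the window of [r] consecutive indices moved down one position at a
    time from the last to the first place, and the first [r] rows with any
    columns. *)
Lemma transfer_strict m r : (r <= m)%N -> exists2 c, (0 < c)%N &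
  forall (f g : 'I_r -> 'I_m), incr f -> incr g -> 0 < minor (mxpow (transfer m) c) f g.
Proof.
move=> rm.
have h0 : (0 + r <= m)%N by [].
have h1 : (m - r + r <= m)%N by rewrite subnK.
have P0 (g : 'I_r -> 'I_m) : incr g -> 0 < minor (transfer m) (window h0) g.
  move=> Ig; apply: (minor_transfer (@window_incr _ _ _ h0) Ig).2 => a b ab /=.
  have := incr_lb b Ig; lia.
have P1 (f : 'I_r -> 'I_m) : incr f -> 0 < minor (transfer m) f (window h1).
  move=> If; apply: (minor_transfer If (@window_incr _ _ _ h1)).2 => a b ab /=.
  have := incr_ub a If; lia.
have tP := @totpos_transfer m.
have path a (ha : (a + r <= m)%N) : 0 < minor (mxpow (transfer m) a.+1) (window ha) (window h0).
  elim: a ha => [|a IH] ha.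
    rewrite mxpow1 (eq_minor _ (f' := window h0) (g' := window h0)) ?P0 // => i; exact/val_inj.
  have ha' : (a + r <= m)%N by lia.
  rewrite -add1n mxpowD mxpow1; apply: (minor_mulmx_gt0 (h := window ha')) => //; try exact: window_incr.
    exact: totpos_mxpow.
  apply: mulf_neq0; apply: lt0r_neq0; last exact: IH.
  apply: (minor_transfer (@window_incr _ _ _ ha) (@window_incr _ _ _ ha')).2 => i j ij /=; lia.
(* One step to the last columns, [(m - r).+1] steps to slide the window down,
   and one step to the columns [g]. *)
exists (m - r).+3 => // f g If Ig.
rewrite -addn1 mxpowD mxpow1; apply: (minor_mulmx_gt0 (h := window h0)) => //.
- exact: totpos_mxpow.
- apply: mulf_neq0; apply: lt0r_neq0; last exact: P0.
  rewrite -add1n mxpowD mxpow1; apply: (minor_mulmx_gt0 (h := window h1)) => //; try exact: window_incr.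
    exact: totpos_mxpow.
  by apply: mulf_neq0; apply: lt0r_neq0; [exact: P1|exact: path].
Qed.

End Transfer.

(** * The inverse of the transfer matrix and complementary minors *)

Section Inverse.
Variable R : realFieldType.

Lemma coef_XD1n k i : (('X + 1 : {poly R}) ^+ k)`_i = 'C(k, i)%:R.
Proof.
elim: k i => [|k IH] i; first by rewrite expr0 coef1 bin0n.
rewrite exprSr mulrDr mulr1 coefD coefMX !IH; case: i => [|i] /=; first by rewrite !bin0 add0r.
by rewrite binS natrD addrC.
Qed.

Lemma coef_shift (f : {poly R}) n i : (size f <= n)%N ->
  (f \Po ('X + 1))`_i = \sum_(k < n) f`_k * 'C(k, i)%:R.
Proof.
move=> fn; rewrite comp_polyE coef_sum.
under eq_bigr do rewrite coefZ coef_XD1n.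
rewrite -!(big_mkord xpredT (fun k => f`_k * 'C(k, i)%:R)).
rewrite [RHS](big_cat_nat (n := size f)) //= [X in _ = _ + X]big_nat_cond [X in _ = _ + X]big1 ?addr0 //.
by move=> k /andP[/andP[sk _] _]; rewrite nth_default // mul0r.
Qed.

(** Coefficients of orders 1 to [m].  The order 0 is left out because the
    polynomials of interest vanish at the knots. *)
Definition coef_tail m (f : {poly R}) : 'cV[R]_m := \col_i f`_(i.+1).

Lemma horner1_sum (f : {poly R}) n : (size f <= n)%N -> f.[1] = \sum_(k < n) f`_k.
Proof.
move=> fn; rewrite (horner_coef_wide 1 fn); apply: eq_bigr => k _.
by rewrite expr1n mulr1.
Qed.

(** The shift by 1 goes from one knot to the next. *)
Lemma coef_tail_shift m (f : {poly R}) : (size f <= m.+2)%N -> f`_0 = 0 -> f.[1] = 0 ->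
  coef_tail m (f \Po ('X + 1)) = - (transfer R m *m coef_tail m f).
Proof.
move=> sf f0 f1; apply/colP => i; rewrite !mxE (coef_shift _ sf).
move: f1; rewrite (horner1_sum sf) big_ord_recl big_ord_recr /= f0 add0r => f1.
rewrite big_ord_recl big_ord_recr /= f0 mul0r add0r.
under [in RHS]eq_bigr do rewrite !mxE mulrBl.
rewrite sumrB opprB -mulr_sumr; set A := \sum_(_ < m) _ in f1.
have -> : f`_(bump 0 m) = - A by apply/eqP; rewrite -addr_eq0 addrC f1.
rewrite mulNr mulrC [X in _ = _ - X]mulrC; congr (_ - _); last by rewrite mulrC.
by apply: eq_bigr => k _; rewrite mulrC.
Qed.

Definition altsign_mx m : 'M[R]_m := diag_mx (\row_i (-1) ^+ i).

Lemma altsign_mxK m : altsign_mx m *m altsign_mx m = 1%:M.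
Proof.
apply/matrixP => i j; rewrite mul_diag_mx !mxE; case: eqVneq => [->|]; rewrite ?mulr0 //.
by rewrite mulr1n -expr2 sqrr_sign.
Qed.

Lemma coef_tail_reflect m (f : {poly R}) : coef_tail m (f \Po (- 'X)) = - (altsign_mx m *m coef_tail m f).
Proof.
apply/colP => i; rewrite mul_diag_mx !mxE.
have -> : f \Po (- 'X) = \sum_(k < size f) (f`_k * (-1) ^+ k) *: 'X^k.
  rewrite comp_polyE; apply: eq_bigr => k _.
  by rewrite -scalerA (exprNn 'X); congr (_ *: _); rewrite -mul_polyC rmorph_sign.
have -> : \sum_(k < size f) (f`_k * (-1) ^+ k) *: 'X^k = \poly_(k < size f) (f`_k * (-1) ^+ k).
  by rewrite poly_def.
rewrite coef_poly; case: ltnP => sf; first by rewrite exprS; ring.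
by rewrite nth_default // mulr0 oppr0.
Qed.

(** The polynomial of degree at most [m.+1] that vanishes at 0 and 1 and has
    prescribed coefficients of orders 1 to [m]. *)
Definition null_poly m (y : 'cV[R]_m) : {poly R} :=
  \poly_(k < m.+2) (if k is k'.+1 then if insub k' is Some i then y i 0 else - \sum_i y i 0 else 0).

Lemma size_null_poly m (y : 'cV[R]_m) : (size (null_poly y) <= m.+2)%N.
Proof. exact: size_poly. Qed.

Lemma null_poly0 m (y : 'cV[R]_m) : (null_poly y)`_0 = 0.
Proof. by rewrite coef_poly. Qed.

Lemma coef_tail_null_poly m (y : 'cV[R]_m) : coef_tail m (null_poly y) = y.
Proof.
apply/colP => i; rewrite mxE coef_poly valK.
by rewrite ltnS (leqW (ltn_ord i)).
Qed.

Lemma null_poly1 m (y : 'cV[R]_m) : (null_poly y).[1] = 0.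
Proof.
rewrite (horner1_sum (size_null_poly y)) big_ord_recl big_ord_recr /= null_poly0 add0r.
rewrite [X in _ + X]coef_poly ltnSn /= insubF ?ltnn //.
apply/eqP; rewrite subr_eq0; apply/eqP; apply: eq_bigr => i _.
by have := congr1 (fun v : 'cV[R]_m => v i 0) (coef_tail_null_poly y); rewrite mxE.
Qed.

(** Going backwards along a null spline is going forwards along its reflection
    [f(-X)], whose coefficients are those of [f] with alternating signs.  With
    [P] the transfer matrix and [S] the alternating signs, [P^-1 = S P S]. *)
Lemma transfer_altsign_mx m : transfer R m *m altsign_mx m *m transfer R m = altsign_mx m.
Proof.
suff H (y : 'cV[R]_m) : transfer R m *m altsign_mx m *m transfer R m *m y = altsign_mx m *m y.
  apply/trmx_inj/row_matrixP => j; apply/trmx_inj; rewrite !tr_row !trmxK !colE; exact: H.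
pose f := null_poly y; pose g := f \Po ('X + 1).
have sX1 : size ('X + 1 : {poly R}) = 2 by rewrite -polyC1 size_XaddC.
have sN : size (- 'X : {poly R}) = 2 by rewrite size_polyN size_polyX.
have g0 : g`_0 = 0 by rewrite -horner_coef0 horner_comp !hornerE null_poly1.
have gm : g.[-1] = 0.
  by rewrite horner_comp !hornerE addNr horner_coef0 null_poly0.
have gE : coef_tail m g = - (transfer R m *m y).
  by rewrite (coef_tail_shift (size_null_poly y)) ?null_poly0 ?null_poly1 // coef_tail_null_poly.
have := @coef_tail_shift m (g \Po (- 'X)).
rewrite !size_comp_poly2 // size_null_poly => /(_ isT).
have e0 : (g \Po (- 'X))`_0 = 0 by rewrite -horner_coef0 horner_comp hornerN hornerX oppr0 horner_coef0.
have e1 : (g \Po (- 'X)).[1] = 0 by rewrite horner_comp hornerN hornerX gm.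
move=> /(_ e0 e1).
have -> : (g \Po - 'X) \Po ('X + 1) = f \Po (- 'X).
  rewrite /g -!comp_polyA; congr (_ \Po _).
  rewrite !(comp_polyD, comp_polyX, raddfN) /= -polyC1 !comp_polyC comp_polyX.
  by rewrite opprD subrK.
rewrite !coef_tail_reflect gE coef_tail_null_poly !mulmxN !opprK -!mulmxA => /esym.
exact: oppr_inj.
Qed.

Lemma mxpow_altsign_mx m k : mxpow (transfer R m) k *m (altsign_mx m *m mxpow (transfer R m) k *m altsign_mx m) = 1%:M.
Proof.
elim: k => [|k IH]; first by rewrite /= mul1mx mulmx1 altsign_mxK.
have -> : mxpow (transfer R m) k.+1 = mxpow (transfer R m) k *m transfer R m.
  by rewrite -addn1 mxpowD mxpow1.
have -> : mxpow (transfer R m) k *m transfer R m *m (altsign_mx m *m (mxpow (transfer R m) k *m transfer R m) *m altsign_mx m) =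
   mxpow (transfer R m) k *m transfer R m *m (altsign_mx m *m (transfer R m *m mxpow (transfer R m) k) *m altsign_mx m).
  by do 2 congr (_ *m _); congr (_ *m _); rewrite -[X in _ *m X = _]mxpow1 -[X in _ = X *m _]mxpow1 -!mxpowD addnC.
by rewrite !mulmxA -(mulmxA (mxpow _ k)) -(mulmxA (mxpow _ k)) transfer_altsign_mx -IH !mulmxA.
Qed.

(** A consequence of [P^-1 = S P S], which makes [det P] its own inverse. *)
Lemma det_transfer_pow m k : `|\det (mxpow (transfer R m) k)| = 1.
Proof.
have := congr1 (fun A => `|\det A|) (mxpow_altsign_mx m k).
have : `|\det (altsign_mx m)| ^+ 2 = 1 by rewrite expr2 -normrM -det_mulmx altsign_mxK det1 normr1.
rewrite !det_mulmx !normrM det1 normr1.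
set e := `|_|; set d := `|_| => e2 de.
have d0 : 0 <= d by exact: normr_ge0.
have : d ^+ 2 == 1.
  by rewrite -[X in _ == X]de -[X in X == _]mulr1 -e2; apply/eqP; ring.
by rewrite sqrf_eq1 => /orP[/eqP //|/eqP dN]; move: d0; rewrite dN oppr_ge0 ler10.
Qed.

(** Jacobi's identity for complementary minors of a matrix and its inverse:
    multiply [A] by the matrix whose first columns are those of the identity
    and whose last columns are those of [B]. *)
Lemma jacobi_block a b (A B : 'M[R]_(a + b)) : A *m B = 1%:M ->
  \det A * \det (drsubmx B) = \det (ulsubmx A).
Proof.
move=> AB.
have -> : \det (drsubmx B) = \det (block_mx 1%:M (ursubmx B) 0 (drsubmx B)).
  by rewrite det_ublock det1 mul1r.
rewrite -det_mulmx.
move: (AB); rewrite -{1}(submxK A) -{1}(submxK B) mulmx_block scalar_mx_block.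
move=> /eq_block_mx [_ e1 _ e2].
rewrite -{1}(submxK A) mulmx_block e1 e2 !mulmx0 !addr0 !mulmx1.
by rewrite det_lblock det1 mulr1.
Qed.

(** [jacobi_block] for the corner formed by the first rows and the last
    columns, which a permutation of the columns of [A] (and rows of [B]) brings
    in diagonal position.  The absolute values absorb the sign of that
    permutation. *)
Lemma jacobi_corner m a b (ha : (b + a <= m)%N) (hb : (a + b <= m)%N)
   (ha0 : (0 + a <= m)%N) (hb0 : (0 + b <= m)%N) (A B : 'M[R]_m) :
  (m = a + b)%N -> A *m B = 1%:M ->
  `|\det A| * `|minor B (window hb0) (window hb)| = `|minor A (window ha0) (window ha)|.
Proof.
move=> mab; subst m => AB.
pose sf (k : 'I_(a + b)) : 'I_(a + b) :=
  match fintype.split k with inl i => window ha i | inr j => window hb0 j end.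
have sfl i : sf (lshift b i) = window ha i by rewrite /sf (unsplitK (inl i)).
have sfr j : sf (rshift a j) = window hb0 j by rewrite /sf (unsplitK (inr j)).
have sfI : injective sf.
  move=> x y; rewrite -(splitK x) -(splitK y).
  case: (fintype.split x) => i; case: (fintype.split y) => j; rewrite /= ?sfl ?sfr => /(congr1 val) /=;
    move=> e; apply/val_inj => /=; have := ltn_ord i; have := ltn_ord j; lia.
pose s := perm sfI.
have AB' : col_perm s A *m row_perm s B = 1%:M.
  rewrite -AB; apply/matrixP => i j; rewrite !mxE [RHS](reindex_perm s) /=.
  by apply: eq_bigr => k _; rewrite !mxE.
have := congr1 (fun x => `|x|) (jacobi_block AB'); rewrite normrM.
have -> : `|\det (col_perm s A)| = `|\det A|.
  by rewrite -det_tr tr_col_perm row_permE det_mulmx det_perm normrM normr_sign mul1r det_tr.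
rewrite ulsubmxEsub drsubmxEsub; rewrite /minor.
suff [-> ->] : mxsub (window ha0) (window ha) A = mxsub (lshift b) (lshift b) (col_perm s A) /\
  mxsub (window hb0) (window hb) B = mxsub (rshift a (n:=b)) (rshift a (n:=b)) (row_perm s B) by [].
split; apply/matrixP => i j; rewrite !mxE permE ?sfl ?sfr; congr (_ _ _); exact/val_inj.
Qed.

End Inverse.

(** * Growth of the corner minors *)

Section Growth.
Variable R : realFieldType.

Lemma fin_ubound (X : finType) (phi : X -> R) : exists2 M : R, 0 < M & forall x, phi x <= M.
Proof.
exists (1 + \sum_x `|phi x|).
  by apply: ltr_pwDl => //; apply: sumr_ge0.
move=> x; apply: le_trans (ler_norm _) _; rewrite (bigD1 x) //= addrCA lerDl.
by apply: addr_ge0 => //; apply: sumr_ge0.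
Qed.

Lemma fin_lbound (X : finType) (phi : X -> R) :
  exists2 e : R, 0 < e & forall x, 0 < phi x -> e <= phi x.
Proof.
have [M M0 HM] := fin_ubound (fun x => (phi x)^-1).
exists M^-1; first by rewrite invr_gt0.
by move=> x px; rewrite -[leRHS]invrK lef_pV2 ?posrE ?invr_gt0.
Qed.

Lemma det_bound n (A : 'M[R]_n) (z : R) : (forall i j, `|A i j| <= z) ->
  `|\det A| <= n`!%:R * z ^+ n.
Proof.
move=> Az; rewrite /determinant; apply: le_trans (ler_norm_sum _ _ _) _.
rewrite -card_Sn -sumr_const mulr_suml; apply: ler_sum => s _.
rewrite mul1r normrM normr_sign mul1r normr_prod -[in leRHS](card_ord n) -prodr_const.
by apply: ler_prod => i _; rewrite normr_ge0 Az.
Qed.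

Section Compare.
Variables (m r : nat) (Q : 'M[R]_m).
Hypothesis Qpos : forall (f g : 'I_r -> 'I_m), incr f -> incr g -> 0 < minor Q f g.

Lemma compare_rows : exists2 k : R, 0 < k &
  forall (f f' g : 'I_r -> 'I_m), incr f' -> `|minor Q f g| <= k * `|minor Q f' g|.
Proof.
have [M M0 HM] := fin_ubound
  (fun x : {ffun 'I_r -> 'I_m} * {ffun 'I_r -> 'I_m} => `|minor Q x.1 x.2|).
have [e e0 He] := fin_lbound
  (fun x : {ffun 'I_r -> 'I_m} * {ffun 'I_r -> 'I_m} => minor Q x.1 x.2).
exists (M / e) => [|f f' g If']; first exact: divr_gt0.
have fE (h : 'I_r -> 'I_m) : h =1 [ffun i => h i] by move=> i; rewrite ffunE.
have [/sort_inj [s gs]|ng] := boolP (injectiveb g); last first.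
  by rewrite !(minor_noninjr _ _ ng) normr0 mulr0.
have E h : `|minor Q h g| = `|minor Q h (g \o s)|.
  by rewrite minor_permr normrM normr_sign mul1r.
rewrite !E mulrAC -mulrA.
apply: le_trans (_ : M <= _).
  have := HM ([ffun i => f i], [ffun i => (g \o s) i]).
  by rewrite /= -(eq_minor _ (fE f) (fE _)).
rewrite ler_pMr // ler_pdivlMr // mul1r.
have P := Qpos If' gs; rewrite (ger0_norm (ltW P)).
have := He ([ffun i => f' i], [ffun i => (g \o s) i]).
by rewrite /= -(eq_minor _ (fE f') (fE _)); apply.
Qed.
End Compare.

Lemma minor_tr_pos m r (Q : 'M[R]_m) :
  (forall (f g : 'I_r -> 'I_m), incr f -> incr g -> 0 < minor Q f g) ->
  (forall (f g : 'I_r -> 'I_m), incr f -> incr g -> 0 < minor Q^T f g).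
Proof. by move=> H f g If Ig; rewrite minor_trmx H. Qed.

Lemma fact0 r : 0 < r`!%:R :> R. Proof. by rewrite ltr0n fact_gt0. Qed.

(** In the Cauchy-Binet sum for [P^k = P^c P^(k-c)] the row indices only enter
    through [P^c], all of whose minors of order [r] are positive
    ([transfer_strict]), so changing them costs a bounded factor; columns are
    treated alike. *)
Lemma minors_comparable m r : (r <= m)%N -> exists k0 : nat, exists2 K : R, 0 < K &
  forall k, (k0 <= k)%N -> forall (f g f' g' : 'I_r -> 'I_m), incr f' -> incr g' ->
    0 < minor (mxpow (transfer R m) k) f' g' /\
    `|minor (mxpow (transfer R m) k) f g| <= K * minor (mxpow (transfer R m) k) f' g'.
Proof.
move=> rm; have [c c0 Qpos] := transfer_strict R rm.
have tP := @totpos_transfer R m.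
have [k1 k1p H1] := compare_rows Qpos.
have [k2 k2p H2] := compare_rows (minor_tr_pos Qpos).
exists (c + c).+1, (k1 * k2); first exact: mulr_gt0.
move=> k ck f g f' g' If' Ig'.
have pos : 0 < minor (mxpow (transfer R m) k) f' g'.
  have -> : k = ((k - c) + c)%N by lia.
  rewrite mxpowD; apply: (minor_mulmx_gt0 (h := f')) => //; try by apply: totpos_mxpow => //; lia.
  apply: mulf_neq0; last by rewrite lt0r_neq0 ?Qpos.
  have : forall d, 0 < minor (mxpow (transfer R m) (c + d)) f' f'.
    elim=> [|d IH]; first by rewrite addn0 Qpos.
    have Pd : 0 < minor (transfer R m) f' f'.
      apply: (minor_transfer R If' If').2 => a b ab; apply: ltnW; apply: If'; rewrite ab; lia.
    rewrite addnS -addn1 mxpowD mxpow1; apply: (minor_mulmx_gt0 (h := f')) => //.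
      by apply: totpos_mxpow => //; lia.
    by apply: mulf_neq0; rewrite lt0r_neq0.
  by move=> /(_ (k - c - c)%N); rewrite (_ : c + (k - c - c) = k - c)%N; [exact: lt0r_neq0|lia].
split=> //.
rewrite -[X in _ <= _ * X](ger0_norm (ltW pos)) -mulrA.
apply: le_trans (_ : k1 * `|minor (mxpow (transfer R m) k) f' g| <= _).
  have -> : k = (c + (k - c))%N by lia.
  rewrite mxpowD -(ler_pM2l (fact0 r)) mulrCA !abs_cauchy_binet; try by apply: totpos_mxpow => //; lia.
  rewrite mulr_sumr; apply: ler_sum => h _.
  by rewrite mulrA ler_wpM2r // H1.
rewrite ler_pM2l //.
have -> : k = ((k - c) + c)%N by lia.
rewrite mxpowD -(ler_pM2l (fact0 r)) mulrCA !abs_cauchy_binet; try by apply: totpos_mxpow => //; lia.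
rewrite mulr_sumr; apply: ler_sum => h _.
by rewrite mulrCA ler_wpM2l // -!(minor_trmx (mxpow _ c)) H2.
Qed.

Definition first_idx m r (rm : (r <= m)%N) : 'I_r -> 'I_m := @window r m 0 rm.
Fact last_idx_subproof m r (rm : (r <= m)%N) : (m - r + r <= m)%N. Proof. by rewrite subnK. Qed.
Definition last_idx m r (rm : (r <= m)%N) : 'I_r -> 'I_m := window (last_idx_subproof rm).
(** The minor of the k-th power of the transfer matrix [P] with which the other
    minors of order [r] are compared; denoted [D_r(k)] below. *)
Definition corner m r (rm : (r <= m)%N) k := minor (mxpow (transfer R m) k) (first_idx rm) (last_idx rm).

Lemma first_idx_incr m r (rm : (r <= m)%N) : incr (first_idx rm). Proof. exact: window_incr. Qed.
Lemma last_idx_incr m r (rm : (r <= m)%N) : incr (last_idx rm). Proof. exact: window_incr. Qed.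

(** A single term of the Cauchy-Binet sum for [P^a P^b] suffices, once [D_r(b)]
    has been compared with another minor of [P^b]. *)
Lemma corner_mul m r (rm : (r <= m)%N) : exists k0 : nat, exists2 K : R, 0 < K &
  forall a b, (k0 <= a)%N -> (k0 <= b)%N ->
  corner rm a * corner rm b <= K * corner rm (a + b).
Proof.
have [k0 [K K0 HK]] := minors_comparable rm.
exists k0.+1, (K * r`!%:R); first by rewrite mulr_gt0 ?fact0.
move=> a b ka kb.
have [pa _] := HK a (ltnW ka) (first_idx rm) (first_idx rm) _ _ (first_idx_incr rm) (last_idx_incr rm).
have [pb _] := HK b (ltnW kb) (first_idx rm) (first_idx rm) _ _ (first_idx_incr rm) (last_idx_incr rm).
have [pbb Hb] := HK b (ltnW kb) (first_idx rm) (last_idx rm) _ _ (last_idx_incr rm) (last_idx_incr rm).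
have [pab _] := HK (a + b)%N (leq_trans (ltnW ka) (leq_addr _ _)) (first_idx rm) (last_idx rm) _ _ (first_idx_incr rm) (last_idx_incr rm).
apply: le_trans (_ : corner rm a * (K * minor (mxpow (transfer R m) b) (last_idx rm) (last_idx rm)) <= _).
  by rewrite ler_pM2l //; apply: le_trans (ler_norm _) Hb.
rewrite mulrCA -mulrA ler_pM2l // -[X in _ <= _ * X](ger0_norm (ltW pab)) /corner mxpowD.
rewrite abs_cauchy_binet; try by apply: totpos_mxpow; [exact: totpos_transfer|lia].
rewrite (bigD1 [ffun i => last_idx rm i]) //=.
have E : [ffun i => last_idx rm i] =1 last_idx rm by move=> i; rewrite ffunE.
rewrite (eq_minor _ (frefl _) E) (eq_minor _ E (frefl _)) (ger0_norm (ltW pa)) (ger0_norm (ltW pbb)).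
by rewrite lerDl; apply: sumr_ge0 => h _; apply: mulr_ge0.
Qed.

Lemma minor_altsign_mx m r (A : 'M[R]_m) (f g : 'I_r -> 'I_m) :
  `|minor (altsign_mx R m *m A *m altsign_mx R m) f g| = `|minor A f g|.
Proof.
have -> : minor (altsign_mx R m *m A *m altsign_mx R m) f g =
  \det (diag_mx (\row_i (-1) ^+ f i) *m mxsub f g A *m diag_mx (\row_i (-1) ^+ g i)).
  congr (\det _); apply/matrixP => i j.
  by rewrite mul_mx_diag mul_diag_mx [LHS]mxE mul_mx_diag mul_diag_mx !mxE.
rewrite !det_mulmx !det_diag !normrM !normr_prod.
rewrite big1 ?mul1r => [|i _]; last by rewrite mxE normr_sign.
by rewrite big1 ?mulr1 // => i _; rewrite mxE normr_sign.
Qed.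

(** Jacobi's identity for [P^k]: its determinant is 1 in absolute value, and
    its inverse is [P^k] itself up to signs of rows and columns. *)
Lemma corner_dual m r s (rm : (r <= m)%N) (sm : (s <= m)%N) k : (m = r + s)%N ->
  `|corner rm k| = `|corner sm k|.
Proof.
move=> E.
have hs : (r + s <= m)%N by rewrite E.
have hr : (s + r <= m)%N by rewrite E addnC.
rewrite /corner -[RHS]minor_altsign_mx.
have H := @jacobi_corner R m r s hr hs rm sm _ _ E (mxpow_altsign_mx R m k).
rewrite det_transfer_pow mul1r in H.
rewrite (eq_minor _ (frefl _) (_ : last_idx rm =1 window hr)); last by move=> i; apply/val_inj => /=; rewrite E addKn.
rewrite (eq_minor (_ *m _) (frefl _) (_ : last_idx sm =1 window hs)); last by move=> i; apply/val_inj => /=; rewrite E addnK.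
by rewrite H.
Qed.

(** Inside the block of order [r.+2], Jacobi's identity expresses [D_r] by a
    2 x 2 minor of the inverse, whose entries are minors of order [r.+1],
    comparable to [D_(r+1)], divided by [D_(r+2)]. *)
Lemma corner_logconcave m r (r0m : (r <= m)%N) (r1m : (r.+1 <= m)%N) (r2m : (r.+2 <= m)%N) :
  exists k0 : nat, exists2 K : R, 0 < K & forall k, (k0 <= k)%N ->
  corner r0m k * corner r2m k <= K * corner r1m k ^+ 2.
Proof.
have [k0 [K K0 HK]] := minors_comparable r1m.
have [k2 [K2 _ HK2]] := minors_comparable r2m.
exists (maxn k0 k2), (2 * K ^+ 2); first by rewrite mulr_gt0 ?exprn_gt0.
move=> k; rewrite geq_max => /andP[kk0 kk2].
have [p2 _] := HK2 k kk2 (first_idx r2m) (last_idx r2m) _ _ (first_idx_incr r2m) (last_idx_incr r2m).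
have [p1 _] := HK k kk0 (first_idx r1m) (last_idx r1m) _ _ (first_idx_incr r1m) (last_idx_incr r1m).
set A := mxpow (transfer R m) k.
pose X := mxsub (first_idx r2m) (last_idx r2m) A.
have dX : \det X = corner r2m k by [].
have uX : X \in unitmx by rewrite unitmxE unitfE dX lt0r_neq0.
have e2 : (r.+2 = r + 2)%N by lia.
have h2 : (r + 2 <= r.+2)%N by lia.
have hr : (2 + r <= r.+2)%N by lia.
have hr0 : (0 + r <= r.+2)%N by lia.
have H := @jacobi_corner R r.+2 r 2 hr h2 hr0 isT X (invmx X) e2 (mulmxV uX).
have E : minor X (window hr0) (window hr) = corner r0m k.
  rewrite /corner -/A -(eq_minor A (f := first_idx r2m \o window hr0) (g := last_idx r2m \o window hr)) //; last first.
  - by move=> i; apply/val_inj => /=; lia.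
  - by move=> i; apply/val_inj.
  by congr (\det _); apply/matrixP => i j; rewrite !mxE.
have Yb i j : `|invmx X i j| <= K * corner r1m k / corner r2m k.
  rewrite /invmx uX mxE normrM normfV dX (ger0_norm (ltW p2)) mulrC ler_pM2r ?invr_gt0 //.
  rewrite mxE /cofactor normrM normrX normrN1 expr1n mul1r.
  have -> : \det (row' j (col' i X)) = minor A (first_idx r2m \o lift j) (last_idx r2m \o lift i).
    by congr (\det _); apply/matrixP => a b; rewrite !mxE.
  have [_] := HK k kk0 (first_idx r2m \o lift j) (last_idx r2m \o lift i) _ _ (first_idx_incr r1m) (last_idx_incr r1m).
  by [].
have := @det_bound 2 (mxsub (window (isT : (0 + 2 <= r.+2)%N)) (window h2) (invmx X)) _
   (fun i j => _ : `|_ i j| <= K * corner r1m k / corner r2m k).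
move=> /(_ (fun i j => ltac:(rewrite mxE; exact: Yb))) B.
rewrite E in H; rewrite dX ger0_norm ?ltW // in H.
have Hc : `|corner r0m k| <= corner r2m k * (2 * (K * corner r1m k / corner r2m k) ^+ 2).
  by rewrite -H ler_pM2l.
apply: le_trans (_ : `|corner r0m k| * corner r2m k <= _).
  by rewrite ler_pM2r // ler_norm.
apply: le_trans (ler_wpM2r (ltW p2) Hc) _.
rewrite le_eqVlt; apply/orP; left; apply/eqP.
have := lt0r_neq0 p2; rewrite -/(corner r2m k).
move: (corner r2m k) (corner r1m k) => x y x0.
by field.
Qed.

Lemma corner_mid (r : nat) (rm : (r <= r + r.+1)%N) (sm : (r.+1 <= r + r.+1)%N) :
  exists k0, forall k, (k0 <= k)%N -> corner rm k = corner sm k.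
Proof.
have [k1 [K1 _ H1]] := minors_comparable rm.
have [k2 [K2 _ H2]] := minors_comparable sm.
exists (maxn k1 k2) => k; rewrite geq_max => /andP[kk1 kk2].
have [p1 _] := H1 k kk1 (first_idx rm) (last_idx rm) _ _ (first_idx_incr rm) (last_idx_incr rm).
have [p2 _] := H2 k kk2 (first_idx sm) (last_idx sm) _ _ (first_idx_incr sm) (last_idx_incr sm).
by have := corner_dual rm sm k erefl; rewrite !ger0_norm ?ltW.
Qed.

(** In dimension [2 r + 3] the orders [r.+1] and [r.+2] are complementary, so
    that [D_(r+1) = D_(r+2)] and log-concavity simplifies to
    [D_r <= K D_(r+1)]. *)
Lemma corner_pred (r : nat) (qm : (r <= r.+1 + r.+2)%N) (rm : (r.+1 <= r.+1 + r.+2)%N) :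
  exists k0 : nat, exists2 K : R, 0 < K & forall k, (k0 <= k)%N -> corner qm k <= K * corner rm k.
Proof.
have sm : (r.+2 <= r.+1 + r.+2)%N by lia.
have [k1 H1] := corner_mid rm sm.
have [k2 [K K0 H2]] := corner_logconcave qm rm sm.
have [k3 [K3 _ H3]] := minors_comparable rm.
exists (maxn k1 (maxn k2 k3)), K => // k; rewrite !geq_max => /and3P[a b c].
have [p1 _] := H3 k c (first_idx rm) (last_idx rm) _ _ (first_idx_incr rm) (last_idx_incr rm).
have := H2 k b; rewrite -(H1 k a) expr2 mulrA ler_pM2r //.
Qed.

End Growth.

(** * Chains of states *)

Section Chains.
Variable R : realFieldType.

Definition l1norm n (x : 'cV[R]_n) : R := \sum_i `|x i 0|.

Lemma l1norm_ge0 n (x : 'cV[R]_n) : 0 <= l1norm x.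
Proof. by apply: sumr_ge0. Qed.

Lemma l1normN n (x : 'cV[R]_n) : l1norm (- x) = l1norm x.
Proof. by apply: eq_bigr => i _; rewrite mxE normrN. Qed.

Lemma l1normD n (x y : 'cV[R]_n) : l1norm (x + y) <= l1norm x + l1norm y.
Proof. by rewrite -big_split /=; apply: ler_sum => i _; rewrite mxE ler_normD. Qed.

Lemma l1norm_mulmx m n (A : 'M[R]_(m, n)) (x : 'cV[R]_n) (z : R) :
  (forall i j, `|A i j| <= z) -> l1norm (A *m x) <= m%:R * z * l1norm x.
Proof.
move=> Az; have -> : m%:R = \sum_(i < m) 1 :> R by rewrite sumr_const card_ord.
rewrite !mulr_suml.
apply: ler_sum => i _; rewrite mul1r mxE mulr_sumr.
apply: le_trans (ler_norm_sum _ _ _) _; apply: ler_sum => j _.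
by rewrite normrM ler_wpM2r.
Qed.

Lemma entry_bound m n (A : 'M[R]_(m, n)) : exists2 z : R, 0 < z & forall i j, `|A i j| <= z.
Proof.
have [z z0 H] := fin_ubound (fun x : 'I_m * 'I_n => `|A x.1 x.2|).
by exists z => // i j; have := H (i, j).
Qed.

Lemma l1norm_mulmx_ex m n (A : 'M[R]_(m, n)) : exists2 c : R, 1 <= c &
  forall x, l1norm (A *m x) <= c * l1norm x.
Proof.
have [z z0 H] := entry_bound A.
exists (1 + m%:R * z); first by rewrite lerDl mulr_ge0 // ltW.
move=> x; apply: le_trans (l1norm_mulmx x H) _.
by rewrite mulrDl mul1r lerDr l1norm_ge0.
Qed.

Lemma l1norm_pow m (A : 'M[R]_m) c k x : 1 <= c -> (forall x, l1norm (A *m x) <= c * l1norm x) ->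
  l1norm (mxpow A k *m x) <= c ^+ k * l1norm x.
Proof.
move=> c1 H; elim: k x => [|k IH] x; first by rewrite mul1mx expr0 mul1r.
rewrite /= -mulmxA; apply: le_trans (H _) _.
by rewrite exprS -mulrA ler_wpM2l // (le_trans ler01).
Qed.

Lemma l1norm_invmx n (W : 'M[R]_n) x (d a : R) : 0 < d -> d <= `|\det W| ->
  (forall i j, `|cofactor W i j| <= a) -> l1norm x <= n%:R * (a / d) * l1norm (W *m x).
Proof.
move=> d0 dW cW.
have u : W \in unitmx by rewrite unitmxE unitfE -normr_gt0 (lt_le_trans d0).
rewrite -[in leLHS](mulKmx u x); apply: l1norm_mulmx => i j.
rewrite /invmx u !mxE normrM normfV [leLHS]mulrC.
apply: ler_pM; rewrite ?invr_ge0 //.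
by rewrite lef_pV2 // posrE (lt_le_trans d0).
Qed.

Lemma cofactor_bound n (W : 'M[R]_n) (z : R) i j : (forall i j, `|W i j| <= z) ->
  `|cofactor W i j| <= (n.-1)`!%:R * z ^+ n.-1.
Proof.
move=> H; rewrite /cofactor normrM normrX normrN1 expr1n mul1r.
by apply: det_bound => a b; rewrite !mxE.
Qed.

(** Cramer's rule.  The entries are quotients of minors of [A], so they are
    bounded when the minors of [A] are comparable. *)
Lemma cramer_rows s m n (A : 'M[R]_(m, n)) (f : 'I_s -> 'I_m) (g : 'I_s -> 'I_n) i b :
  minor A f g != 0 ->
  (colsub g A *m invmx (mxsub f g A)) i b =
    minor A (fun a => if a == b then i else f a) g / minor A f g.
Proof.
move=> ne.
have u : mxsub f g A \in unitmx by rewrite unitmxE unitfE.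
rewrite /invmx u -scalemxAr mxE mulrC; congr (_ / _).
rewrite mxE /minor (expand_det_row _ b); apply: eq_bigr => c _.
rewrite !mxE eqxx; congr (_ * (_ * \det _)).
by apply/matrixP => x y; rewrite !mxE eq_sym (negbTE (neq_lift _ _)).
Qed.

Lemma cramer_cols s m n (A : 'M[R]_(m, n)) (f : 'I_s -> 'I_m) (g : 'I_s -> 'I_n) b j :
  minor A f g != 0 ->
  (invmx (mxsub f g A) *m rowsub f A) b j =
    minor A f (fun a => if a == b then j else g a) / minor A f g.
Proof.
move=> ne.
have := @cramer_rows _ _ _ A^T g f j b; rewrite !minor_trmx => /(_ ne) <-.
have -> : colsub f A^T = (rowsub f A)^T by apply/matrixP => x y; rewrite !mxE.
have -> : mxsub g f A^T = (mxsub f g A)^T by apply/matrixP => x y; rewrite !mxE.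
by rewrite -trmx_inv -trmx_mul [RHS]mxE.
Qed.

Lemma rowsub_mulmx m n s (A : 'M[R]_(m, n)) (f : 'I_s -> 'I_m) p (B : 'M[R]_(n, p)) :
  rowsub f (A *m B) = rowsub f A *m B.
Proof. by apply/matrixP => i j; rewrite !mxE; apply: eq_bigr => k _; rewrite !mxE. Qed.

Lemma colsub_mulmx m n s (A : 'M[R]_(m, n)) p (B : 'M[R]_(n, p)) (g : 'I_s -> 'I_p) :
  colsub g (A *m B) = A *m colsub g B.
Proof. by apply/matrixP => i j; rewrite !mxE; apply: eq_bigr => k _; rewrite !mxE. Qed.

Notation P m := (transfer R m).

(** The inverse of [P] is bounded, so a bounded number of steps of a chain can
    be absorbed into the constants. *)
Lemma transfer_lower m : exists2 c : R, 1 <= c & forall k x, l1norm x <= c ^+ k * l1norm (mxpow (P m) k *m x).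
Proof.
pose Q := altsign_mx R m *m P m *m altsign_mx R m.
have [c c1 H] := l1norm_mulmx_ex Q.
have QP : Q *m P m = 1%:M.
  by apply: mulmx1C; have := mxpow_altsign_mx R m 1; rewrite mxpow1.
exists c => // k x; elim: k x => [|k IH] x; first by rewrite mul1mx expr0 mul1r.
have {1}-> : x = Q *m (P m *m x) by rewrite mulmxA QP mul1mx.
apply: le_trans (H _) _; rewrite exprS -mulrA ler_wpM2l ?(le_trans ler01) //.
by rewrite mxpowSr -mulmxA.
Qed.

Lemma colsub_last m s (sm : (s <= m)%N) p (A : 'M[R]_(p, m)) (u : 'cV[R]_m) :
  (forall i : 'I_m, (i < m - s)%N -> u i 0 = 0) ->
  A *m u = colsub (last_idx sm) A *m rowsub (last_idx sm) u.
Proof.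
have [d md] : exists d, m = (d + s)%N by exists (m - s)%N; rewrite subnK.
subst m => u0; apply/colP => i; rewrite !mxE big_split_ord /= big1 ?add0r => [|j _].
  by apply: eq_bigr => j _; rewrite !mxE; congr (A i _ * u _ 0); apply/val_inj; rewrite /= addnK.
by rewrite u0 ?mulr0 //= addnK.
Qed.

Lemma l1norm_rowsub_first m s (sm : (s <= m)%N) (x : 'cV[R]_m) :
  l1norm (rowsub (first_idx sm) x) <= l1norm x.
Proof.
have [d md] : exists d, m = (s + d)%N by exists (m - s)%N; rewrite subnKC.
subst m; rewrite /l1norm [leRHS]big_split_ord /=; apply: ler_wpDr; first by apply: sumr_ge0.
rewrite le_eqVlt; apply/orP; left; apply/eqP; apply: eq_bigr => i _.
by rewrite mxE; congr `|x _ 0|; apply/val_inj.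
Qed.

(** The chain starts with only its last [s] coordinates nonzero.  Then [P^j u]
    is the image of its first [s] coordinates under a bounded matrix (Cramer's
    rule), and the [s] x [s] matrix [W] that carries these coordinates over [i]
    steps has determinant [D_s(i+j) / D_s(j)], at least a multiple of [D_s(i)],
    while its cofactors are bounded by minors of order [s.-1] of [P^i], hence
    by [D_s(i)] under the hypothesis.  So the inverse of [W] is bounded, and
    the chain cannot decrease by more than a constant factor. *)
Lemma chain_mono m s (sm : (s <= m)%N) :
  (s = 0%N \/ exists qm : (s.-1 <= m)%N, exists k0 : nat, exists2 K : R, 0 < K &
     forall k, (k0 <= k)%N -> corner R qm k <= K * corner R sm k) ->
  exists2 K : R, 0 < K & forall u : 'cV[R]_m, (forall i : 'I_m, (i < m - s)%N -> u i 0 = 0) ->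
    forall j i, l1norm (mxpow (P m) j *m u) <= K * l1norm (mxpow (P m) (i + j) *m u).
Proof.
move=> [s0|[qm [k1 [K1 K1p H1]]]].
  exists 1 => // u u0 j i; suff -> : u = 0 by rewrite !mulmx0 mul1r.
  by apply/colP => a; rewrite mxE u0 // s0 subn0.
have [k2 [K2 K2p H2]] := minors_comparable R sm.
have [k3 [K3 K3p H3]] := corner_mul R sm.
have [k4 [K4 K4p H4]] := minors_comparable R qm.
have [c c1 Hc] := transfer_lower m.
pose k0 := maxn k1 (maxn k2 (maxn k3 k4)).
have [le1 le2 le3 le4] : [/\ k1 <= k0, k2 <= k0, k3 <= k0 & k4 <= k0]%N.
  by rewrite /k0 !leq_max !leqnn ?orbT.
(* [transfer_lower] deals with fewer than [2 * k0] steps, and replaces [j] by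
   [k0 + j] otherwise. *)
suff [K Kp HK] : exists2 K : R, 0 < K & forall u : 'cV[R]_m, (forall i : 'I_m, (i < m - s)%N -> u i 0 = 0) ->
    forall j i, (k0 <= j)%N -> (k0 <= i)%N -> l1norm (mxpow (P m) j *m u) <= K * l1norm (mxpow (P m) (i + j) *m u).
  have cp k : 0 < c ^+ k by rewrite exprn_gt0 // (lt_le_trans ltr01).
  exists (c ^+ (2 * k0) * (1 + K)) => [|u u0 j i]; first by rewrite mulr_gt0 // addr_gt0.
  have [ik|ik] := ltnP i (2 * k0).
    rewrite mxpowD -mulmxA; apply: le_trans (Hc i _) _; rewrite ler_wpM2r ?l1norm_ge0 //.
    apply: le_trans (_ : c ^+ (2 * k0) <= _); first by rewrite ler_weXn2l // ltnW.
    by rewrite ler_pMr // lerDl ltW.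
  apply: le_trans (Hc k0 _) _; rewrite mulmxA -mxpowD -mulrA; apply: ler_pM.
  - exact: ltW.
  - exact: l1norm_ge0.
  - by rewrite ler_weXn2l // leq_pmull.
  have := HK u u0 (k0 + j)%N (i - k0)%N (leq_addr _ _); rewrite (_ : i - k0 + (k0 + j) = i + j)%N; last by lia.
  rewrite (_ : (k0 <= i - k0)%N); last by lia.
  by move=> /(_ isT) /le_trans; apply; rewrite ler_wpM2r ?l1norm_ge0 // lerDr.
have K4' : 0 < s.-1`!%:R :> R by exact: fact0.
pose cB := (#|{ffun 'I_s.-1 -> 'I_m}|%:R * (K4 * K1 * (s.-1`!%:R * K2 ^+ s.-1))) / s.-1`!%:R.
have K2s : 0 <= K2 ^+ s.-1 by rewrite exprn_ge0 // ltW.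
have cB0 : 0 <= cB by rewrite /cB divr_ge0 // !mulr_ge0 // ltW.
exists (m%:R * K2 * (s%:R * (cB * K3)) + 1).
  have p1 : 0 <= cB * K3 by apply: mulr_ge0 => //; exact: ltW.
  have p2 : 0 <= m%:R * K2 by apply: mulr_ge0 => //; exact: ltW.
  by apply: ltr_wpDl => //; apply: mulr_ge0 => //; apply: mulr_ge0.
move=> u u0 j i kj ki.
have kj2 := leq_trans le2 kj; have ki1 := leq_trans le1 ki; have ki2 := leq_trans le2 ki.
have ki4 := leq_trans le4 ki.
have Dp k (kk : (k2 <= k)%N) : 0 < corner R sm k.
  by have [] := H2 k kk (first_idx sm) (last_idx sm) _ _ (first_idx_incr sm) (last_idx_incr sm).
pose E := mxsub (first_idx sm) (last_idx sm) (mxpow (P m) j).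
have dE : \det E = corner R sm j by [].
have dE0 : corner R sm j != 0 by rewrite lt0r_neq0 ?Dp.
have uE : E \in unitmx by rewrite unitmxE unitfE dE.
pose B := colsub (last_idx sm) (mxpow (P m) j) *m invmx E.
have Bb a b : `|B a b| <= K2.
  rewrite /B cramer_rows // normrM normfV (ger0_norm (ltW (Dp j kj2))) ler_pdivrMr ?Dp //.
  by have [] := H2 j kj2 (fun x => if x == b then a else first_idx sm x) (last_idx sm) _ _ (first_idx_incr sm) (last_idx_incr sm).
pose z := rowsub (first_idx sm) (mxpow (P m) j *m u).
have uB : mxpow (P m) j *m u = B *m z.
  rewrite /z (colsub_last sm _ u0) rowsub_mulmx /B -mulmxA; congr (_ *m _).
  rewrite (_ : rowsub (first_idx sm) _ = E) ?mulKmx //; by apply/matrixP => a b; rewrite !mxE.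
pose W := rowsub (first_idx sm) (mxpow (P m) i) *m B.
have Wz : W *m z = rowsub (first_idx sm) (mxpow (P m) (i + j) *m u).
  by rewrite /W -mulmxA -uB mxpowD -mulmxA rowsub_mulmx.
have dW : \det W = corner R sm (i + j) / corner R sm j.
  rewrite /W /B mulmxA det_mulmx det_inv dE; congr (\det _ / _).
  by rewrite mxpowD -colsub_mulmx -rowsub_mulmx; apply/matrixP => a b; rewrite [LHS]mxE [LHS]mxE [RHS]mxE.
have dWl : corner R sm i / K3 <= `|\det W|.
  rewrite dW normrM normfV (ger0_norm (ltW (Dp j kj2))) ger0_norm; last exact/ltW/Dp/(leq_trans kj2 (leq_addl _ _)).
  rewrite ler_pdivrMr // mulrAC ler_pdivlMr ?Dp // [leRHS]mulrC.
  by apply: H3; [exact: leq_trans le3 ki|exact: leq_trans le3 kj].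
have cW a b : `|cofactor W a b| <= cB * corner R sm i.
  rewrite /cofactor normrM normrX normrN1 expr1n mul1r.
  have -> : \det (row' a (col' b W)) = minor (mxpow (P m) i *m B) (first_idx sm \o lift a) (lift b).
    by congr (\det _); apply/matrixP => x y; rewrite /W -rowsub_mulmx !mxE.
  rewrite /cB mulrAC ler_pdivlMr // mulrC -[X in X * _](ger0_norm (ltW K4')) -normrM cauchy_binet.
  apply: le_trans (ler_norm_sum _ _ _) _.
  apply: le_trans (_ : \sum_(h : {ffun 'I_s.-1 -> 'I_m})
      K4 * (K1 * corner R sm i) * (s.-1`!%:R * K2 ^+ s.-1) <= _); last first.
    by rewrite sumr_const -mulr_natl le_eqVlt; apply/orP; left; apply/eqP; ring.
  apply: ler_sum => h _; rewrite normrM; apply: ler_pM => //.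
    have [_ /le_trans] := H4 i ki4 (first_idx sm \o lift a) h _ _ (first_idx_incr qm) (last_idx_incr qm).
    by apply; rewrite ler_pM2l // H1.
  by apply: det_bound => x y; rewrite mxE.
have Di := Dp i ki2.
have zb := @l1norm_invmx _ W z _ _ (divr_gt0 Di K3p) dWl cW.
rewrite uB; apply: le_trans (l1norm_mulmx z Bb) _.
have lez : l1norm (W *m z) <= l1norm (mxpow (P m) (i + j) *m u).
  rewrite Wz; exact: l1norm_rowsub_first.
rewrite mulrDl mul1r; apply: ler_wpDr; first exact: l1norm_ge0.
rewrite -[leRHS]mulrA; apply: ler_wpM2l; first by rewrite mulr_ge0 // ltW.
apply: le_trans zb _; rewrite (_ : cB * corner R sm i / (corner R sm i / K3) = cB * K3); last first.
  by field; rewrite !lt0r_neq0.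
apply: ler_wpM2l => //; apply: mulr_ge0 => //; apply: mulr_ge0 => //; exact: ltW.
Qed.

Lemma mxpow_inv m k : exists Q : 'M[R]_m, Q *m mxpow (P m) k = 1%:M /\ mxpow (P m) k *m Q = 1%:M.
Proof.
exists (altsign_mx R m *m mxpow (P m) k *m altsign_mx R m); split; last exact: mxpow_altsign_mx.
exact/mulmx1C/mxpow_altsign_mx.
Qed.

(** In [u] only the last [r] coordinates may be nonzero, in [w] only the last
    [r.+1].  Keeping the first [r] coordinates of the relation at step [N]
    eliminates [w] and leaves, for the first [r] coordinates of [P^k u], a
    square system with bounded entries and with determinant
    [D_r(N) / (D_r(k) D_r(N-k))], which [corner_mul] bounds below. *)
Lemma chain_match r : exists N0 : nat, exists2 K : R, 0 < K &
  forall N k (u w q : 'cV[R]_(r + r.+1)), (N0 <= N)%N -> (k <= N)%N ->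
   (forall i : 'I_(r + r.+1), (i < r.+1)%N -> u i 0 = 0) ->
   (forall i : 'I_(r + r.+1), (i < r)%N -> w i 0 = 0) ->
   mxpow (P _) N *m u - w = mxpow (P _) (N - k) *m q ->
   l1norm (mxpow (P _) k *m u) <= K * l1norm q.
Proof.
set m := (r + r.+1)%N; have rm : (r <= m)%N by exact: leq_addr.
have [k2 [K2 K2p H2]] := minors_comparable R rm.
have [k3 [K3 K3p H3]] := corner_mul R rm.
have [c c1 Hc] := transfer_lower m.
have [d d1 Hd] := l1norm_mulmx_ex (P m).
pose k0 := maxn k2 k3.
have [le2 le3] : (k2 <= k0)%N /\ (k3 <= k0)%N by rewrite /k0 leq_maxl leq_maxr.
have Dp k (kk : (k2 <= k)%N) : 0 < corner R rm k.
  by have [] := H2 k kk (first_idx rm) (last_idx rm) _ _ (first_idx_incr rm) (last_idx_incr rm).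
(* A step closer than [k0] to one of the ends is moved away from it, which costs
   a bounded factor. *)
suff [K Kp HK] : exists2 K : R, 0 < K &
  forall N k (u w q : 'cV[R]_m), (k0 <= k)%N -> (k + k0 <= N)%N ->
   (forall i : 'I_m, (i < r.+1)%N -> u i 0 = 0) ->
   (forall i : 'I_m, (i < r)%N -> w i 0 = 0) ->
   mxpow (P _) N *m u - w = mxpow (P _) (N - k) *m q ->
   l1norm (mxpow (P _) k *m u) <= K * l1norm q.
  have [cp dp] : 0 < c /\ 0 < d by split; exact: lt_le_trans ltr01 _.
  exists (k0 + k0)%N, ((c * d) ^+ k0 * K); first by rewrite mulr_gt0 // exprn_gt0 // mulr_gt0.
  move=> N k u w q N2 kN u0 w0 E.
  have cd1 j : (j <= k0)%N -> c ^+ j * d ^+ j <= (c * d) ^+ k0.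
    move=> jk; rewrite -exprMn ler_weXn2l //.
    by rewrite -[1]mulr1 ler_pM.
  have [kk|kk] := ltnP k k0.
    pose j := (k0 - k)%N.
    have := HK N k0 u w (mxpow (P m) j *m q) (leqnn _) N2 u0 w0.
    rewrite mulmxA -mxpowD (_ : N - k0 + j = N - k)%N; last by rewrite /j; lia.
    move=> /(_ E) H.
    apply: le_trans (Hc j _) _; rewrite mulmxA -mxpowD (_ : j + k = k0)%N; last by rewrite /j; lia.
    apply: le_trans (_ : c ^+ j * (K * (d ^+ j * l1norm q)) <= _).
      rewrite ler_pM2l ?exprn_gt0 //; apply: le_trans H _.
      by rewrite ler_pM2l //; exact: l1norm_pow.
    rewrite (_ : c ^+ j * (K * (d ^+ j * l1norm q)) = (c ^+ j * d ^+ j) * K * l1norm q); last by ring.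
    by rewrite ler_wpM2r ?l1norm_ge0 // ler_pM2r // cd1 // leq_subr.
  have [kk'|kk'] := leqP (k + k0) N; last first.
    pose j := (k - (N - k0))%N.
    have [Q [_ PQ]] := mxpow_inv m j.
    have := HK N (N - k0)%N u w (Q *m q).
    rewrite (_ : k0 <= N - k0)%N; last by lia.
    rewrite (_ : N - k0 + k0 <= N)%N; last by lia.
    rewrite (_ : N - (N - k0) = (N - k) + j)%N; last by rewrite /j; lia.
    rewrite mulmxA mxpowD -(mulmxA (mxpow _ _)) PQ mulmx1.
    move=> /(_ isT isT u0 w0 E) H.
    rewrite (_ : k = j + (N - k0))%N; last by rewrite /j; lia.
    rewrite mxpowD -mulmxA; apply: le_trans (l1norm_pow _ _ d1 Hd) _.
    apply: le_trans (_ : d ^+ j * (K * (c ^+ j * l1norm q)) <= _).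
      rewrite ler_pM2l ?exprn_gt0 //; apply: le_trans H _.
      by rewrite ler_pM2l //; apply: le_trans (Hc j _) _; rewrite mulmxA PQ mul1mx.
    rewrite (_ : d ^+ j * (K * (c ^+ j * l1norm q)) = (c ^+ j * d ^+ j) * K * l1norm q); last by ring.
    by rewrite ler_wpM2r ?l1norm_ge0 // ler_pM2r // cd1 // /j; lia.
  apply: le_trans (HK N k u w q kk kk' u0 w0 E) _.
  rewrite ler_wpM2r ?l1norm_ge0 // -[leLHS]mul1r ler_pM2r // -(expr1n _ k0).
  rewrite lerXn2r ?nnegrE ?ler01 //; first by rewrite mulr_ge0 // ltW.
  by rewrite -[1]mulr1 ler_pM.
pose zb := m%:R * (K2 * K2) : R.
pose aa := (r.-1)`!%:R * zb ^+ r.-1.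
have zb0 : 0 <= zb by rewrite /zb !mulr_ge0 // ltW.
have aa0 : 0 <= aa by apply: mulr_ge0 => //; apply: exprn_ge0.
exists (m%:R * K2 * (r%:R * (aa * K3)) * (r%:R * K2) + 1).
  apply: ltr_wpDl => //; do !apply: mulr_ge0 => //; exact: ltW.
move=> N k u w q kk kN u0 w0 Eq.
have kN0 : (k <= N)%N := leq_trans (leq_addr _ _) kN.
have kN' : (N - k + k = N)%N by rewrite subnK.
have k0N : (k0 <= N - k)%N by rewrite leq_subRL.
have kk2 := leq_trans le2 kk; have nk2 := leq_trans le2 k0N.
pose E := mxsub (first_idx rm) (last_idx rm) (mxpow (P m) k).
pose F := mxsub (first_idx rm) (last_idx rm) (mxpow (P m) (N - k)).
have dE0 : corner R rm k != 0 by rewrite lt0r_neq0 ?Dp.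
have dF0 : corner R rm (N - k) != 0 by rewrite lt0r_neq0 ?Dp.
have uE : E \in unitmx by rewrite unitmxE unitfE.
have uF : F \in unitmx by rewrite unitmxE unitfE.
pose B := colsub (last_idx rm) (mxpow (P m) k) *m invmx E.
pose Y := invmx F *m rowsub (first_idx rm) (mxpow (P m) (N - k)).
have Bb a b : `|B a b| <= K2.
  rewrite /B cramer_rows // normrM normfV (ger0_norm (ltW (Dp k kk2))) ler_pdivrMr ?Dp //.
  by have [] := H2 k kk2 (fun x => if x == b then a else first_idx rm x) (last_idx rm) _ _ (first_idx_incr rm) (last_idx_incr rm).
have Yb a b : `|Y a b| <= K2.
  rewrite /Y cramer_cols // normrM normfV (ger0_norm (ltW (Dp _ nk2))) ler_pdivrMr ?Dp //.
  by have [] := H2 _ nk2 (first_idx rm) (fun x => if x == a then b else last_idx rm x) _ _ (first_idx_incr rm) (last_idx_incr rm).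
have u0' (i : 'I_m) : (i < m - r)%N -> u i 0 = 0 by rewrite /m addKn; exact: u0.
pose z := rowsub (first_idx rm) (mxpow (P m) k *m u).
have uB : mxpow (P m) k *m u = B *m z.
  rewrite /z (colsub_last rm _ u0') rowsub_mulmx /B -mulmxA; congr (_ *m _).
  by rewrite (_ : rowsub (first_idx rm) _ = E) ?mulKmx //; apply/matrixP => a b; rewrite !mxE.
have YBz : (Y *m B) *m z = Y *m q.
  have := congr1 (fun v => invmx F *m rowsub (first_idx rm) v) Eq.
  rewrite /= rowsub_mulmx mulmxA -/Y => <-.
  rewrite -[X in mxpow _ X]kN' mxpowD -[_ *m _ *m u]mulmxA uB -mulmxA.
  rewrite (_ : rowsub (first_idx rm) _ = rowsub (first_idx rm) (mxpow (P m) (N - k)) *m (B *m z)); last first.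
    rewrite -rowsub_mulmx; apply/matrixP => a b; rewrite [LHS]mxE [LHS]mxE [RHS]mxE.
    by rewrite [X in _ + X]mxE ord1 (w0 (first_idx rm a)) ?oppr0 ?addr0 //= add0n ltn_ord.
  by rewrite [RHS]mulmxA -/Y.
have dYB : \det (Y *m B) = corner R rm N / (corner R rm k * corner R rm (N - k)).
  have -> : Y *m B = invmx F *m mxsub (first_idx rm) (last_idx rm) (mxpow (P m) N) *m invmx E.
    rewrite /Y /B -!mulmxA; congr (_ *m _); rewrite mulmxA; congr (_ *m _).
    by rewrite -[in RHS]kN' mxpowD -colsub_mulmx -rowsub_mulmx; apply/matrixP => a b; rewrite [LHS]mxE [LHS]mxE [RHS]mxE.
  by rewrite !det_mulmx !det_inv invfM mulrAC mulrC [X in _ = _ * X]mulrC.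
have DN : 0 < corner R rm N by apply/Dp/(leq_trans kk2).
have dl : K3^-1 <= `|\det (Y *m B)|.
  rewrite dYB ger0_norm; last first.
    by apply: divr_ge0; [exact: ltW|apply: mulr_ge0; apply/ltW/Dp].
  rewrite ler_pdivlMr; last by apply: mulr_gt0; exact: Dp.
  by rewrite ler_pdivrMl // -[X in _ <= _ * corner _ _ X]kN' mulrC; apply: H3; exact: leq_trans le3 _.
have cW a b : `|cofactor (Y *m B) a b| <= aa.
  apply: cofactor_bound => x y.
  rewrite mxE; apply: le_trans (ler_norm_sum _ _ _) _.
  have -> : zb = \sum_(j < m) K2 * K2 by rewrite sumr_const card_ord -mulr_natl.
  by apply: ler_sum => j _; rewrite normrM ler_pM.
have zz := l1norm_invmx z (etrans (invr_gt0 _) K3p) dl cW.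
rewrite invrK YBz in zz.
rewrite uB; apply: le_trans (l1norm_mulmx z Bb) _.
rewrite mulrDl mul1r; apply: ler_wpDr; first exact: l1norm_ge0.
have p1 : 0 <= m%:R * K2 by apply: mulr_ge0 => //; exact: ltW.
have p2 : 0 <= r%:R * (aa * K3) by apply: mulr_ge0 => //; apply: mulr_ge0 => //; exact: ltW.
have zq : l1norm z <= r%:R * (aa * K3) * (r%:R * K2 * l1norm q).
  by apply: le_trans zz _; apply: ler_wpM2l => //; exact: l1norm_mulmx.
by apply: le_trans (ler_wpM2l p1 zq) _; rewrite !mulrA.
Qed.

(** The chain [u] issued from the left end meets at the step [k0] the chain [w]
    that arrives at the right end.  Their mismatch bounds [u] there by
    [chain_match], and [chain_mono] carries the bound to the other steps, for
    [w] after multiplication by alternating signs, which reverses the direction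
    of travel. *)
Theorem transfer_chains r : exists N0 : nat, exists2 K : R, 0 < K &
  forall N k0 (u w : nat -> 'cV[R]_(r + r.+1)), (N0 <= N)%N -> (k0 <= N)%N ->
   (forall i : 'I_(r + r.+1), (i < r.+1)%N -> u 0%N i 0 = 0) ->
   (forall i : 'I_(r + r.+1), (i < r)%N -> w N i 0 = 0) ->
   (forall k, (k < k0)%N -> u k.+1 = - (P _ *m u k)) ->
   (forall k, (k0 <= k < N)%N -> w k.+1 = - (P _ *m w k)) ->
   (forall k, (k <= k0)%N -> l1norm (u k) <= K * l1norm (u k0 - w k0)) /\
   (forall k, (k0 <= k <= N)%N -> l1norm (w k) <= K * l1norm (u k0 - w k0)).
Proof.
have rm : (r <= r + r.+1)%N by exact: leq_addr.
have sm : (r.+1 <= r + r.+1)%N by exact: leq_addl.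
have [K1 K1p H1] : exists2 K : R, 0 < K & forall u : 'cV[R]_(r + r.+1),
   (forall i : 'I_(r + r.+1), (i < r + r.+1 - r)%N -> u i 0 = 0) ->
    forall j i, l1norm (mxpow (P _) j *m u) <= K * l1norm (mxpow (P _) (i + j) *m u).
  apply: (@chain_mono _ _ rm); move: rm sm; case: r => [|r] rm sm; [by left|right].
  have qm : (r <= r.+1 + r.+2)%N by lia.
  exists qm; exact: corner_pred.
have [K2 K2p H2] : exists2 K : R, 0 < K & forall u : 'cV[R]_(r + r.+1),
   (forall i : 'I_(r + r.+1), (i < r + r.+1 - r.+1)%N -> u i 0 = 0) ->
    forall j i, l1norm (mxpow (P _) j *m u) <= K * l1norm (mxpow (P _) (i + j) *m u).
  apply: (@chain_mono _ _ sm); right; exists rm.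
  have [k0 H] := corner_mid R rm sm; exists k0, 1 => // k kk.
  by rewrite mul1r H.
have [N0 [K3 K3p H3]] := chain_match r.
exists N0, (K1 * K3 + K2 * (K3 + 1)).
  by apply: addr_gt0; apply: mulr_gt0 => //; apply: addr_gt0.
move=> N k0 u w NN kN u0 w0 uS wS; set q := u k0 - w k0.
pose m := (r + r.+1)%N.
have uE k : (k <= k0)%N -> u k = (-1) ^+ k *: (mxpow (P m) k *m u 0%N).
  elim: k => [|k IH] kk; first by rewrite expr0 scale1r mul1mx.
  by rewrite uS // IH ?(ltnW kk) // exprS -scalemxAr mulN1r scaleNr /= mulmxA.
have wE d k : (k0 <= k)%N -> (k + d <= N)%N -> w (k + d)%N = (-1) ^+ d *: (mxpow (P m) d *m w k).
  elim: d => [|d IH] kk dd; first by rewrite addn0 expr0 scale1r mul1mx.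
  rewrite (addnS k d) wS; last by lia.
  by rewrite IH //; [rewrite exprS -scalemxAr mulN1r scaleNr /= mulmxA|lia].
have l1normZ k (x : 'cV[R]_m) : l1norm ((-1) ^+ k *: x) = l1norm x.
  by apply: eq_bigr => i _; rewrite mxE normrM normr_sign mul1r.
have b1 : l1norm (u k0) <= K3 * l1norm q.
  rewrite uE // l1normZ.
  have := H3 N k0 (u 0%N) ((-1) ^+ N *: w N) ((-1) ^+ k0 *: q) NN kN u0.
  rewrite l1normZ; apply; first by move=> i ir; rewrite mxE w0 ?mulr0.
  have wN := wE (N - k0)%N k0 (leqnn _); rewrite subnKC // in wN.
  have sg : (-1) ^+ N * (-1) ^+ (N - k0) = (-1) ^+ k0 :> R.
    by rewrite -{1}(subnKC kN) exprD -mulrA -expr2 sqrr_sign mulr1.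
  rewrite (wN (leqnn _)) scalerA sg /q (uE _ (leqnn _)).
  rewrite scalerBr mulmxBr -!scalemxAr scalerA -expr2 sqrr_sign scale1r mulmxA -mxpowD subnK //.
have b2 : l1norm (w k0) <= (K3 + 1) * l1norm q.
  have -> : w k0 = u k0 - q by rewrite /q opprB addrCA subrr addr0.
  by apply: le_trans (l1normD _ _) _; rewrite l1normN mulrDl mul1r lerD2r.
split=> k.
  move=> kk; rewrite uE // l1normZ.
  have u0' (i : 'I_(r + r.+1)) : (i < r + r.+1 - r)%N -> u 0%N i 0 = 0 by move=> ir; apply: u0; lia.
  have := H1 _ u0' k (k0 - k)%N; rewrite subnK // => /le_trans; apply.
  apply: le_trans (_ : K1 * (K3 * l1norm q) <= _).
    by rewrite ler_pM2l //; move: b1; rewrite uE // l1normZ.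
  by rewrite mulrA ler_wpM2r ?l1norm_ge0 // lerDl; apply: mulr_ge0; [exact: ltW|apply: addr_ge0 => //; exact: ltW].
move=> /andP[kk leN].
have l1normS (x : 'cV[R]_m) : l1norm (altsign_mx R m *m x) = l1norm x.
  by apply: eq_bigr => i _; rewrite mul_diag_mx mxE !mxE normrM normr_sign mul1r.
(* Up to alternating signs, [w] read from the right end is a chain for the same
   matrix. *)
have sE d : (d <= N - k0)%N ->
    altsign_mx R m *m w (N - d)%N = (-1) ^+ d *: (mxpow (P m) d *m (altsign_mx R m *m w N)).
  elim: d => [|d IH] dd; first by rewrite subn0 expr0 scale1r mul1mx.
  have E : w (N - d)%N = - (P m *m w (N - d.+1)%N).
    by rewrite -wS; [congr w; lia|lia].
  have := IH (ltnW dd); rewrite E => /(congr1 (fun v => - (P m *m v))).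
  rewrite !mulmxN opprK !mulmxA transfer_altsign_mx => ->.
  by rewrite -scalemxAr exprS mulN1r scaleNr /= -!mulmxA.
have w0' (i : 'I_(r + r.+1)) : (i < r + r.+1 - r.+1)%N -> (altsign_mx R m *m w N) i 0 = 0.
  by move=> ir; rewrite mul_diag_mx !mxE w0 ?mulr0 //; lia.
have := H2 _ w0' (N - k)%N (k - k0)%N.
have nE j : (k0 <= j <= N)%N -> l1norm (mxpow (P _) (N - j) *m (altsign_mx R m *m w N)) = l1norm (w j).
  move=> jj; rewrite -(l1normZ (N - j)%N) -sE; last by lia.
  by rewrite l1normS; congr (l1norm (w _)); lia.
rewrite (_ : k - k0 + (N - k) = N - k0)%N; last by lia.
rewrite !nE ?leqnn ?kk ?leN ?kN // => /le_trans; apply.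
apply: le_trans (_ : K2 * ((K3 + 1) * l1norm q) <= _); first by rewrite ler_pM2l.
by rewrite mulrA ler_wpM2r ?l1norm_ge0 // lerDr; apply: mulr_ge0; exact: ltW.
Qed.

End Chains.

(** * Polynomials on the unit interval *)

Section PolyTools.
Variable R : realFieldType.
Implicit Types f g : {poly R}.

(** The integral over the unit interval. *)
Definition int01 f : R := \sum_(i < size f) f`_i / i.+1%:R.

Lemma sum_wide (V : nmodType) (F : nat -> V) a b : (a <= b)%N -> (forall i, (a <= i)%N -> F i = 0) ->
  \sum_(i < a) F i = \sum_(i < b) F i.
Proof.
move=> ab F0; rewrite -!(big_mkord xpredT F) [RHS](big_cat_nat (n := a)) //=.
rewrite [X in _ + X]big_nat_cond [X in _ + X]big1 ?addr0 // => i /andP[/andP[ai _] _].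
exact: F0.
Qed.

Lemma int01_wide f n : (size f <= n)%N -> int01 f = \sum_(i < n) f`_i / i.+1%:R.
Proof.
move=> fn; apply: (sum_wide (F := fun i => f`_i / i.+1%:R)) => // i si.
by rewrite nth_default // mul0r.
Qed.

Lemma int01D f g : int01 (f + g) = int01 f + int01 g.
Proof.
have sz := size_polyD f g; set n := maxn _ _ in sz.
rewrite !(@int01_wide _ n) ?leq_maxl ?leq_maxr // -big_split /=.
by apply: eq_bigr => i _; rewrite coefD mulrDl.
Qed.

Lemma int01Z (c : R) f : int01 (c *: f) = c * int01 f.
Proof.
rewrite (int01_wide (size_scale_leq c f)) mulr_sumr.
by apply: eq_bigr => i _; rewrite coefZ mulrA.
Qed.

Lemma int010 : int01 0 = 0.
Proof. by rewrite /int01 size_poly0 big_ord0. Qed.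

Lemma int01N f : int01 (- f) = - int01 f.
Proof. by rewrite -scaleN1r int01Z mulN1r. Qed.

Lemma int01_sum (I : Type) (s : seq I) (P : pred I) (F : I -> {poly R}) :
  int01 (\sum_(i <- s | P i) F i) = \sum_(i <- s | P i) int01 (F i).
Proof. exact: (big_morph int01 int01D int010). Qed.

Lemma size_deriv_leq f n : (size f <= n.+1)%N -> (size f^`() <= n)%N.
Proof.
move=> /leq_sizeP fn; apply/leq_sizeP => j nj.
by rewrite coef_deriv fn ?mul0rn.
Qed.

Lemma int01_deriv f : int01 f^`() = f.[1] - f.[0].
Proof.
have sz : (size f <= (size f).-1.+1)%N by case: (size f).
rewrite (int01_wide (n := (size f).-1)); last exact: size_deriv_leq.
rewrite (horner_coef_wide 1 sz) big_ord_recl horner_coef0 expr0 mulr1 addrAC subrr add0r.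
apply: eq_bigr => i _; rewrite coef_deriv expr1n mulr1 -[X in X / _ = _]mulr_natr mulfK ?pnatr_eq0 //.
Qed.

(** The antiderivative that vanishes at 0. *)
Definition antideriv f : {poly R} := \poly_(i < (size f).+1) (f`_i.-1 / i%:R).

Lemma coef_antideriv f i : (antideriv f)`_i.+1 = f`_i / i.+1%:R.
Proof.
rewrite coef_poly ltnS; case: ltnP => // si; by rewrite nth_default // mul0r.
Qed.

Lemma deriv_antideriv f : (antideriv f)^`() = f.
Proof.
apply/polyP => i; rewrite coef_deriv coef_antideriv -[LHS]mulr_natr divfK ?pnatr_eq0 //.
Qed.

Lemma antideriv_0 f : (antideriv f).[0] = 0.
Proof. by rewrite horner_coef0 coef_poly invr0 mulr0. Qed.

Lemma antideriv_1 f : (antideriv f).[1] = int01 f.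
Proof. by rewrite -[X in int01 X]deriv_antideriv int01_deriv antideriv_0 subr0. Qed.

Lemma size_antideriv f : (size (antideriv f) <= (size f).+1)%N.
Proof. exact: size_poly. Qed.

(** The l^1 norm of the coefficients: it bounds integrals and values on the
    unit interval, and it is submultiplicative ([coef_normM]). *)
Definition coef_norm f : R := \sum_(i < size f) `|f`_i|.

Lemma coef_norm_wide f n : (size f <= n)%N -> coef_norm f = \sum_(i < n) `|f`_i|.
Proof.
move=> fn; apply: (sum_wide (F := fun i => `|f`_i|)) => // i si.
by rewrite nth_default // normr0.
Qed.

Lemma coef_norm_ge0 f : 0 <= coef_norm f. Proof. exact: sumr_ge0. Qed.

Lemma coef_normD f g : coef_norm (f + g) <= coef_norm f + coef_norm g.
Proof.
have sz := size_polyD f g; set n := maxn _ _ in sz.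
rewrite !(@coef_norm_wide _ n) ?leq_maxl ?leq_maxr // -big_split /=.
by apply: ler_sum => i _; rewrite coefD ler_normD.
Qed.

Lemma coef_normZ (c : R) f : coef_norm (c *: f) = `|c| * coef_norm f.
Proof.
rewrite (coef_norm_wide (size_scale_leq c f)) mulr_sumr.
by apply: eq_bigr => i _; rewrite coefZ normrM.
Qed.

Lemma coef_normN f : coef_norm (- f) = coef_norm f.
Proof. by rewrite -scaleN1r coef_normZ normrN1 mul1r. Qed.

Lemma coef_norm0 : coef_norm 0 = 0.
Proof. by rewrite /coef_norm size_poly0 big_ord0. Qed.

Lemma coef_normC c : coef_norm c%:P = `|c|.
Proof. by rewrite (coef_norm_wide (size_polyC_leq1 c)) big_ord1 coefC. Qed.

Lemma coef_norm1 : coef_norm 1 = 1. Proof. by rewrite -polyC1 coef_normC normr1. Qed.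

Lemma coef_norm_MX f : coef_norm ('X * f) = coef_norm f.
Proof.
rewrite (coef_norm_wide (n := (size f).+1)); last first.
  by apply: leq_trans (size_polyMleq _ _) _; rewrite size_polyX.
rewrite big_ord_recl coefXM normr0 add0r.
by apply: eq_bigr => i _; rewrite coefXM.
Qed.

Lemma coef_norm_XaddC (c : R) f : coef_norm (('X + c%:P) * f) <= (1 + `|c|) * coef_norm f.
Proof.
by rewrite mulrDl; apply: le_trans (coef_normD _ _) _; rewrite coef_norm_MX mul_polyC coef_normZ mulrDl mul1r.
Qed.

Lemma coef_norm_XaddCX (c : R) f i : coef_norm (('X + c%:P) ^+ i * f) <= (1 + `|c|) ^+ i * coef_norm f.
Proof.
elim: i => [|i IH]; first by rewrite !expr0 !mul1r.
rewrite exprS -mulrA; apply: le_trans (coef_norm_XaddC _ _) _.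
by rewrite exprS -mulrA ler_wpM2l // addr_ge0.
Qed.

Lemma int01_le f : `|int01 f| <= coef_norm f.
Proof.
apply: le_trans (ler_norm_sum _ _ _) _; apply: ler_sum => i _.
rewrite normrM ler_piMr // ger0_norm ?invr_ge0 // invf_le1 ?ltr0n // ler1n //.
Qed.

Lemma horner0_le f : `|f.[0]| <= coef_norm f.
Proof.
rewrite horner_coef0 (coef_norm_wide (leqnSn _)) big_ord_recl lerDl; exact: sumr_ge0.
Qed.

Lemma coef_norm_deriv f n : (size f <= n.+1)%N -> coef_norm f^`() <= n%:R * coef_norm f.
Proof.
move=> fn; rewrite (coef_norm_wide (size_deriv_leq fn)) (coef_norm_wide fn) big_ord_recl mulrDr.
rewrite -[leLHS]add0r; apply: lerD; first by rewrite mulr_ge0.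
rewrite mulr_sumr; apply: ler_sum => i _.
by rewrite coef_deriv normrMn -[leLHS]mulr_natl ler_wpM2r // ler_nat.
Qed.

End PolyTools.

(** * Polynomial pieces of the B-splines *)

Section Pieces.
Variable R : realFieldType.
Variables (p N : nat).

(** Open knot vector in units of the mesh width. *)
Definition knot (i : nat) : nat := minn (i - p) N.
Definition knot_gap (q i : nat) : R := (knot (i + q.+1))%:R - (knot i)%:R.

(** The Cox-de Boor recursion restricted to the k-th mesh interval, as a
    polynomial in the local variable, which runs over the unit interval.
    Division by an empty gap gives zero here too, since [0^-1 = 0]. *)
Fixpoint bpiece (q i k : nat) : {poly R} :=
  if q is q'.+1 then
    (knot_gap q' i)^-1 *: (('X + (k%:R - (knot i)%:R)%:P) * bpiece q' i k)
    + (knot_gap q' i.+1)^-1 *: ((((knot (i + q'.+2))%:R - k%:R)%:P - 'X) * bpiece q' i.+1 k)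
  else if (knot i <= k < knot i.+1)%N then 1 else 0.

(** B-splines divided by the length of their support: the derivative of a
    B-spline is a difference of two of these ([deriv_bpiece]), and their
    integral does not depend on the position ([npiece_mass]). *)
Definition npiece q i k := (knot_gap q i)^-1 *: bpiece q i k.

Lemma knotE i : knot i = minn (i - p) N. Proof. by []. Qed.

Lemma knot_le i j : (i <= j)%N -> (knot i <= knot j)%N.
Proof. rewrite /knot; lia. Qed.

Lemma bpieceS q i k : bpiece q.+1 i k = ('X + (k%:R - (knot i)%:R)%:P) * npiece q i k
   + (((knot (i + q.+2))%:R - k%:R)%:P - 'X) * npiece q i.+1 k.
Proof. by rewrite /= /npiece !scalerAr. Qed.

Lemma horner_bpieceS q i k x : (bpiece q.+1 i k).[x] =
   (x + (k%:R - (knot i)%:R)) * ((knot_gap q i)^-1 * (bpiece q i k).[x])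
   + ((knot (i + q.+2))%:R - k%:R - x) * ((knot_gap q i.+1)^-1 * (bpiece q i.+1 k).[x]).
Proof.
rewrite bpieceS /npiece; move: (bpiece q i k) (bpiece q i.+1 k) => f g.
by rewrite hornerD !hornerM hornerD hornerX !hornerZ hornerD hornerN !hornerC hornerX.
Qed.

Lemma bpiece_supp q i k : ~~ (knot i <= k < knot (i + q.+1))%N -> bpiece q i k = 0.
Proof.
elim: q i => [|q IH] i; first by rewrite addn1 /= => /negbTE ->.
move=> H; rewrite bpieceS /npiece !IH ?scaler0 ?mulr0 ?addr0 //.
  by apply: contraNN H; have := @knot_le i i.+1; rewrite addSnnS; lia.
by apply: contraNN H; have := @knot_le (i + q.+1) (i + q.+2); lia.
Qed.

Lemma npiece_supp q i k : ~~ (knot i <= k < knot (i + q.+1))%N -> npiece q i k = 0.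
Proof. by move=> /bpiece_supp H; rewrite /npiece H scaler0. Qed.

Lemma knot_gap_ge1 q i : (knot i < knot (i + q.+1))%N -> 1 <= knot_gap q i.
Proof. by move=> a; rewrite /knot_gap lerBrDl -[X in _ + X]/(1%:R) -natrD ler_nat addn1. Qed.

Lemma knot_gap_le q i : 0 <= knot_gap q i <= q.+1%:R.
Proof.
rewrite /knot_gap subr_ge0 ler_nat knot_le ?leq_addr //= lerBlDl -natrD ler_nat /knot; lia.
Qed.

Lemma knot_gapK q i k : knot_gap q i *: npiece q i k = bpiece q i k.
Proof.
rewrite /npiece scalerA; have [a|a] := ltnP (knot i) (knot (i + q.+1)).
  by rewrite divff ?scale1r // lt0r_neq0 // (lt_le_trans ltr01) ?knot_gap_ge1.
rewrite bpiece_supp ?scaler0 //; lia.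
Qed.

Lemma deriv_bpiece q i k : (bpiece q.+1 i k)^`() = q.+1%:R *: (npiece q i k - npiece q i.+1 k).
Proof.
elim: q i => [|q IH] i.
  rewrite bpieceS derivD !derivM derivB derivD !derivX !derivC addr0 sub0r mul1r mulN1r.
  have c j : (npiece 0 j k)^`() = 0.
    by rewrite /npiece derivZ /=; case: ifP; rewrite -?polyC1 derivC scaler0.
  by rewrite !c !mulr0 !addr0 scale1r.
have A j : (npiece q.+1 j k)^`() = (knot_gap q.+1 j)^-1 *: (q.+1%:R *: (npiece q j k - npiece q j.+1 k)).
  by rewrite /npiece derivZ IH.
rewrite bpieceS derivD !derivM derivB derivD !derivX !derivC addr0 sub0r mul1r mulN1r !A.
have e1 : ('X + (k%:R - (knot i)%:R)%:P) * (npiece q i k - npiece q i.+1 k) =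
   bpiece q.+1 i k - knot_gap q.+1 i *: npiece q i.+1 k.
  rewrite bpieceS /knot_gap -mul_polyC !polyCB addnS; ring.
have e2 : (((knot (i + q.+3))%:R - k%:R)%:P - 'X) * (npiece q i.+1 k - npiece q i.+2 k) =
   - bpiece q.+1 i.+1 k + knot_gap q.+1 i.+1 *: npiece q i.+1 k.
  rewrite bpieceS /knot_gap -mul_polyC !polyCB !addnS !addSn; ring.
rewrite -!scalerAr e1 e2.
have z1 : (knot_gap q.+1 i)^-1 *: (knot_gap q.+1 i *: npiece q i.+1 k) = npiece q i.+1 k.
  rewrite scalerA; have [a|a] := ltnP (knot i) (knot (i + q.+2)).
    by rewrite mulVf ?scale1r // lt0r_neq0 // (lt_le_trans ltr01) ?knot_gap_ge1.
  rewrite npiece_supp ?scaler0 //; have := @knot_le i i.+1; rewrite addSnnS; lia.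
have z2 : (knot_gap q.+1 i.+1)^-1 *: (knot_gap q.+1 i.+1 *: npiece q i.+1 k) = npiece q i.+1 k.
  rewrite scalerA; have [a|a] := ltnP (knot i.+1) (knot (i.+1 + q.+2)).
    by rewrite mulVf ?scale1r // lt0r_neq0 // (lt_le_trans ltr01) ?knot_gap_ge1.
  rewrite npiece_supp ?scaler0 //.
  have := @knot_le (i.+1 + q.+1) (i.+1 + q.+2); rewrite leq_add2l leqnSn => /(_ isT); lia.
have -> : (knot_gap q.+1 i)^-1 *: (q.+1%:R *: (bpiece q.+1 i k - knot_gap q.+1 i *: npiece q i.+1 k)) =
   q.+1%:R *: (npiece q.+1 i k - npiece q i.+1 k).
  by rewrite scalerA mulrC -scalerA scalerBr z1.
have -> : (knot_gap q.+1 i.+1)^-1 *: (q.+1%:R *: (- bpiece q.+1 i.+1 k + knot_gap q.+1 i.+1 *: npiece q i.+1 k)) =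
   q.+1%:R *: (- npiece q.+1 i.+1 k + npiece q i.+1 k).
  by rewrite scalerA mulrC -scalerA scalerDr z2 scalerN.
rewrite [q.+2%:R]mulrSr scalerDl scale1r.
rewrite !scalerDr !scalerN; ring.
Qed.

Lemma bpiece0E i k : (k < N)%N -> bpiece 0 i k = if i == (k + p)%N then 1 else 0.
Proof.
move=> kN /=; suff -> : (knot i <= k < knot i.+1)%N = (i == (k + p)%N) by [].
rewrite /knot; lia.
Qed.

Lemma npiece0E i k : (k < N)%N -> npiece 0 i k = if i == (k + p)%N then 1 else 0.
Proof.
move=> kN; rewrite /npiece bpiece0E //; case: eqP => [->|_]; last by rewrite scaler0.
suff -> : knot_gap 0 (k + p) = 1 by rewrite invr1 scale1r.
rewrite /knot_gap /knot (_ : minn (k + p + 1 - p) N = k.+1); last by lia.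
by rewrite (_ : minn (k + p - p) N = k); [rewrite -natr1 addrAC subrr add0r|lia].
Qed.

Lemma npiece0_horner i k x : (k < N)%N ->
  (knot_gap 0 i)^-1 * (bpiece 0 i k).[x] = (i == (k + p)%N)%:R.
Proof.
move=> kN; rewrite -hornerZ -/(npiece 0 i k) npiece0E //.
by case: eqP => _; rewrite -?polyC1 hornerC.
Qed.

Lemma bpiece_cont q i k : (k.+1 < N)%N -> (bpiece q.+1 i k).[1] = (bpiece q.+1 i k.+1).[0].
Proof.
move=> kN; elim: q i => [|q IH] i; last first.
  rewrite horner_bpieceS [RHS]horner_bpieceS !IH -natr1; ring.
have kN1 : (k < N)%N by exact: ltnW.
rewrite horner_bpieceS [RHS]horner_bpieceS !npiece0_horner //.
have [e|e] := eqVneq i (k + p)%N.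
  subst i; rewrite (_ : (k + p).+1 == (k + p)%N = false); last by lia.
  rewrite (_ : (k + p)%N == (k.+1 + p)%N = false); last by lia.
  rewrite (_ : (k + p).+1 == (k.+1 + p)%N); last by lia.
  rewrite (_ : knot (k + p) = k); last by rewrite /knot; lia.
  rewrite (_ : knot (k + p + 2) = k.+2); last by rewrite /knot; lia.
  rewrite /= -!natr1; ring.
rewrite (_ : i.+1 == (k.+1 + p)%N = false); last by lia.
have [e2|e2] := eqVneq i.+1 (k + p)%N.
  rewrite (_ : knot (i + 2) = k.+1); last by rewrite /knot; lia.
  rewrite (_ : i == (k.+1 + p)%N = false); last by lia.
  rewrite /= -natr1; ring.
have [e3|e3] := eqVneq i (k.+1 + p)%N; last by rewrite /=; ring.
subst i; rewrite (_ : knot (k.+1 + p) = k.+1); last by rewrite /knot; lia.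
rewrite /=; ring.
Qed.

Lemma bpiece_derivn_cont q j i k : (j < q)%N -> (k.+1 < N)%N ->
  ((bpiece q i k)^`(j)).[1] = ((bpiece q i k.+1)^`(j)).[0].
Proof.
elim: j q i => [|j IH] [|q] i // jq kN; first by rewrite !derivn0 bpiece_cont.
by rewrite !derivSn !deriv_bpiece !derivnZ !derivnB !hornerZ !hornerD !hornerN /npiece !derivnZ !hornerZ !IH.
Qed.

Lemma bpiece_unity q k : (q <= p)%N -> (k < N)%N ->
  \sum_(i < q.+1) bpiece q (k + p - q + i) k = 1.
Proof.
move=> + kN; elim: q => [|q IH] qp; first by rewrite big_ord1 bpiece0E // subn0 addn0 eqxx.
under eq_bigr do rewrite bpieceS.
rewrite big_split /= [X in X + _]big_ord_recl [X in _ + X]big_ord_recr /= -[RHS](IH (ltnW qp)).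
rewrite (npiece_supp (i := k + p - q.+1 + 0)); last by rewrite /knot; lia.
rewrite (npiece_supp (i := (k + p - q.+1 + q.+1).+1)); last by rewrite /knot; lia.
rewrite !mulr0 add0r addr0 -big_split /=; apply: eq_bigr => i _.
rewrite /bump /= (_ : k + p - q.+1 + (1 + i) = k + p - q + i)%N; last by lia.
rewrite (_ : (k + p - q.+1 + i).+1 = k + p - q + i)%N; last by lia.
rewrite (_ : k + p - q.+1 + i + q.+2 = k + p - q + i + q.+1)%N; last by lia.
rewrite -[RHS]knot_gapK /knot_gap -mul_polyC !polyCB; ring.
Qed.

Lemma bpiece_local (c : nat -> R) q k : (q <= p)%N -> (k < N)%N ->
  \sum_(j < N + p) c j *: bpiece q j k = \sum_(i < q.+1) c (k + p - q + i)%N *: bpiece q (k + p - q + i) k.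
Proof.
move=> qp kN.
rewrite -(big_mkord xpredT (fun j => c j *: bpiece q j k)).
rewrite (big_cat_nat (n := (k + p - q)%N)) //=; last by lia.
rewrite (big_cat_nat (n := (k + p).+1) (m := (k + p - q)%N)) //=; [|lia|lia].
rewrite big_nat_cond big1 ?add0r => [|j]; last first.
  by rewrite andbT => jk; rewrite bpiece_supp ?scaler0 // /knot; lia.
rewrite [X in _ + X]big_nat_cond [X in _ + X]big1 ?addr0 => [|j]; last first.
  by rewrite andbT => jk; rewrite bpiece_supp ?scaler0 // /knot; lia.
rewrite -{1}[(k + p - q)%N]add0n big_addn (_ : (k + p).+1 - (k + p - q) = q.+1)%N; last by lia.
by rewrite big_mkord; apply: eq_bigr => i _; rewrite addnC.
Qed.

Lemma size_bpiece q i k : (size (bpiece q i k) <= q.+1)%N.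
Proof.
elim: q i => [|q IH] i; first by rewrite /=; case: ifP; rewrite ?size_poly1 ?size_poly0.
rewrite bpieceS; apply: leq_trans (size_polyD _ _) _; rewrite geq_max; apply/andP; split.
  apply: leq_trans (size_polyMleq _ _) _; rewrite size_XaddC /=.
  by apply: leq_trans (size_scale_leq _ _) (IH _).
apply: leq_trans (size_polyMleq _ _) _.
rewrite -opprB size_polyN size_XsubC /=.
by apply: leq_trans (size_scale_leq _ _) (IH _).
Qed.

Lemma coef_norm_npiece_bpiece q i k : coef_norm (npiece q i k) <= coef_norm (bpiece q i k).
Proof.
rewrite /npiece coef_normZ; have [/andP[a b]|h] := boolP (knot i <= k < knot (i + q.+1))%N; last first.
  by rewrite bpiece_supp // coef_norm0 mulr0.
have w := knot_gap_ge1 (leq_ltn_trans a b).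
rewrite ler_piMl ?coef_norm_ge0 // ger0_norm ?invr_ge0 ?(le_trans ler01) //.
by rewrite invf_le1 // (lt_le_trans ltr01).
Qed.

Lemma coef_norm_bpiece q i k : coef_norm (bpiece q i k) <= (2 * (1 + q%:R)) ^+ q.
Proof.
elim: q i => [|q IH] i; first by rewrite expr0 /=; case: ifP; rewrite ?coef_norm1 ?coef_norm0.
pose B : R := (2 * (1 + q%:R)) ^+ q.
have B0 : 0 <= B by apply: exprn_ge0; apply: mulr_ge0 => //; apply: addr_ge0.
have [/andP[a b]|h] := boolP (knot i <= k < knot (i + q.+2))%N; last first.
  rewrite bpiece_supp // coef_norm0; apply: exprn_ge0; apply: mulr_ge0 => //; exact: addr_ge0.
have bb j : coef_norm (npiece q j k) <= B by apply: le_trans (coef_norm_npiece_bpiece _ _ _) (IH j).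
have kl : (knot (i + q.+2) <= q.+2 + knot i)%N by rewrite /knot; lia.
rewrite bpieceS; apply: le_trans (coef_normD _ _) _.
have -> : forall x : {poly R}, (((knot (i + q.+2))%:R - k%:R)%:P - 'X) * x =
   - (('X + (k%:R - (knot (i + q.+2))%:R)%:P) * x).
  by move=> x; rewrite -mulNr opprD -polyCN opprB addrC.
rewrite coef_normN; apply: le_trans (lerD (coef_norm_XaddC _ _) (coef_norm_XaddC _ _)) _.
have c12 : `|k%:R - (knot i)%:R| + `|k%:R - (knot (i + q.+2))%:R| <= q.+2%:R :> R.
  rewrite ger0_norm ?subr_ge0 ?ler_nat // ler0_norm ?subr_le0 ?ler_nat 1?ltnW //.
  rewrite opprB [leLHS]addrC addrA subrK lerBlDr -natrD ler_nat; exact: kl.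
set x := `|_| in c12 *; set y := `|_| in c12 *.
apply: le_trans (_ : (1 + x) * B + (1 + y) * B <= _).
  have x0 : 0 <= x by exact: normr_ge0.
  have y0 : 0 <= y by exact: normr_ge0.
  by apply: lerD; apply: ler_wpM2l => //; apply: addr_ge0.
rewrite -mulrDl exprS; apply: ler_pM => //.
  by apply: addr_ge0; apply: addr_ge0 => //; exact: normr_ge0.
  have -> : q.+1%:R = q%:R + 1 :> R by rewrite natr1.
  by move: c12; rewrite -!natr1; have : (0 : R) <= q%:R by []; lra.
apply: lerXn2r; rewrite ?nnegrE; try by apply: mulr_ge0 => //; apply: addr_ge0.
by rewrite ler_pM2l // lerD2l ler_nat.
Qed.

Hypothesis N0 : (0 < N)%N.

Lemma bpiece_at0 q i : (q <= p)%N -> (bpiece q i 0).[0] = (i + q == p)%N%:R.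
Proof.
elim: q i => [|q IH] i qp.
  rewrite bpiece0E // ?addn0 ?add0n.
  by case: eqP => _; rewrite -?polyC1 hornerC.
rewrite horner_bpieceS !IH ?(ltnW qp) //.
have [e|e] := eqVneq (i + q)%N p.
  rewrite (_ : knot i = 0%N); last by rewrite /knot; lia.
  rewrite (_ : (i.+1 + q == p)%N = false); last by lia.
  rewrite (_ : (i + q.+1 == p)%N = false); last by lia.
  by rewrite !mulr0 subrr !addr0 mul0r.
have [e2|e2] := eqVneq (i.+1 + q)%N p; last first.
  rewrite (_ : (i + q.+1 == p)%N = false); last by lia.
  by rewrite !mulr0 addr0.
rewrite (_ : (i + q.+1 == p)%N); last by lia.
rewrite /knot_gap (_ : knot (i.+1 + q.+1) = 1%N); last by rewrite /knot; lia.
rewrite (_ : knot i.+1 = 0%N); last by rewrite /knot; lia.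
rewrite (_ : knot (i + q.+2) = 1%N); last by rewrite /knot; lia.
by rewrite !mulr0 add0r !subr0 invr1 !mulr1.
Qed.

Lemma bpiece_at1 q i : (bpiece q i N.-1).[1] = (i.+1 == N + p)%N%:R.
Proof.
have NN : (N.-1 < N)%N by lia.
elim: q i => [|q IH] i.
  rewrite bpiece0E // (_ : (i == (N.-1 + p)%N) = (i.+1 == (N + p)%N)); last by lia.
  by case: eqP => _; rewrite !hornerE.
rewrite horner_bpieceS !IH.
have N1 : (N.-1)%:R = N%:R - 1 :> R by rewrite -[in RHS](prednK N0) -natr1 addrK.
have [e|e] := eqVneq i.+1 (N + p)%N.
  rewrite (_ : (i.+2 == N + p)%N = false); last by lia.
  rewrite /knot_gap (_ : knot i = N.-1); last by rewrite /knot; lia.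
  rewrite (_ : knot (i + q.+1) = N); last by rewrite /knot; lia.
  have -> : N%:R - (N.-1)%:R = 1 :> R by rewrite N1 opprB addrC subrK.
  by rewrite subrr addr0 !mulr0 addr0 invr1 !mulr1.
have [e2|e2] := eqVneq i.+2 (N + p)%N; last by rewrite !mulr0 addr0.
rewrite (_ : knot (i + q.+2) = N); last by rewrite /knot; lia.
by rewrite !mulr0 add0r (_ : N%:R - (N.-1)%:R - 1 = 0 :> R) ?mul0r // N1; ring.
Qed.

End Pieces.

(** * Moments against B-splines *)

Section Forms.
Variable R : realFieldType.
Variables (p N : nat).
Hypothesis N0 : (0 < N)%N.
Notation bpiece := (@bpiece R p N).
Notation npiece := (@npiece R p N).
Notation knot_gap := (@knot_gap R p N).
Notation knot := (knot p N).
Implicit Types F G : nat -> {poly R}.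

(** The L^2 product of two piecewise polynomial functions on a mesh of width
    1. *)
Definition pairing F G : R := \sum_(k < N) int01 (F k * G k).

Lemma pairing_eq F F' G G' : (forall k, (k < N)%N -> F k * G k = F' k * G' k) ->
  pairing F G = pairing F' G'.
Proof. by move=> H; apply: eq_bigr => k _; rewrite H. Qed.

Lemma pairing_npiece F q m : pairing F (bpiece q m) = knot_gap q m * pairing F (npiece q m).
Proof.
rewrite /pairing mulr_sumr; apply: eq_bigr => k _.
by rewrite -int01Z scalerAr knot_gapK.
Qed.

Lemma pairing0r F G : (forall k, (k < N)%N -> G k = 0) -> pairing F G = 0.
Proof. by move=> H; apply: big1 => k _; rewrite H // mulr0 int010. Qed.

Lemma pairingBl F G H : pairing (fun k => F k - G k) H = pairing F H - pairing G H.
Proof.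
rewrite /pairing -sumrB; apply: eq_bigr => k _.
by rewrite mulrBl int01D int01N.
Qed.

Lemma pairingZl c F H : pairing (fun k => c *: F k) H = c * pairing F H.
Proof.
rewrite /pairing mulr_sumr; apply: eq_bigr => k _.
by rewrite -scalerAl int01Z.
Qed.

Definition knot_cont F := forall k, (k.+1 < N)%N -> (F k).[1] = (F k.+1).[0].

Lemma telescope_cont F : knot_cont F ->
  \sum_(k < N) ((F k).[1] - (F k).[0]) = (F N.-1).[1] - (F 0%N).[0].
Proof.
rewrite /knot_cont; case: N N0 => // n _; elim: n => [|n IH] cF; first by rewrite big_ord1.
rewrite big_ord_recr /= IH => [|k lekn]; last by apply: cF; exact: ltnW.
rewrite (cF n) //=; ring.
Qed.

(** Integration by parts; only the first and the last B-spline meet the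
    boundary. *)
Lemma ibp F q m : (q.+1 <= p)%N -> knot_cont F ->
  pairing (fun k => (F k)^`()) (bpiece q.+1 m) =
  (F N.-1).[1] * (m.+1 == N + p)%N%:R - (F 0%N).[0] * (m + q.+1 == p)%N%:R
  - q.+1%:R * (pairing F (npiece q m) - pairing F (npiece q m.+1)).
Proof.
move=> qp cF.
have cFb : knot_cont (fun k => F k * bpiece q.+1 m k).
  by move=> k kN; rewrite !hornerM cF // bpiece_cont.
have := telescope_cont cFb; rewrite !hornerM (bpiece_at1 _ _ N0) (bpiece_at0 _ N0) // => <-.
rewrite /pairing -sumrB mulr_sumr -sumrB; apply: eq_bigr => k _.
rewrite -int01_deriv derivM deriv_bpiece -scalerAr mulrBr int01D int01Z int01D int01N; ring.
Qed.

(** Integration by parts relates the moments of [F^(q+1)] in degree [q] to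
    those of [F^(q)] in degree [q.-1] ([bmoment_rec]); in degree 0 they are
    increments of [F] between knots ([bmoment0]). *)
Definition bmoment F q m := pairing (fun k => (F k)^`(q.+1)) (bpiece q m).
Definition nmoment F q m := pairing (fun k => (F k)^`(q.+1)) (npiece q m).

Lemma bmomentE F q m : bmoment F q m = knot_gap q m * nmoment F q m.
Proof. exact: pairing_npiece. Qed.

(** [F] is of class C^n across the interior knots. *)
Definition knot_smooth n F := forall i, (i <= n)%N -> knot_cont (fun k => (F k)^`(i)).

Lemma bmoment_rec F q m : (q.+1 <= p)%N -> knot_smooth p F ->
  bmoment F q.+1 m =
  ((F N.-1)^`(q.+1)).[1] * (m.+1 == N + p)%N%:R - ((F 0%N)^`(q.+1)).[0] * (m + q.+1 == p)%N%:R
  - q.+1%:R * (nmoment F q m - nmoment F q m.+1).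
Proof. by move=> qp cF; have := ibp m qp (cF _ qp). Qed.

Lemma nmoment_out F q m : (N + p <= m)%N -> nmoment F q m = 0.
Proof. by move=> h; apply: pairing0r => k kN; apply: npiece_supp; rewrite !knotE; lia. Qed.

Lemma nmoment_out0 F q m : (m + q < p)%N -> nmoment F q m = 0.
Proof. by move=> h; apply: pairing0r => k kN; apply: npiece_supp; rewrite !knotE; lia. Qed.

Lemma bmoment0 F k : (k < N)%N -> bmoment F 0 (k + p)%N = (F k).[1] - (F k).[0].
Proof.
move=> kN; rewrite /bmoment /pairing (bigD1 (Ordinal kN)) // bpiece0E // eqxx mulr1.
rewrite derivn1 int01_deriv big1 => [|j jk]; first exact: addr0; rewrite bpiece0E //.
rewrite (_ : (k + p == j + p)%N = false) ?mulr0 ?int010 //.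
rewrite eqn_add2r eq_sym; apply/negbTE; apply: contraNN jk => /eqP e.
by apply/eqP/val_inj.
Qed.

Section Left.
Variables (f : nat -> {poly R}) (l : nat).
Hypothesis cf : knot_smooth p f.
Hypothesis f0 : forall i, (i <= p)%N -> ((f 0%N)^`(i)).[0] = 0.
Hypothesis lN : (l < N + p)%N.
Hypothesis Xl : forall m, (m < l)%N -> bmoment f p m = 0.

(** By [bmoment_rec] a vanishing moment in one degree makes two consecutive
    moments equal in the degree below, where the first ones vanish for reasons
    of support.  Each step down extends the range of indices by one. *)
Lemma left_nmoment d m : (d < p)%N -> (m <= l + d)%N -> nmoment f (p - d.+1) m = 0.
Proof.
move=> dp; elim: d dp m => [|d IHd] dp m.
all: elim: m => [|m IHm] ml; first by apply: nmoment_out0; lia.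
all: have [|mN] := leqP (N + p) m.+1; first exact: nmoment_out.
all: have qn : forall q, q.+1%:R != 0 :> R by move=> q; rewrite pnatr_eq0.
- have E : (p - 1).+1 = p by lia.
  have /eqP : bmoment f (p - 1).+1 m = 0 by rewrite E Xl //; lia.
  rewrite bmoment_rec ?E // f0 // (_ : (m.+1 == N + p)%N = false); last by lia.
  rewrite mulr0 mul0r subrr sub0r oppr_eq0 mulf_eq0 -{1}E (negbTE (qn _)) /=.
  by rewrite IHm ?sub0r ?oppr_eq0 => [/eqP //|]; lia.
have E : (p - d.+2).+1 = (p - d.+1)%N by lia.
have /eqP : bmoment f (p - d.+2).+1 m = 0 by rewrite E bmomentE IHd ?mulr0 //; lia.
rewrite bmoment_rec //; last by lia.
rewrite f0; last by lia.
rewrite (_ : (m.+1 == N + p)%N = false); last by lia.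
rewrite mulr0 mul0r subrr sub0r oppr_eq0 mulf_eq0 (negbTE (qn _)) /=.
by rewrite IHm ?sub0r ?oppr_eq0 => [/eqP //|]; lia.
Qed.

(** In degree 0, [left_nmoment] says that [f] does not vary between consecutive
    knots up to the knot [l]. *)
Lemma left_zero k : (0 < p)%N -> (k <= l)%N -> (k < N)%N -> (f k).[0] = 0.
Proof.
move=> p0; elim: k => [|k IH] kl kN; first by rewrite -[f 0%N]derivn0 f0.
have := cf (leq0n _) kN; rewrite !derivn0 => <-.
apply/eqP; rewrite -[X in X == 0]subr0 -[X in _ - X](IH _ _); [|lia|lia].
rewrite -bmoment0; last by lia.
have -> : 0%N = (p - p.-1.+1)%N by lia.
by rewrite bmomentE left_nmoment ?mulr0 //; lia.
Qed.

Lemma left_zero1 k : (0 < p)%N -> (k < l)%N -> (k < N)%N -> (f k).[1] = 0.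
Proof.
move=> p0 kl kN; rewrite -[LHS](subrK (f k).[0]) left_zero //; last by lia.
rewrite addr0 -[X in _ - X](left_zero p0 (ltnW kl) kN) -bmoment0 //.
have -> : 0%N = (p - p.-1.+1)%N by lia.
by rewrite bmomentE left_nmoment ?mulr0 //; lia.
Qed.

Hypothesis Xr : forall m, (l < m)%N -> (m.+1 < N + p)%N -> bmoment f p m = 0.

(** Beyond [l] the normalised moments of degree [p.-1] are constant, and their
    value comes from the recursion at [l], where the moment of degree [p] need
    not vanish. *)
Lemma left_last : (0 < p)%N -> (l.+1 < N + p)%N -> nmoment f p.-1 (N + p).-1 = bmoment f p l / p%:R.
Proof.
move=> p0 lN1.
have pR0 : p%:R != 0 :> R by rewrite pnatr_eq0; lia.
have E : p.-1.+1 = p by lia.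
suff H m : (l < m)%N -> (m < N + p)%N -> nmoment f p.-1 m = bmoment f p l / p%:R by apply: H; lia.
elim: m => // m IH lm mN.
move: lm; rewrite ltnS leq_eqVlt => /orP[/eqP e|lm].
  subst m; apply: (mulfI pR0); rewrite mulrCA divff // mulr1.
  rewrite -{3}E bmoment_rec ?E // f0 // (_ : (l.+1 == N + p)%N = false); last by lia.
  rewrite (_ : nmoment f p.-1 l = 0); last by rewrite -subn1 left_nmoment //; lia.
  by rewrite mulr0 mul0r subrr !sub0r mulrN opprK.
have := Xr lm mN; rewrite -{1}E bmoment_rec ?E // f0 // (_ : (m.+1 == N + p)%N = false); last by lia.
rewrite mulr0 mul0r subrr sub0r => /eqP; rewrite oppr_eq0 mulf_eq0 (negbTE pR0) /=.
by rewrite subr_eq0 => /eqP <-; apply: IH => //; lia.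
Qed.

End Left.

(** The same argument run from the right end, where [F] is assumed to vanish to
    order [p]. *)
Section Right.
Variables (F : nat -> {poly R}) (l : nat).
Hypothesis cF : knot_smooth p F.
Hypothesis F1 : forall i, (i < p)%N -> ((F N.-1)^`(i)).[1] = 0.
Hypothesis Xr : forall m, (l < m)%N -> (m.+1 < N + p)%N -> bmoment F p m = 0.
Hypothesis Zlast : nmoment F p.-1 (N + p).-1 = 0.
Hypothesis p0 : (0 < p)%N.

Lemma right_nmoment d m : (d < p)%N -> (l < m)%N -> nmoment F (p - d.+1) m = 0.
Proof.
elim: d m => [|d IHd] m dp lm.
all: have [|mN] := leqP (N + p) m; first exact: nmoment_out.
all: have qn : forall q, q.+1%:R != 0 :> R by move=> q; rewrite pnatr_eq0.
all: have [e me] : exists e, m = ((N + p).-1 - e)%N by exists ((N + p).-1 - m)%N; lia.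
all: elim: e m lm mN me => [|e IHe] m lm mN me.
- by rewrite me subn0 subn1.
- have E : (p - 1).+1 = p by lia.
  have mN1 : (m.+1 < N + p)%N by lia.
  have /eqP : bmoment F (p - 1).+1 m = 0 by rewrite E Xr.
  rewrite bmoment_rec ?E // (_ : (m.+1 == N + p)%N = false); last by lia.
  rewrite (_ : (m + p == p)%N = false); last by lia.
  rewrite !mulr0 subrr sub0r oppr_eq0 mulf_eq0 -{1}E (negbTE (qn _)) /=.
  by rewrite (IHe m.+1) ?subr0; [move=> /eqP|lia|lia|lia].
all: have E : (p - d.+2).+1 = (p - d.+1)%N by lia.
all: have [|mp] := leqP (m + (p - d.+2).+1) p; first by move=> mp; apply: nmoment_out0; lia.
all: have /eqP : bmoment F (p - d.+2).+1 m = 0 by rewrite E bmomentE IHd ?mulr0 //; lia.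
all: rewrite bmoment_rec //; last by lia.
all: rewrite F1; last by lia.
all: rewrite (_ : (m + _ == p)%N = false); last by lia.
all: rewrite mul0r mulr0 subrr sub0r oppr_eq0 mulf_eq0 (negbTE (qn _)) /=.
- by rewrite (@nmoment_out F (p - d.+2)%N m.+1) ?subr0 => [/eqP //|]; lia.
- by rewrite (IHe m.+1) ?subr0; [move=> /eqP|lia|lia|lia].
Qed.

Lemma right_zero_step k : (l < k + p)%N -> (k < N)%N -> (F k).[1] = (F k).[0].
Proof.
move=> lk kN; apply/eqP; rewrite -subr_eq0 -bmoment0 //.
have -> : 0%N = (p - p.-1.+1)%N by lia.
by rewrite bmomentE right_nmoment ?mulr0 //; lia.
Qed.

Lemma right_zero k : (l < k + p)%N -> (k < N)%N -> (F k).[0] = 0 /\ (F k).[1] = 0.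
Proof.
move=> lk kN; have [e ke] : exists e, (k + e = N.-1)%N by exists (N.-1 - k)%N; lia.
elim: e k lk kN ke => [|e IH] k lk kN ke.
  have H : (F k).[1] = 0 by rewrite (_ : k = N.-1); [exact: (F1 p0)|lia].
  by rewrite -right_zero_step.
have [kN1|kN1] := ltnP k.+1 N; last first.
  have kE : k = N.-1 by lia.
  have H : (F k).[1] = 0 by rewrite kE; exact: (F1 p0).
  by rewrite -right_zero_step.
have H : (F k).[1] = 0.
  have := cF (leq0n _) kN1; rewrite !derivn0 => ->.
  have a1 : (l < k.+1 + p)%N by lia.
  have a2 : (k.+1 + e = N.-1)%N by lia.
  by case: (IH k.+1 a1 kN1 a2).
by rewrite -right_zero_step.
Qed.

(** For such [i] the recursion at the left end has no other term than the
    boundary one. *)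
Lemma right_deriv0 i : (0 < i)%N -> (i + l < p)%N -> ((F 0%N)^`(i)).[0] = 0.
Proof.
case: i => // i _ il.
have E : i = (p - (p - i.+1).-1.+2)%N by lia.
have : bmoment F i.+1 (p - i.+1) = 0.
  by rewrite bmomentE (_ : i.+1 = p - (p - i.+2).+1)%N ?right_nmoment ?mulr0 //; lia.
rewrite bmoment_rec //; last by lia.
rewrite F1; last by lia.
rewrite (_ : (p - i.+1 + i.+1 == p)%N); last by lia.
rewrite (@nmoment_out0 F i (p - i.+1)%N); last by lia.
rewrite (_ : nmoment F i (p - i.+1).+1 = 0); last first.
  by rewrite [X in nmoment _ X](_ : i = p - (p - i.+1).+1)%N ?right_nmoment //; lia.
by rewrite mul0r subrr mulr0 subr0 sub0r mulr1 => /eqP; rewrite oppr_eq0 => /eqP.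
Qed.

End Right.

(** Integration by parts against the constant 1 shows that consecutive
    normalised B-splines have equal integrals, and the last one has integral
    [q.+1^-1]. *)
Lemma npiece_mass q m : (q < p)%N -> (p <= m + q)%N -> (m < N + p)%N ->
  pairing (fun=> 1) (npiece q m) = q.+1%:R^-1.
Proof.
move=> qp mq mN.
have [e me] : exists e, m = ((N + p).-1 - e)%N by exists ((N + p).-1 - m)%N; lia.
have qn : q.+1%:R != 0 :> R by rewrite pnatr_eq0.
elim: e m mq mN me => [|e IH] m mq mN me.
all: have c1 : knot_cont (fun=> 1) by move=> k _; rewrite -polyC1 !hornerC.
all: have := ibp m qp c1.
all: rewrite (_ : pairing (fun=> 1^`()) (bpiece q.+1 m) = 0); last by
  rewrite -polyC1 derivC; apply: big1 => k _; rewrite mul0r int010.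
all: rewrite -polyC1 !hornerC !mul1r (_ : (m + q.+1 == p)%N = false) ?subr0; last by lia.
- rewrite (_ : (m.+1 == N + p)%N); last by lia.
  rewrite [pairing _ (npiece q m.+1)]pairing0r => [|k kN]; last by apply: npiece_supp; rewrite !knotE; lia.
  rewrite subr0 => /esym/eqP; rewrite subr_eq0 => /eqP H.
  by apply: (mulfI qn); rewrite -H divff.
- rewrite (_ : (m.+1 == N + p)%N = false); last by lia.
  rewrite sub0r => /esym/eqP; rewrite oppr_eq0 mulf_eq0 (negbTE qn) /= subr_eq0 => /eqP ->.
  by apply: IH; lia.
Qed.

End Forms.

(** * A polynomial controlled by its moments *)

Section Shift.
Variable R : realFieldType.
Implicit Types f g h : {poly R}.

Lemma derivn_shift f c i : (f \Po ('X + c%:P))^`(i) = f^`(i) \Po ('X + c%:P).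
Proof.
elim: i => [|i IH]; first by rewrite !derivn0.
by rewrite !derivnS IH deriv_comp derivD derivX derivC addr0 mulr1.
Qed.

Lemma shift_shift f a b : (f \Po ('X + a%:P)) \Po ('X + b%:P) = f \Po ('X + (a + b)%:P).
Proof.
rewrite -comp_polyA; congr (_ \Po _).
by rewrite comp_polyD comp_polyX comp_polyC polyCD -addrA [b%:P + _]addrC.
Qed.

Lemma shift0 f : f \Po ('X + 0%:P) = f.
Proof. by rewrite polyC0 addr0 comp_polyXr. Qed.

Lemma coef_fact f i : f`_i * i`!%:R = (f^`(i)).[0].
Proof. by rewrite horner_coef0 coef_derivn addn0 ffactnn mulr_natr. Qed.

Lemma derivnD_comm f i j : f^`(i)^`(j) = f^`(i + j).
Proof. by rewrite addnC /derivn iterD. Qed.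

Lemma size_derivn_leq f n i : (size f <= n)%N -> (size f^`(i) <= n - i)%N.
Proof.
move=> fn; apply/leq_sizeP => j nj.
rewrite coef_derivn nth_default ?mul0rn //; apply: leq_trans fn _; lia.
Qed.

Lemma comp_shiftE f c n : (size f <= n)%N ->
  f \Po ('X + c%:P) = \sum_(i < n) f`_i *: ('X + c%:P) ^+ i.
Proof.
move=> fn; rewrite comp_polyE.
apply: (sum_wide (F := fun i => f`_i *: ('X + c%:P) ^+ i)) => // i si.
by rewrite nth_default // scale0r.
Qed.

Lemma coef_norm_derivn f n i : (size f <= n.+1)%N -> coef_norm f^`(i) <= n%:R ^+ i * coef_norm f.
Proof.
move=> fn; elim: i => [|i IH]; first by rewrite derivn0 expr0 mul1r.
rewrite derivnS exprS -mulrA; apply: le_trans (coef_norm_deriv (n := n) _) _.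
  by apply: leq_trans (size_derivn_leq i fn) _; lia.
by rewrite ler_wpM2l.
Qed.

End Shift.

Section CoefBound.
Variable R : realFieldType.
Variable p : nat.

Lemma pairing_bound N F q m (B : R) : 0 <= B ->
  (forall k, (knot p N m <= k < knot p N (m + q.+1))%N -> `|int01 (F k * npiece R p N q m k)| <= B) ->
  `|pairing N F (npiece R p N q m)| <= q.+1%:R * B.
Proof.
move=> B0 H; apply: le_trans (ler_norm_sum _ _ _) _.
have kk : (knot p N m <= knot p N (m + q.+1))%N by apply: knot_le; lia.
have kN : (knot p N (m + q.+1) <= N)%N by rewrite /knot; lia.
rewrite -(big_mkord xpredT (fun k => `|int01 (F k * npiece R p N q m k)|)).
rewrite (big_cat_nat (n := knot p N m)) //=; last exact: leq_trans kk kN.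
rewrite (big_cat_nat (n := knot p N (m + q.+1)) (m := knot p N m)) //=.
have Z k : ~~ (knot p N m <= k < knot p N (m + q.+1))%N -> `|int01 (F k * npiece R p N q m k)| = 0.
  by move=> h; rewrite npiece_supp // mulr0 int010 normr0.
rewrite big_nat_cond big1 ?add0r => [|k]; last by rewrite andbT => h; apply: Z; lia.
rewrite [X in _ + X]big_nat_cond [X in _ + X]big1 ?addr0 => [|k]; last first.
  by rewrite andbT => h; apply: Z; lia.
apply: le_trans (_ : \sum_(knot p N m <= k < knot p N (m + q.+1)) B <= _).
  by apply: ler_sum_nat => k hk; apply: H.
rewrite sumr_const_nat -[leLHS]mulr_natl; apply: ler_wpM2r => //.
by rewrite ler_nat /knot; lia.
Qed.

(** [H0] is a polynomial expanded around the knot [k0].  Its q-th derivative is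
    orthogonal to one B-spline of degree [q.-1] supported near [k0], or has
    value 0 at [k0]. *)
Definition has_null_moment N (k0 : nat) (H0 : {poly R}) q :=
  H0`_q = 0 \/ exists m, [/\ (p <= m + q.-1)%N, (m < N + p)%N,
     pairing N (fun k => H0^`(q) \Po ('X + (k%:R - k0%:R)%:P)) (npiece R p N q.-1 m) = 0 &
     forall k, (knot p N m <= k < knot p N (m + q))%N -> (k <= k0 + p)%N && (k0 <= k + p)%N].

(** Downward induction on the order of the coefficient.  The constant term of
    [H0^(q)] contributes its product with the integral of the B-spline
    ([npiece_mass]) to the null moment, and the other terms only involve higher
    coefficients of [H0], already bounded. *)
Lemma coef_bound_down : exists2 K : R, 0 < K & forall N k0 (H0 : {poly R}) (Y : R), (0 < N)%N ->
  (size H0 <= p.+1)%N -> `|H0`_p| <= Y ->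
  (forall q, (0 < q)%N -> (q < p)%N -> has_null_moment N k0 H0 q) ->
  forall i, (0 < i)%N -> `|H0`_i| <= K * Y.
Proof.
suff H d : (d < p)%N -> exists2 K : R, 0 < K & forall N k0 (H0 : {poly R}) (Y : R), (0 < N)%N ->
  (size H0 <= p.+1)%N -> `|H0`_p| <= Y ->
  (forall q, (0 < q)%N -> (q < p)%N -> has_null_moment N k0 H0 q) ->
  forall i, (p - d <= i)%N -> `|H0`_i| <= K * Y.
  have [p0|p0] := posnP p.
    exists 1 => // N k0 H0 Y _ sH HY _ i i0; rewrite nth_default ?normr0 ?mul1r.
      by apply: le_trans HY; exact: normr_ge0.
    by apply: leq_trans sH _; rewrite p0.
  have [K K0 HK] := H p.-1 ltac:(lia).
  exists K => // N k0 H0 Y N0 sH HY HO i i0; apply: (HK N k0) => //; lia.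
elim: d => [|d IH] dp.
  exists 1 => // N k0 H0 Y _ sH HY _ i; rewrite subn0 leq_eqVlt => /orP[/eqP <-|ip].
    by rewrite mul1r.
  rewrite nth_default ?normr0 ?mul1r //; last by apply: leq_trans sH _.
  by apply: le_trans HY; exact: normr_ge0.
have [K K0 HK] := IH (ltnW dp).
set q := (p - d.+1)%N.
have q0 : (0 < q)%N by rewrite /q; lia.
pose B : R := (1 + p%:R) ^+ p * (2 * (1 + q.-1%:R)) ^+ q.-1.
have B0 : 0 <= B by apply: mulr_ge0; apply: exprn_ge0; [exact: addr_ge0|apply: mulr_ge0 => //; exact: addr_ge0].
pose C : R := \sum_(j < p.+1) (j ^_ q)%:R.
have C0 : 0 <= C by apply: sumr_ge0.
have CE j : (j < p.+1)%N -> (j ^_ q)%:R <= C.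
  move=> jp; rewrite /C (bigD1 (Ordinal jp)) //= lerDl; exact: sumr_ge0.
pose K' : R := q%:R * (d.+1%:R * (K * C * (q%:R * B))).
have K'0 : 0 <= K' by do ?[apply: mulr_ge0 => //]; exact: ltW.
exists (K + K') => [|N k0 H0 Y N0 sH HY HO i]; first exact: ltr_wpDr.
have Y0 : 0 <= Y by apply: le_trans HY; exact: normr_ge0.
rewrite leq_eqVlt => /orP[/eqP <-|iq]; last first.
  have ip : (p - d <= i)%N by rewrite /q in iq; lia.
  apply: le_trans (HK N k0 H0 Y N0 sH HY HO i ip) _.
  by rewrite ler_wpM2r // lerDl.
apply: le_trans (_ : K' * Y <= _); last by rewrite ler_wpM2r // lerDr ltW.
have qp : (q < p)%N by rewrite /q; lia.
have [->|[m [m1 m2 mo mk]]] := HO q q0 qp; first by rewrite normr0 mulr_ge0.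
set D := H0^`(q) in mo.
have sD : (size D <= d.+2)%N.
  by apply: leq_trans (size_derivn_leq q sH) _; rewrite /q; lia.
pose T i := pairing N (fun k => ('X + (k%:R - k0%:R)%:P) ^+ i) (npiece R p N q.-1 m).
have E : \sum_(j < d.+2) D`_j * T j = 0.
  rewrite -[RHS]mo.
  transitivity (\sum_(j < d.+2) \sum_(k < N)
      D`_j * int01 (('X + (k%:R - k0%:R)%:P) ^+ j * npiece R p N q.-1 m k)).
    by apply: eq_bigr => j _; rewrite /T /pairing mulr_sumr.
  rewrite exchange_big /=; apply: eq_bigr => k _.
  rewrite (comp_shiftE _ sD) mulr_suml int01_sum; apply: eq_bigr => j _.
  by rewrite -scalerAl int01Z.
have T0 : T 0%N = q%:R^-1.
  rewrite /T -[X in X%:R^-1](prednK q0) -(@npiece_mass R p N N0 q.-1 m) //; last by lia.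
have TB j : (j <= p)%N -> `|T j| <= q%:R * B.
  move=> jp; rewrite -{1}(prednK q0); apply: pairing_bound => // k.
  rewrite (prednK q0) => /mk /andP[ka kb].
  apply: le_trans (int01_le _) _; apply: le_trans (coef_norm_XaddCX _ _ _) _.
  have cb : `|k%:R - k0%:R| <= p%:R :> R.
    move: ka kb; rewrite -!(ler_nat R) !natrD ler_norml => ka kb.
    by apply/andP; split; lra.
  apply: ler_pM; [by apply: exprn_ge0; apply: addr_ge0|exact: coef_norm_ge0| |].
    apply: le_trans (_ : (1 + p%:R) ^+ j <= _).
      by apply: lerXn2r; rewrite ?nnegrE ?addr_ge0 // lerD2l.
    by apply: ler_weXn2l => //; rewrite lerDl.
  exact: le_trans (coef_norm_npiece_bpiece _ _ _ _ _ _) (coef_norm_bpiece _ _ _ _ _ _).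
have D0 : `|H0`_q| <= `|D`_0|.
  rewrite coef_derivn addn0 ffactnn normrMn -[leRHS]mulr_natr ler_peMr //.
  by rewrite ler1n fact_gt0.
apply: le_trans D0 _.
have qR : 0 < q%:R :> R by rewrite ltr0n.
move: E; rewrite big_ord_recl T0 => /eqP; rewrite addr_eq0 => /eqP E.
have -> : D`_0 = q%:R * (- \sum_(j < d.+1) D`_(lift ord0 j) * T (lift ord0 j)).
  by rewrite -E mulrC divfK // lt0r_neq0.
rewrite normrM normrN (ger0_norm (ltW qR)) /K' -mulrA ler_pM2l //.
apply: le_trans (ler_norm_sum _ _ _) _.
apply: le_trans (_ : \sum_(j < d.+1) (K * Y * C * (q%:R * B)) <= _); last first.
  by rewrite sumr_const card_ord -[leLHS]mulr_natl le_eqVlt; apply/orP; left; apply/eqP; ring.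
apply: ler_sum => j _; rewrite normrM; apply: ler_pM => //; last first.
  by apply: TB; have := ltn_ord j; rewrite /= /bump /=; lia.
have jd := ltn_ord j; rewrite coef_derivn normrMn -[leLHS]mulr_natr.
apply: ler_pM => //; last by apply: CE; rewrite /= /bump /q /=; lia.
by apply: (HK N k0 H0 Y N0 sH HY HO); rewrite /= /bump /q /=; lia.
Qed.

End CoefBound.

(** * States of splines at the knots and B-spline coefficients *)

Section States.
Variable R : realFieldType.
Variables (N : nat).
Implicit Types F G : nat -> {poly R}.

(** The antiderivative of a piecewise polynomial function that vanishes at the
    left end and is continuous across the knots. *)
Definition antideriv_pieces F k : {poly R} := antideriv (F k) + (\sum_(j < k) int01 (F j))%:P.

Lemma deriv_antideriv_pieces F k : (antideriv_pieces F k)^`() = F k.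
Proof. by rewrite /antideriv_pieces derivD deriv_antideriv derivC addr0. Qed.

Lemma antideriv_pieces_cont F : knot_cont N (antideriv_pieces F).
Proof.
move=> k kN; rewrite /antideriv_pieces !hornerD !hornerC antideriv_0 antideriv_1 add0r big_ord_recr /=.
by rewrite addrC.
Qed.

Lemma antideriv_pieces0 F : (antideriv_pieces F 0).[0] = 0.
Proof. by rewrite /antideriv_pieces hornerD hornerC antideriv_0 big_ord0 addr0. Qed.

Lemma size_antideriv_pieces F k : (size (antideriv_pieces F k) <= (size (F k)).+1)%N.
Proof.
apply: leq_trans (size_polyD _ _) _; rewrite geq_max size_antideriv.
by apply: leq_trans (size_polyC_leq1 _) _.
Qed.

Lemma derivn_iter_antideriv_pieces F a i k : (i <= a)%N -> (iter a antideriv_pieces F k)^`(i) = iter (a - i) antideriv_pieces F k.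
Proof.
elim: i a => [|i IH] [|a] // ia.
by rewrite derivSn /= deriv_antideriv_pieces IH.
Qed.

Lemma size_iter_antideriv_pieces F a k n : (forall k, size (F k) <= n)%N -> (size (iter a antideriv_pieces F k) <= n + a)%N.
Proof.
move=> H; elim: a => [|a IH]; first by rewrite addn0.
by rewrite addnS; apply: leq_trans (size_antideriv_pieces _ _) _.
Qed.

(** No piece starts at the last knot, where the shifted last piece is used. *)
Definition state m F k : 'cV[R]_m :=
  if (k < N)%N then coef_tail m (F k) else coef_tail m (F N.-1 \Po ('X + 1)).

Lemma coef_tailB m (f g : {poly R}) : coef_tail m (f - g) = coef_tail m f - coef_tail m g.
Proof. by apply/colP => i; rewrite !mxE coefB. Qed.

Lemma stateB m F G k : state m (fun k => F k - G k) k = state m F k - state m G k.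
Proof. by rewrite /state; case: ifP => _; rewrite ?comp_polyB coef_tailB. Qed.

Lemma coef_factI (f g : {poly R}) i : (f^`(i)).[0] = (g^`(i)).[0] -> f`_i = g`_i.
Proof.
rewrite -!coef_fact => H; apply: (mulIf _ H).
by rewrite pnatr_eq0 -lt0n fact_gt0.
Qed.

Lemma derivn_shift1 (f : {poly R}) i : ((f \Po ('X + 1))^`(i)).[0] = (f^`(i)).[1].
Proof. by rewrite -polyC1 derivn_shift horner_comp hornerD hornerX hornerC add0r. Qed.

Lemma state_succ m F k : knot_smooth N m F -> (k < N)%N -> state m F k.+1 = coef_tail m (F k \Po ('X + 1)).
Proof.
move=> cF kN; rewrite /state; case: ifP => kN1; last first.
  by rewrite (_ : N.-1 = k) //; lia.
apply/colP => i; rewrite !mxE; apply: coef_factI.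
by rewrite derivn_shift1 (cF _ _ _ kN1).
Qed.

Lemma state_null m F k : knot_smooth N m F -> (k < N)%N -> (size (F k) <= m.+2)%N ->
  (F k).[0] = 0 -> (F k).[1] = 0 -> state m F k.+1 = - (transfer R m *m state m F k).
Proof.
move=> cF kN sF F0 F1; rewrite state_succ // /state kN coef_tail_shift //.
by rewrite -horner_coef0.
Qed.

(** The coefficient of order 0 is zero, and the one of order [m.+1] is minus
    the sum of the others. *)
Lemma coef_norm_null m (f : {poly R}) : (size f <= m.+2)%N -> f.[0] = 0 -> f.[1] = 0 ->
  coef_norm f <= 2 * l1norm (coef_tail m f).
Proof.
move=> sf; rewrite horner_coef0 => f0 f1.
have nE : l1norm (coef_tail m f) = \sum_(i < m) `|f`_i.+1|.
  by apply: eq_bigr => i _; rewrite mxE.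
rewrite (coef_norm_wide sf) big_ord_recl big_ord_recr /= f0 normr0 add0r nE mulrDl mul1r.
apply: lerD => //.
move: f1; rewrite (horner1_sum sf) big_ord_recl big_ord_recr /= f0 add0r.
rewrite addrC => /eqP; rewrite addr_eq0 => /eqP ->; rewrite normrN.
exact: ler_norm_sum.
Qed.

End States.

Section CoefFromSpline.
Variable R : realFieldType.
Variable p : nat.

(** On the k-th interval only [q.+1] B-splines of degree [q] are nonzero. *)
Definition local_spline N q (c : nat -> R) k : {poly R} :=
  \sum_(i < q.+1) c (k + p - q + i)%N *: bpiece R p N q (k + p - q + i) k.

Lemma deriv_local_spline N q c k : (q < p)%N -> (k < N)%N ->
  (local_spline N q.+1 c k)^`() =
  local_spline N q (fun j => q.+1%:R * (c j - c j.-1) / knot_gap R p N q j) k.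
Proof.
move=> qp kN; rewrite /local_spline raddf_sum /=.
set a := fun j => npiece R p N q j k.
transitivity (q.+1%:R *: (\sum_(i < q.+2) (c (k + p - q.+1 + i)%N *: a (k + p - q.+1 + i)%N)
   - \sum_(i < q.+2) (c (k + p - q.+1 + i)%N *: a (k + p - q.+1 + i).+1))).
  rewrite -sumrB scaler_sumr; apply: eq_bigr => i _.
  by rewrite derivZ deriv_bpiece -scalerBr scalerA mulrC -scalerA.
rewrite big_ord_recl [X in _ - X]big_ord_recr /=.
rewrite {1}/a npiece_supp ?scaler0 ?add0r; last by rewrite /knot; lia.
rewrite [a (k + p - q.+1 + q.+1).+1]npiece_supp ?scaler0 ?addr0; last by rewrite /knot; lia.
rewrite -sumrB scaler_sumr; apply: eq_bigr => i _.
rewrite /bump /= (_ : k + p - q.+1 + (1 + i) = k + p - q + i)%N; last by lia.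
rewrite (_ : (k + p - q.+1 + i).+1 = k + p - q + i)%N; last by lia.
rewrite (_ : (k + p - q.+1 + i) = (k + p - q + i).-1)%N; last by lia.
by rewrite -scalerBl scalerA /a /npiece scalerA.
Qed.

(** Local stability of the B-spline basis, by induction on the degree: the
    differences of consecutive coefficients are, up to bounded factors, the
    coefficients of the derivative, and the partition of unity then gives the
    coefficients themselves from one value of the spline. *)
Lemma coef_of_spline q : (q <= p)%N -> exists2 K : R, 0 < K & forall N c k (V : R), (k < N)%N ->
  coef_norm (local_spline N q c k) <= V -> forall j, (k + p - q <= j <= k + p)%N -> `|c j| <= K * V.
Proof.
elim: q => [|q IH] qp.
  exists 1 => // N c k V kN HV j; rewrite subn0 => jk.
  have -> : j = (k + p)%N by lia.
  move: HV; rewrite /local_spline big_ord1 subn0 addn0 bpiece0E // eqxx alg_polyC coef_normC mul1r.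
  by [].
have [K K0 HK] := IH (ltnW qp).
pose D : R := q.+2%:R * (K * q.+2%:R).
pose K' : R := 1 + q.+2%:R * (D * (2 * (1 + q.+1%:R)) ^+ q.+1).
have B0 : 0 <= (2 * (1 + q.+1%:R)) ^+ q.+1 :> R.
  by apply: exprn_ge0; apply: mulr_ge0 => //; apply: addr_ge0.
have D0 : 0 <= D by apply: mulr_ge0 => //; apply: mulr_ge0 => //; exact: ltW.
exists K' => [|N c k V kN HV j jk]; first by apply: ltr_pwDl => //; apply: mulr_ge0 => //; apply: mulr_ge0.
have V0 : 0 <= V by apply: le_trans HV; exact: coef_norm_ge0.
have d1 i : (k + p - q <= i <= k + p)%N -> `|c i - c i.-1| <= K * q.+2%:R * V.
  move=> ik.
  have ss : (size (local_spline N q.+1 c k) <= q.+2)%N.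
    apply: (leq_trans (size_sum _ _ _)); apply/bigmax_leqP => x _.
    by apply: leq_trans (size_scale_leq _ _) (size_bpiece _ _ _ _ _ _).
  have Hd : coef_norm (local_spline N q (fun j => q.+1%:R * (c j - c j.-1) / knot_gap R p N q j) k) <= q.+1%:R * V.
    rewrite -deriv_local_spline //; apply: le_trans (coef_norm_deriv ss) _.
    by rewrite ler_wpM2l.
  have := HK N _ k _ kN Hd i ik.
  have w1 : 1 <= knot_gap R p N q i by apply: knot_gap_ge1; rewrite /knot; lia.
  have w0 : 0 < knot_gap R p N q i by apply: lt_le_trans w1.
  have /andP[_ w2] := knot_gap_le R p N q i.
  rewrite normrM normrM normfV ger0_norm // (ger0_norm (ltW w0)) ler_pdivrMr // => H.
  have q0 : 0 < q.+1%:R :> R by [].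
  rewrite -(ler_pM2l q0); apply: le_trans H _.
  have -> : q.+1%:R * (K * q.+2%:R * V) = K * (q.+1%:R * V) * q.+2%:R by ring.
  apply: ler_wpM2l; first by apply: mulr_ge0; [exact: ltW|exact: mulr_ge0].
  by apply: le_trans w2 _; rewrite ler_nat.
have d2 e i : (e <= q.+2)%N -> (k + p - q.+1 <= i)%N -> (i + e <= k + p)%N -> `|c (i + e)%N - c i| <= e%:R * (K * q.+2%:R * V).
  elim: e => [|e IHe] eq ik ie; first by rewrite addn0 subrr normr0 mul0r.
  rewrite -(subrK (c (i + e)%N) (c (i + e.+1)%N)) -addrA -natr1 mulrDl mul1r [leRHS]addrC.
  apply: le_trans (ler_normD _ _) _; apply: lerD; last by apply: IHe; lia.
  have := d1 (i + e.+1)%N; rewrite addnS /=; apply; lia.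
have Dj i : (k + p - q.+1 <= i <= k + p)%N -> `|c i - c j| <= D * V.
  have E : D * V = q.+2%:R * (K * q.+2%:R * V) by rewrite /D; ring.
  have KV : 0 <= K * q.+2%:R * V by apply: mulr_ge0 => //; apply: mulr_ge0 => //; exact: ltW.
  move=> ik; rewrite E; have [ij|ij] := leqP i j.
    have := d2 (j - i)%N i; rewrite subnKC // distrC => /(_ _ _ _) H.
    apply: le_trans (H _ _ _) _; try by lia.
    by rewrite ler_wpM2r // ler_nat; lia.
  have := d2 (i - j)%N j; rewrite subnKC ?(ltnW ij) // => /(_ _ _ _) H.
  apply: le_trans (H _ _ _) _; try by lia.
  by rewrite ler_wpM2r // ler_nat; lia.
have E : c j = (local_spline N q.+1 c k).[0] - \sum_(i < q.+2) (c (k + p - q.+1 + i)%N - c j) * (bpiece R p N q.+1 (k + p - q.+1 + i) k).[0].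
  rewrite /local_spline horner_sum -sumrB.
  under eq_bigr do rewrite hornerZ -mulrBl opprB addrCA subrr addr0.
  by rewrite -mulr_sumr -horner_sum bpiece_unity // -polyC1 hornerC mulr1.
rewrite E; apply: le_trans (ler_normB _ _) _; rewrite /K' mulrDl mul1r; apply: lerD.
  exact: le_trans (horner0_le _) HV.
apply: le_trans (ler_norm_sum _ _ _) _.
apply: le_trans (_ : \sum_(i < q.+2) (D * V * (2 * (1 + q.+1%:R)) ^+ q.+1) <= _); last first.
  by rewrite sumr_const card_ord -[leLHS]mulr_natl le_eqVlt; apply/orP; left; apply/eqP; ring.
apply: ler_sum => i _; rewrite normrM; apply: ler_pM => //.
  by apply: Dj; have := ltn_ord i; lia.
exact: le_trans (horner0_le _) (coef_norm_bpiece _ _ _ _ _ _).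
Qed.

End CoefFromSpline.

(** * The uniform inverse bound *)

Section Main.
Variable R : realFieldType.

Lemma coef_eq0_derivn (f : {poly R}) i : (f^`(i)).[0] = 0 -> f`_i = 0.
Proof.
by move=> H; rewrite (@coef_factI R f 0 i) ?coef0 // H linear0 horner0.
Qed.

Definition spline p N (c : nat -> R) k : {poly R} := \sum_(j < N + p) c j *: bpiece R p N p j k.

Lemma splineE p N c k : (k < N)%N -> spline p N c k = local_spline p N p c k.
Proof. by move=> kN; rewrite /spline bpiece_local. Qed.

Lemma spline_cont p N c i : (i < p)%N -> knot_cont N (fun k => (spline p N c k)^`(i)).
Proof.
move=> ip k kN; rewrite /spline !raddf_sum /= !horner_sum; apply: eq_bigr => j _.
by rewrite !derivnZ !hornerZ bpiece_derivn_cont.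
Qed.

Lemma size_spline p N c k : (size (spline p N c k) <= p.+1)%N.
Proof.
apply: (leq_trans (size_sum _ _ _)); apply/bigmax_leqP => x _.
by apply: leq_trans (size_scale_leq _ _) (size_bpiece _ _ _ _ _ _).
Qed.

Lemma spline0 p N c : (0 < N)%N -> (spline p N c 0).[0] = c 0%N.
Proof.
move=> N0; rewrite /spline horner_sum.
have N1 : (0 < N + p)%N by rewrite addn_gt0 N0.
rewrite (bigD1 (Ordinal N1)) //= hornerZ bpiece_at0 // add0n eqxx mulr1.
rewrite big1 ?addr0 // => j j0; rewrite hornerZ bpiece_at0 // (_ : (j + p == p)%N = false) ?mulr0 //.
by apply/negbTE; apply: contraNN j0 => /eqP e; apply/eqP/val_inj; rewrite /=; lia.
Qed.

(** Here [v] is a spline, [Y] the pairing of [v'] with the B-spline of index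
    [l], the only one that need not vanish (the last B-spline excepted), and
    [f] the p-fold antiderivative of [v].  The polynomial [G] has degree [p],
    the derivatives of [f] of order below [p] at the right end, and p-th
    derivative [Y]; [H] and [H0] are its expansions at the right end and at the
    knot [k0].  Both [f], on the left of [k0], and [F = f - G], on its right,
    vanish at the knots, hence their states form two chains. *)
Section Source.
Variables (r N l : nat) (c : nat -> R).
Let p := r.+1.
Let m := (r + r.+1)%N.
Hypothesis N0 : (0 < N)%N.
Hypothesis c0 : c 0%N = 0.
Hypothesis lN : (l.+1 < N + p)%N.
Let v := spline p N c.
Let test j := pairing N (fun k => (v k)^`()) (bpiece R p N p j).
Hypothesis Hy : forall j, (j.+1 < N + p)%N -> j != l -> test j = 0.
Let Y := test l.
Let f := iter p (@antideriv_pieces R) v.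
Let k0 := minn l N.
Let H : {poly R} := \poly_(i < p.+1) ((if (i < p)%N then ((f N.-1)^`(i)).[1] else Y) / i`!%:R).
Let G k := H \Po ('X + (k%:R - N%:R)%:P).
Let F k := f k - G k.
Let H0 := H \Po ('X + (k0%:R - N%:R)%:P).

Let Ef i k : (i <= p)%N -> (f k)^`(i) = iter (p - i) (@antideriv_pieces R) v k.
Proof. exact: derivn_iter_antideriv_pieces. Qed.

Let Efp j k : (f k)^`(p + j) = (v k)^`(j).
Proof. by rewrite -derivnD_comm Ef // subnn. Qed.

Let cf : knot_smooth N m f.
Proof.
move=> i im; have [ip|pi] := ltnP i p.
  move=> k kN; rewrite !Ef ?(ltnW ip) //.
  rewrite (_ : (p - i)%N = (p - i).-1.+1); last by lia.
  exact: antideriv_pieces_cont.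
move=> k kN; rewrite (_ : i = p + (i - p))%N; last by lia.
by rewrite !Efp spline_cont //; rewrite /m /p in im *; lia.
Qed.

Let pm : (p <= m)%N. Proof. by rewrite /m leq_addl. Qed.

Let cfp : knot_smooth N p f.
Proof. by move=> i ip; apply: cf; exact: leq_trans pm. Qed.

Let f00 i : (i <= p)%N -> ((f 0%N)^`(i)).[0] = 0.
Proof.
rewrite leq_eqVlt => /orP[/eqP ->|ip]; first by rewrite Ef // subnn spline0.
rewrite Ef ?(ltnW ip) //.
rewrite (_ : (p - i)%N = (p - i).-1.+1); last by lia.
exact: antideriv_pieces0.
Qed.

Let sf k : (size (f k) <= m.+2)%N.
Proof.
have := @size_iter_antideriv_pieces R v p k p.+1 (fun k => size_spline p N c k).
by rewrite /m /p; rewrite (_ : r.+2 + r.+1 = (r + r.+1).+2)%N //; lia.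
Qed.

Let bmomentY j : bmoment p N f p j = test j.
Proof. by apply: pairing_eq => k _; rewrite -addn1 Efp derivn1. Qed.

Let fXl j : (j < l)%N -> bmoment p N f p j = 0.
Proof. by move=> jl; rewrite bmomentY Hy //; lia. Qed.

Let fXr j : (l < j)%N -> (j.+1 < N + p)%N -> bmoment p N f p j = 0.
Proof. by move=> jl jN; rewrite bmomentY Hy //; lia. Qed.

Let lN' : (l < N + p)%N. Proof. exact: ltnW. Qed.

Let derivG q k : (G k)^`(q) = H^`(q) \Po ('X + (k%:R - N%:R)%:P).
Proof. exact: derivn_shift. Qed.

Let N1R : (N.-1)%:R = N%:R - 1 :> R.
Proof. by rewrite -[in RHS](prednK N0) -natr1 addrK. Qed.

Let cG n : knot_smooth N n G.
Proof.
move=> i _ k kN; rewrite !derivG !horner_comp !hornerD !hornerX !hornerC -natr1.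
by congr (_.[_]); ring.
Qed.

Let sH : (size H <= p.+1)%N. Proof. exact: size_poly. Qed.

Let H_fact i : (i < p.+1)%N -> (H^`(i)).[0] = if (i < p)%N then ((f N.-1)^`(i)).[1] else Y.
Proof.
move=> ip; rewrite -coef_fact coef_poly ip divfK // ?pnatr_eq0 -?lt0n ?fact_gt0.
Qed.

Let Hp : H^`(p) = Y%:P.
Proof.
have s1 : (size H^`(p) <= 1)%N by apply: leq_trans (size_derivn_leq p sH) _; lia.
have := H_fact (ltnSn p); rewrite ltnn => <-.
by rewrite {1}(size1_polyC s1) horner_coef0.
Qed.

Let Gp k : (G k)^`(p) = Y%:P.
Proof. by rewrite derivG Hp comp_polyC. Qed.

Let F_T i : (i < p)%N -> ((F N.-1)^`(i)).[1] = 0.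
Proof.
move=> ip; rewrite /F derivnB hornerD hornerN derivG horner_comp !hornerD hornerX hornerC.
rewrite (_ : 1 + ((N.-1)%:R - N%:R) = 0); last by rewrite N1R; ring.
by rewrite H_fact ?ip ?subrr // ltnW.
Qed.

Let cF : knot_smooth N m F.
Proof.
move=> i im k kN; rewrite /F !derivnB !hornerD !hornerN (cf im kN).
by have := @cG m i im k kN; rewrite /= => ->.
Qed.

Let cFp : knot_smooth N p F.
Proof. by move=> i ip; apply: cF; exact: leq_trans pm. Qed.

Let ZFE q j : nmoment p N F q j = nmoment p N f q j - nmoment p N G q j.
Proof. by rewrite /nmoment -pairingBl; apply: pairing_eq => k _; rewrite /F derivnB. Qed.

Let FXr j : (l < j)%N -> (j.+1 < N + p)%N -> bmoment p N F p j = 0.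
Proof.
move=> lj jN; rewrite bmomentE ZFE mulrBr -!bmomentE fXr // sub0r.
rewrite (_ : bmoment p N G p j = 0) ?oppr0 //; apply: big1 => k _.
by rewrite derivnS Gp derivC mul0r int010.
Qed.

Let Zlast : nmoment p N F p.-1 (N + p).-1 = 0.
Proof.
rewrite ZFE (left_last N0 cfp f00 lN' fXl fXr) // bmomentY.
have -> : nmoment p N G p.-1 (N + p).-1 = Y * p%:R^-1.
  have -> : nmoment p N G p.-1 (N + p).-1 = Y * pairing N (fun=> 1) (npiece R p N p.-1 (N + p).-1).
    rewrite -pairingZl; apply: pairing_eq => k _; have := Gp k; rewrite /p /= => ->.
    by rewrite -mul_polyC mulr1.
  by rewrite npiece_mass //; rewrite /p; lia.
by rewrite subrr.
Qed.

Let fnull k : (k < k0)%N -> (f k).[0] = 0 /\ (f k).[1] = 0.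
Proof.
rewrite /k0 => kk; split.
  by apply: (left_zero N0 cfp f00 lN' fXl) => //; lia.
by apply: (left_zero1 N0 cfp f00 lN' fXl) => //; lia.
Qed.

Let Fnull k : (k0 <= k < N)%N -> (F k).[0] = 0 /\ (F k).[1] = 0.
Proof.
rewrite /k0 => kk; apply: (right_zero N0 cFp F_T FXr Zlast) => //; rewrite /p; lia.
Qed.

Let sF k : (size (F k) <= m.+2)%N.
Proof.
apply: leq_trans (size_polyD _ _) _; rewrite geq_max sf size_polyN.
rewrite size_comp_poly2 ?size_XaddC //.
by apply: leq_trans sH _; rewrite /m /p; lia.
Qed.

Let sH0 : (size H0 <= p.+1)%N.
Proof. by rewrite size_comp_poly2 ?size_XaddC. Qed.

(** Since [p`! * H0`_p = Y]. *)
Let H0p : `|H0`_p| <= `|Y|.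
Proof.
have -> : Y = H0`_p * p`!%:R.
  by rewrite coef_fact derivn_shift Hp comp_polyC hornerC.
by rewrite normrM ler_peMr // ger0_norm // ler1n fact_gt0.
Qed.

Let GH0 k : G k = H0 \Po ('X + (k%:R - k0%:R)%:P).
Proof. by rewrite /H0 shift_shift; congr (_ \Po ('X + _%:P)); ring. Qed.

(** Both [f] and [F] have a vanishing moment against the normalised B-spline of
    degree [q.-1] and index [l + p - q], the largest one to which
    [left_nmoment] applies; hence so has [G = f - F].  When [l = 0] there is no
    interval on the left of the source, and it is the derivatives at 0 that
    vanish. *)
Let orthH0 q : (0 < q)%N -> (q < p)%N -> has_null_moment p N k0 H0 q.
Proof.
move=> q0 qp; have [l0|l0] := posnP l.
  left; apply: coef_eq0_derivn.
  have -> : H0 = G 0 by rewrite /G /H0 /k0 l0 min0n.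
  have -> : G 0%N = f 0%N - F 0%N by rewrite /F opprB addrCA subrr addr0.
  rewrite derivnB hornerD hornerN f00 ?(ltnW qp) //.
  rewrite (right_deriv0 N0 cFp F_T FXr Zlast) ?subrr //.
  by rewrite l0 addn0.
right; exists (minn (l + p - q) (N + p).-1); split.
- by rewrite /p in qp *; lia.
- lia.
- set j := minn _ _.
  have -> : pairing N (fun k => H0^`(q) \Po ('X + (k%:R - k0%:R)%:P)) (npiece R p N q.-1 j) = nmoment p N G q.-1 j.
    by apply: pairing_eq => k _; rewrite GH0 prednK // [in RHS]derivn_shift.
  have E : (q.-1 = p - (p - q).+1)%N by lia.
  have nmoment0 : nmoment p N f q.-1 j = 0.
    by rewrite E (left_nmoment N0 cfp f00 lN' fXl) //; rewrite /j; lia.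
  have ZF0 : nmoment p N F q.-1 j = 0.
    by rewrite E (right_nmoment N0 cFp F_T FXr Zlast) //; rewrite /j; lia.
  by have := ZFE q.-1 j; rewrite nmoment0 ZF0 sub0r => /esym/eqP; rewrite oppr_eq0 => /eqP.
- by move=> k; rewrite /knot /k0; lia.
Qed.

(** The mismatch of the two chains at [k0] is the state of [G] there, which is
    bounded by [`|Y|] through the moments of [G].  The chains are then bounded
    at every knot, and so is [v], which is [f^(p)] on the left and [F^(p) + Y]
    on the right. *)
Lemma source_bound (Kt Kc : R) : 0 < Kt -> 0 < Kc ->
  (forall k0 (u w : nat -> 'cV[R]_(r + r.+1)), (k0 <= N)%N ->
     (forall i : 'I_(r + r.+1), (i < r.+1)%N -> u 0%N i 0 = 0) ->
     (forall i : 'I_(r + r.+1), (i < r)%N -> w N i 0 = 0) ->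
     (forall k, (k < k0)%N -> u k.+1 = - (transfer R (r + r.+1) *m u k)) ->
     (forall k, (k0 <= k < N)%N -> w k.+1 = - (transfer R (r + r.+1) *m w k)) ->
     (forall k, (k <= k0)%N -> l1norm (u k) <= Kt * l1norm (u k0 - w k0)) /\
     (forall k, (k0 <= k <= N)%N -> l1norm (w k) <= Kt * l1norm (u k0 - w k0))) ->
  (forall k0 (H0 : {poly R}) (Y : R), (size H0 <= r.+2)%N -> `|H0`_r.+1| <= Y ->
     (forall q, (0 < q)%N -> (q < r.+1)%N -> has_null_moment r.+1 N k0 H0 q) ->
     forall i, (0 < i)%N -> `|H0`_i| <= Kc * Y) ->
  forall k, (k < N)%N ->
    coef_norm (v k) <= ((m.+1)%:R ^+ p * (2 * (Kt * (m%:R * Kc))) + 1) * `|Y|.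
Proof.
move=> Kt0 Kc0 HT HC k kN.
have k0N : (k0 <= N)%N by rewrite /k0 geq_minr.
have Hc := HC k0 H0 `|Y| sH0 H0p orthH0.
have [|i ir|k1 kk|k1 kk|Hu Hw] := HT k0 (state N m f) (state N m F) k0N.
- move=> i ir; rewrite /state N0 mxE; apply: coef_eq0_derivn; exact: f00.
- rewrite /state ltnn mxE; apply: coef_eq0_derivn; rewrite derivn_shift1.
  by apply: F_T; rewrite /p ltnS.
- have [a b] := fnull kk; apply: state_null => //; lia.
- have [a b] := Fnull kk; apply: state_null => //; lia.
have qE : state N m f k0 - state N m F k0 = coef_tail m H0.
  rewrite -stateB /state /F; case: ifP => kk.
    by rewrite opprB addrCA subrr addr0 GH0 subrr shift0.
  rewrite opprB addrCA subrr addr0 GH0 -polyC1 shift_shift.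
  have -> : k0 = N by lia.
  by rewrite N1R (_ : N%:R - 1 - N%:R + 1 = 0 :> R) ?shift0 //; ring.
have nq : l1norm (state N m f k0 - state N m F k0) <= m%:R * Kc * `|Y|.
  rewrite qE /l1norm.
  apply: le_trans (_ : \sum_(i < m) Kc * `|Y| <= _).
    by apply: ler_sum => i _; rewrite mxE; apply: Hc.
  by rewrite sumr_const card_ord -[leLHS]mulr_natl mulrA.
have m0 : 0 <= (m.+1)%:R ^+ p :> R by apply: exprn_ge0.
have [kk|kk] := ltnP k k0.
  have [a b] := fnull kk.
  have -> : v k = (f k)^`(p) by rewrite Ef // subnn.
  apply: le_trans (coef_norm_derivn p (sf k)) _.
  rewrite [leRHS]mulrDl mul1r; apply: ler_wpDr => //.
  rewrite -mulrA; apply: ler_wpM2l => //.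
  apply: le_trans (coef_norm_null (sf k) a b) _; rewrite -mulrA ler_pM2l //.
  have := Hu k (ltnW kk); rewrite {1}/state kN => /le_trans; apply.
  by rewrite -mulrA ler_pM2l.
have kkN : (k0 <= k < N)%N by rewrite kk.
have [a b] := Fnull kkN.
have -> : v k = (F k)^`(p) + Y%:P.
  by rewrite -(Gp k) -derivnD /F subrK Ef // subnn.
apply: le_trans (coef_normD _ _) _; rewrite coef_normC mulrDl mul1r lerD2r.
apply: le_trans (coef_norm_derivn p (sF k)) _.
rewrite -mulrA; apply: ler_wpM2l => //.
apply: le_trans (coef_norm_null (sF k) a b) _; rewrite -mulrA ler_pM2l //.
have := Hw k _; rewrite kk (ltnW kN) => /(_ isT); rewrite {1}/state kN => /le_trans; apply.
by rewrite -mulrA ler_pM2l.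
Qed.

End Source.

(** The pieces of the spline are bounded by [source_bound], hence its
    coefficients by [coef_of_spline].  The condition [c 0 = 0] corresponds to
    the omission of the B-spline that does not vanish at 0 from the columns of
    the matrix. *)
Theorem spline_inverse_bound p : (0 < p)%N -> exists N0 : nat, exists2 K : R, 0 < K &
  forall N l (c : nat -> R), (N0 <= N)%N -> c 0%N = 0 -> (l.+1 < N + p)%N ->
   (forall j, (j.+1 < N + p)%N -> j != l ->
      pairing N (fun k => (spline p N c k)^`()) (bpiece R p N p j) = 0) ->
   forall j, (j < N + p)%N ->
     `|c j| <= K * `|pairing N (fun k => (spline p N c k)^`()) (bpiece R p N p l)|.
Proof.
case: p => // r _; set p := r.+1.
have [N1 [Kt Kt0 HT]] := transfer_chains R r.
have [Kc Kc0 HC] := coef_bound_down R p.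
have [K5 K50 H5] := @coef_of_spline R p p (leqnn _).
set m := (r + r.+1)%N.
exists (maxn 1 N1), (K5 * ((m.+1)%:R ^+ p * (2 * (Kt * (m%:R * Kc))) + 1)).
  apply: mulr_gt0 => //; apply: ltr_wpDl => //; apply: mulr_ge0; first exact: exprn_ge0.
  by apply: mulr_ge0 => //; apply: mulr_ge0; [exact: ltW|apply: mulr_ge0 => //; exact: ltW].
move=> N l c; rewrite geq_max => /andP[N0 NN1] c0 lN Hy j jN.
have B := source_bound N0 c0 lN Hy Kt0 Kc0
  (fun k0 u w => HT N k0 u w NN1) (fun k0 H0 Y => HC N k0 H0 Y N0).
(* An interval of the support of the B-spline of index [j]. *)
pose k := if (j < N)%N then j else N.-1.
have kN : (k < N)%N by rewrite /k; case: ifP => //; lia.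
have := B k kN; rewrite splineE // => /(H5 N c k _ kN) /(_ j).
rewrite -mulrA; apply; rewrite /k; case: ifP; lia.
Qed.

End Main.

(** * The matrix and its inverse *)

Section Mat.
Variable R : realFieldType.

Lemma coef_norm_MXn (f : {poly R}) i : coef_norm ('X^i * f) = coef_norm f.
Proof.
by elim: i => [|i IH]; rewrite ?expr0 ?mul1r // exprS -mulrA coef_norm_MX.
Qed.

Lemma coef_norm_sum (I : Type) (s : seq I) (P : pred I) (F : I -> {poly R}) :
  coef_norm (\sum_(i <- s | P i) F i) <= \sum_(i <- s | P i) coef_norm (F i).
Proof.
apply: (big_ind2 (fun a b => coef_norm a <= b)) => [|a b c d ab cd|//]; first by rewrite coef_norm0.
by apply: le_trans (coef_normD _ _) _; apply: lerD.
Qed.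

Lemma coef_normM (f g : {poly R}) : coef_norm (f * g) <= coef_norm f * coef_norm g.
Proof.
rewrite -[f in leLHS]coefK poly_def mulr_suml.
apply: le_trans (coef_norm_sum _ _ _) _; rewrite [X in X * _]/coef_norm mulr_suml.
by apply: ler_sum => i _; rewrite -scalerAl coef_normZ coef_norm_MXn.
Qed.

Lemma sum_window n a p : (\sum_(l < n) (a <= l <= a + p) <= p.+1)%N.
Proof.
suff: (\sum_(l < n) (a <= l <= a + p) <= minn n (a + p.+1) - a)%N by lia.
elim: n => [|n IH]; first by rewrite big_ord0.
rewrite big_ord_recr /=; apply: leq_trans (leq_add IH (leqnn _)) _.
case: (boolP (a <= n <= a + p)%N) => /= H; lia.
Qed.

Lemma coef_norm_bpiece_window p N j k : (k < N)%N ->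
  coef_norm (bpiece R p N p j k) <= (2 * (1 + p%:R)) ^+ p * (k <= j <= k + p)%N%:R.
Proof.
move=> kN; case: (boolP (k <= j <= k + p)%N) => H; first by rewrite mulr1 coef_norm_bpiece.
rewrite mulr0 bpiece_supp ?coef_norm0 //; apply: contraNN H; rewrite /knot; lia.
Qed.

(** The matrix of the problem in terms of polynomial pieces; the mesh width
    cancels between the derivative and the integral. *)
Definition spline_mx p n : 'M[R]_n :=
  \matrix_(i < n, j < n) pairing (n.+1 - p) (fun k => (bpiece R p (n.+1 - p) p j.+1 k)^`())
     (bpiece R p (n.+1 - p) p i).

(** Each B-spline lives on at most [p.+1] intervals, each of which meets at
    most [p.+1] B-splines. *)
Lemma spline_mx_col_sum p : exists2 B : R, 0 < B & forall n (j : 'I_n),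
  \sum_(i < n) `|spline_mx p n i j| <= B.
Proof.
pose M : R := (2 * (1 + p%:R)) ^+ p.
have M0 : 0 < M by apply: exprn_gt0; apply: mulr_gt0 => //; apply: ltr_pwDl.
exists (p.+1%:R * M * M * p.+1%:R * p.+1%:R).
  by rewrite !mulr_gt0 ?ltr0n.
move=> n j; set N := (n.+1 - p)%N.
pose w (k i : nat) : R := (k <= i <= k + p)%N%:R.
have w0 k i : 0 <= w k i by rewrite ler0n.
have ws a m : \sum_(i < m) w a i <= p.+1%:R.
  by rewrite /w -natr_sum ler_nat sum_window.
have wt i m : \sum_(k < m) w k i <= p.+1%:R.
  apply: le_trans (ws (i - p)%N m); apply: ler_sum => k _.
  rewrite /w ler_nat; case: (boolP (k <= i <= k + p)%N) => // H.
  by rewrite lt0b; lia.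
have H (i : 'I_n) : `|spline_mx p n i j| <= \sum_(k < N) p.+1%:R * M * M * (w k j.+1 * w k i).
  rewrite mxE; apply: le_trans (ler_norm_sum _ _ _) _; apply: ler_sum => k _.
  apply: le_trans (int01_le _) _; apply: le_trans (coef_normM _ _) _.
  have -> : p.+1%:R * M * M * (w k j.+1 * w k i) = (p.+1%:R * (M * w k j.+1)) * (M * w k i).
    by rewrite -!mulrA; congr (_ * (_ * _)); rewrite mulrCA.
  apply: ler_pM; rewrite ?coef_norm_ge0 ?coef_norm_bpiece_window //.
  apply: (@le_trans _ _ (p.+1%:R * coef_norm (bpiece R p N p j.+1 k))).
    by apply: coef_norm_deriv; exact: leqW (@size_bpiece R p N p j.+1 k).
  by rewrite ler_wpM2l ?coef_norm_bpiece_window.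
apply: le_trans (ler_sum _ (fun i _ => H i)) _.
rewrite exchange_big /=.
under eq_bigr => k _ do rewrite -mulr_sumr -mulr_sumr.
rewrite -mulr_sumr -[leRHS]mulrA ler_wpM2l ?(mulr_ge0 (mulr_ge0 _ (ltW M0)) (ltW M0)) //.
apply: (@le_trans _ _ (\sum_(k < N) w k j.+1 * p.+1%:R)).
  by apply: ler_sum => k _; exact: ler_wpM2l (w0 _ _) _ _ (ws _ _).
by rewrite -mulr_suml; apply: ler_wpM2r => //; exact: wt.
Qed.

(** The coefficients of the spline are those of [x] preceded by a zero. *)
Lemma spline_mxE p n (x : 'cV[R]_n) (i : 'I_n) : (p <= n)%N ->
  let c j := if j is j'.+1 then if insub j' is Some j0 then x j0 0 else 0 else 0 in
  (spline_mx p n *m x) i 0 =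
  pairing (n.+1 - p) (fun k => (spline p (n.+1 - p) c k)^`()) (bpiece R p (n.+1 - p) p i).
Proof.
move=> lepn c; rewrite mxE /pairing.
under eq_bigr => j _ do rewrite mxE /pairing mulr_suml.
rewrite exchange_big /=; apply: eq_bigr => k _.
have E : (n.+1 - p + p)%N = n.+1 by lia.
have c0 : c 0%N = 0 by [].
rewrite /spline E big_ord_recl c0 scale0r add0r raddf_sum mulr_suml int01_sum.
apply: eq_bigr => j _; rewrite lift0 [_ (_ *: _)]derivZ -scalerAl int01Z mulrC /c /=.
by case: insubP => [j0 _ /val_inj ->|] //; rewrite ltn_ord.
Qed.

(** A vector whose image is supported at one index is bounded by that entry
    ([spline_inverse_bound]).  This gives injectivity, and it applies to the
    columns of the inverse. *)
Lemma spline_mx_inverse p : (0 < p)%N -> exists n0 : nat, exists2 K : R, 0 < K &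
  forall n, (n0 <= n)%N -> spline_mx p n \in unitmx /\
    forall i j, `|invmx (spline_mx p n) i j| <= K.
Proof.
move=> p0; have [N0 [K K0 H]] := spline_inverse_bound R p0.
exists (N0 + p).+1, K => // n nn.
have lepn : (p <= n)%N by lia.
have E : (n.+1 - p + p)%N = n.+1 by lia.
have main (x : 'cV[R]_n) (l : 'I_n) : (forall i, i != l -> (spline_mx p n *m x) i 0 = 0) ->
    forall j, `|x j 0| <= K * `|(spline_mx p n *m x) l 0|.
  move=> Hx j; rewrite spline_mxE //.
  set c := (c in spline _ _ c).
  have -> : x j 0 = c j.+1.
    by rewrite /c; case: insubP => [j0 _ /val_inj ->|] //; rewrite ltn_ord.
  apply: (H (n.+1 - p)%N l c) => //; rewrite ?E ?ltnS //; first by lia.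
  move=> i; rewrite ltnS => ilt il.
  by have := Hx (Ordinal ilt) il; rewrite spline_mxE.
have U : spline_mx p n \in unitmx.
  (* When the image is zero, any index serves as the position of the source. *)
  rewrite -unitmx_tr -row_free_unit; apply: inj_row_free => v vA.
  have n1 : (0 < n)%N by lia.
  have Z : spline_mx p n *m v^T = 0 by rewrite -[spline_mx p n]trmxK -trmx_mul vA trmx0.
  apply/rowP => j; have := main v^T (Ordinal n1) _ j.
  rewrite Z !mxE normr0 mulr0 normr_le0 => /(_ _)/eqP -> // i _.
  by rewrite mxE.
split=> // i j.
have e : spline_mx p n *m col j (invmx (spline_mx p n)) = delta_mx j 0.
  by rewrite colE mulmxA mulmxV // mul1mx.
have := main (col j (invmx (spline_mx p n))) j _ i.
rewrite e !mxE !eqxx normr1 mulr1; apply=> k /negbTE kj.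
by rewrite mxE kj.
Qed.
End Mat.

(** * Integrals of B-splines *)

Section Analysis.
Variable R : realType.
Notation mu := (@lebesgue_measure R).

(** The values of [f] at the end points are irrelevant to measurability. *)
Lemma measurable_poly_itv (f : R -> R) (a b : R) (G : {poly R}) :
  {in `]a, b[, f =1 horner G} -> measurable_fun `[a, b] f.
Proof.
move=> fG; apply: (@measurable_fun_itv_cc _ _ _ false true).
apply: (@eq_measurable_fun _ _ _ _ _ (horner G)).
  by move=> x; rewrite inE => xab; rewrite fG.
apply/measurable_funTS; apply: continuous_measurable_fun.
exact/continuous_horner.
Qed.

Lemma integral_poly_itv (f : R -> R) (a b : R) (G : {poly R}) : a < b ->
  {in `]a, b[, f =1 horner G^`()} ->
  (\int[mu]_(t in `[a, b]) (f t)%:E = (G.[b] - G.[a])%:E)%E.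
Proof.
move=> ab fG.
have mf : measurable_fun `]a, b[ f.
  apply: measurable_funS (measurable_poly_itv fG) => //.
  exact: subset_itv_oo_cc.
rewrite integral_itv_bndoo; last exact/measurable_EFinP.
under eq_integral => t /[!inE] tab do rewrite fG //.
rewrite -(@integral_itv_bndoo _ _ _ _ true false); last first.
  apply/measurable_EFinP/measurable_funTS; apply: continuous_measurable_fun.
  exact/continuous_horner.
rewrite (@continuous_FTC2 _ _ (horner G)) //.
- apply: continuous_subspaceT; exact: continuous_horner.
- split=> [x _| |]; first exact: derivable_horner.
    by apply: cvg_at_right_filter; exact: continuous_horner.
  by apply: cvg_at_left_filter; exact: continuous_horner.
- by move=> x _; rewrite -derivE.
Qed.

(** The function is only known inside the intervals, its values at the knots
    being immaterial.  Measurability is part of the induction because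
    additivity of the integral requires it. *)
Lemma integral_poly_pieces (f : R -> R) (x : nat -> R) (G : nat -> {poly R}) n :
  (forall k, (k < n)%N -> x k < x k.+1) ->
  (forall k, (k < n)%N -> {in `]x k, x k.+1[, f =1 horner (G k)^`()}) ->
  (0 < n)%N ->
  measurable_fun `[x 0%N, x n] f /\
  (\int[mu]_(t in `[x 0%N, x n]) (f t)%:E =
     (\sum_(k < n) ((G k).[x k.+1] - (G k).[x k]))%:E)%E.
Proof.
elim: n => [//|[|n] IH] xS fG _.
  rewrite big_ord1; split; first exact: measurable_poly_itv (fG _ _).
  by apply: integral_poly_itv; [exact: xS | exact: fG].
have [||mf If] := IH _ _ isT.
- by move=> k len; apply: xS; rewrite ltnW.
- by move=> k len; apply: fG; rewrite ltnW.
have x0 : x 0%N <= x n.+1.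
  elim: (n.+1) {mf If IH fG} xS => [//|m IHm] xS.
  by apply: le_trans (IHm _) (ltW (xS _ _)) => // k km; apply: xS; rewrite ltnW.
have mg := measurable_poly_itv (fG n.+1 (ltnSn _)).
have mg' : measurable_fun `]x n.+1, x n.+2] f.
  by apply: measurable_funS mg => //; exact: subset_itv_oc_cc.
have U : [set` `[x 0%N, x n.+2]] = `[x 0%N, x n.+1] `|` `]x n.+1, x n.+2].
  by rewrite -itv_bndbnd_setU // bnd_simp //= ltW // xS.
have mU : measurable_fun `[x 0%N, x n.+2] f.
  by rewrite U; apply/measurable_funU.
split=> //; rewrite U integral_setU_EFin //; last 2 first.
- by rewrite -U.
- apply/disj_setPS => t [] /=; rewrite !in_itv /= => /andP[_ t1] /andP[t2 _].
  by move: (lt_le_trans t2 t1); rewrite ltxx.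
rewrite If [in RHS]big_ord_recr /= [in RHS]EFinD; congr (_ + _)%E.
rewrite integral_itv_obnd_cbnd; last exact/measurable_EFinP.
by apply: integral_poly_itv; [exact: xS | exact: fG].
Qed.

(** Both sides satisfy the same recursion, from which the mesh width
    cancels. *)
Lemma cox_de_boor_piece (T : R) p N q i k (s : R) : 0 < T -> (k < N)%N -> 0 <= s < 1 ->
  cox_de_boor (open_knot T p N) T q i ((k%:R + s) * (T / N%:R)) = (bpiece R p N q i k).[s].
Proof.
move=> T0 kN /andP[s0 s1].
have N0 : 0 < N%:R :> R by rewrite ltr0n (leq_ltn_trans _ kN).
have h0 : 0 < T / N%:R by rewrite divr_gt0.
have le_knot j : (open_knot T p N j <= (k%:R + s) * (T / N%:R)) = (knot p N j <= k)%N.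
  rewrite /open_knot ler_pM2r // -/(knot p N j).
  have [a|a] := leqP (knot p N j) k.
    by rewrite (le_trans _ (_ : k%:R <= _)) ?ler_nat // lerDl.
  apply/negbTE; rewrite -ltNge.
  by apply: (@lt_le_trans _ _ k.+1%:R); rewrite ?ler_nat // -natr1 ltrD2l.
elim: q i => [|q IH] i.
  rewrite [LHS]/= le_knot ltNge le_knot -ltnNge [_ == T]lt_eqF ?orbF /=.
    by case: ifP; rewrite ?hornerC.
  rewrite -[ltRHS](divfK (lt0r_neq0 N0)) [ltRHS]mulrC ltr_pM2r //.
  by apply: (@lt_le_trans _ _ k.+1%:R); rewrite ?ler_nat // -natr1 ltrD2l.
rewrite horner_bpieceS -!IH [LHS]/= /open_knot -!/(knot p N _).
move: (cox_de_boor _ _ _ i _) (cox_de_boor _ _ _ i.+1 _) => u v.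
have hN := lt0r_neq0 h0.
have hK (a b : R) : a * (T / N%:R) / (b * (T / N%:R)) = a / b.
  by rewrite -mulf_div divff // mulr1.
rewrite /knot_gap addSnnS -!mulrBl !hK.
congr (_ + _); rewrite mulrA; congr (_ * _ * _); ring.
Qed.

(** The local variable [(t - k h) / h] of the k-th interval. *)
Definition local_var (h : R) (k : nat) : {poly R} := h^-1 *: 'X - k%:R%:P.

Lemma horner_local_var h k t : (local_var h k).[t] = t / h - k%:R.
Proof. by rewrite /local_var hornerD hornerN hornerC hornerZ hornerX mulrC. Qed.

Lemma deriv_comp_local_var h k (f : {poly R}) :
  (f \Po local_var h k)^`() = h^-1 *: (f^`() \Po local_var h k).
Proof. by rewrite deriv_comp /local_var derivB derivZ derivX derivC subr0 alg_polyC mulrC mul_polyC. Qed.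

Lemma bspline_piece (T : R) p N j k t : 0 < T -> (k < N)%N ->
  t \in `]k%:R * (T / N%:R), k.+1%:R * (T / N%:R)[ ->
  bspline T p N j t = (bpiece R p N p j k \Po local_var (T / N%:R) k).[t].
Proof.
move=> T0 kN; rewrite in_itv /= => /andP[t1 t2].
have N0 : 0 < N%:R :> R by rewrite ltr0n (leq_ltn_trans _ kN).
have h0 : 0 < T / N%:R by rewrite divr_gt0.
rewrite horner_comp horner_local_var -(@cox_de_boor_piece T) //.
  by rewrite addrC subrK divfK ?lt0r_neq0.
by rewrite subr_ge0 ltrBlDr addrC natr1 ler_pdivlMr // ltr_pdivrMr // ltW.
Qed.

(** Inside an interval the B-spline agrees with a polynomial in a neighbourhood
    of each point. *)
Lemma derive1_bspline_piece (T : R) p N j k t : 0 < T -> (k < N)%N ->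
  t \in `]k%:R * (T / N%:R), k.+1%:R * (T / N%:R)[ ->
  derive1 (bspline T p N j) t = ((bpiece R p N p j k \Po local_var (T / N%:R) k)^`()).[t].
Proof.
move=> T0 kN tk; rewrite derivE !derive1E; apply: near_eq_derive.
near=> u; apply: bspline_piece => //.
near: u; exact: near_in_itvoo.
Unshelve. all: by end_near. Qed.

Lemma Ch_entryE (T : R) p N l j : 0 < T -> (0 < N)%N ->
  Ch_entry T p N l j =
  pairing N (fun k => (bpiece R p N p j k)^`()) (bpiece R p N p l.-1).
Proof.
move=> T0 N0.
have N0' : 0 < N%:R :> R by rewrite ltr0n.
have h0 : 0 < T / N%:R by rewrite divr_gt0.
pose G k := antideriv ((bpiece R p N p j k)^`() * bpiece R p N p l.-1 k) \Po local_var (T / N%:R) k.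
have [||_] := @integral_poly_pieces
  (fun t => derive1 (bspline T p N j) t * bspline T p N l.-1 t)
  (fun k => k%:R * (T / N%:R)) G N _ _ N0.
- by move=> k _; rewrite ltr_pM2r // ltr_nat.
- move=> k kN t tk /=; rewrite (derive1_bspline_piece p j T0 kN tk) (bspline_piece p _ T0 kN tk).
  rewrite /G !deriv_comp_local_var deriv_antideriv !hornerZ !horner_comp hornerM.
  by rewrite mulrA.
rewrite mul0r mulrC divfK ?lt0r_neq0 // /Ch_entry /Rintegral => ->.
rewrite /pairing /=; apply: eq_bigr => k _.
rewrite /G !horner_comp !horner_local_var !mulfK ?lt0r_neq0 // subrr antideriv_0 subr0.
by rewrite -natr1 addrC addKr antideriv_1.
Qed.
End Analysis.

(** * Operator norms and condition numbers *)

Section Norms.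
Variable R : realType.

Lemma CmxE (T : R) p n : 0 < T -> (p <= n)%N -> Cmx T p n = spline_mx R p n.
Proof.
move=> T0 lepn; apply/matrixP => i j; rewrite !mxE Ch_entryE //; lia.
Qed.

Lemma vnorm0 k n : vnorm k (0 : 'cV[R]_n) = 0.
Proof.
case: k => /=.
- by apply: big1 => i _; rewrite mxE normr0.
- by rewrite big1 ?sqrtr0 // => i _; rewrite mxE expr0n.
- by apply/eqP; rewrite eq_le; apply/andP; split;
    [apply: bigmax_le => // i _; rewrite mxE normr0 | exact: bigmax_ge_id].
Qed.

(** The value at the zero vector makes the set nonempty and gives the lower
    bound. *)
Lemma opnorm_bounds k n (A : 'M[R]_n) (B : R) :
  (forall x, vnorm k x <= 1 -> vnorm k (A *m x) <= B) -> 0 <= opnorm k A <= B.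
Proof.
move=> H; rewrite /opnorm; set S := [set _ | _ in _].
have uS : ubound S B by move=> _ [x /= x1 <-]; exact: H.
have S0 : S 0 by exists 0; rewrite /= ?mulmx0 vnorm0.
by apply/andP; split; [apply: ub_le_sup => //; exists B | apply: ge_sup => //; exists 0].
Qed.

Lemma opnorm1_bounds n (A : 'M[R]_n) (B : R) :
  0 <= B -> (forall j, \sum_(i < n) `|A i j| <= B) -> 0 <= opnorm Norm1 A <= B.
Proof.
move=> B0 H; apply: opnorm_bounds => x /= x1.
apply: (@le_trans _ _ (\sum_(i < n) \sum_(j < n) `|A i j| * `|x j 0|)).
  apply: ler_sum => i _; rewrite mxE; apply: le_trans (ler_norm_sum _ _ _) _.
  by apply: ler_sum => j _; rewrite normrM.
rewrite exchange_big /=.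
apply: (@le_trans _ _ (\sum_(j < n) B * `|x j 0|)).
  by apply: ler_sum => j _; rewrite -mulr_suml ler_wpM2r.
by rewrite -mulr_sumr ler_piMr.
Qed.

Lemma coord_le_vnorm k n (x : 'cV[R]_n) i : `|x i 0| <= vnorm k x.
Proof.
case: k => /=.
- by rewrite (bigD1 i) //= lerDl sumr_ge0.
- rewrite -sqrtr_sqr ler_sqrt; last by apply: sumr_ge0 => j _; exact: sqr_ge0.
  by rewrite (bigD1 i) //= lerDl sumr_ge0 // => j _; exact: sqr_ge0.
- exact: (le_bigmax_cond 0 (fun j => `|x j 0|)).
Qed.

Lemma vnorm_le_coord k n (x : 'cV[R]_n) (b : R) : 0 <= b ->
  (forall i, `|x i 0| <= b) -> vnorm k x <= n%:R * b.
Proof.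
move=> b0 H; case: k => /=.
- apply: le_trans (ler_sum _ (fun i _ => H i)) _.
  by rewrite sumr_const card_ord mulr_natl.
- have nb : 0 <= n%:R * b by rewrite mulr_ge0.
  rewrite -[leRHS](ger0_norm nb) -sqrtr_sqr ler_sqrt ?sqr_ge0 //.
  apply: (@le_trans _ _ (\sum_(i < n) b ^+ 2)).
    by apply: ler_sum => i _; rewrite -[leLHS]real_normK ?num_real // lerXn2r ?nnegrE.
  rewrite sumr_const card_ord -[leLHS]mulr_natl exprMn ler_wpM2r ?sqr_ge0 //.
  by rewrite -natrX ler_nat; nia.
- apply: bigmax_le => [|i _]; first by rewrite mulr_ge0.
  apply: le_trans (H i) _; rewrite ler_peMl // ler1n.
  exact: leq_ltn_trans (ltn_ord i).
Qed.

(** The factor [n ^ 2] is far from sharp, but it holds for the three norms at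
    once and any power of [n] will do. *)
Lemma opnorm_coord_bounds k n (A : 'M[R]_n) (B : R) : 0 <= B ->
  (forall i j, `|A i j| <= B) -> 0 <= opnorm k A <= n%:R * (n%:R * B).
Proof.
move=> B0 H; apply: opnorm_bounds => x x1.
apply: vnorm_le_coord => [|i]; first by rewrite mulr_ge0.
rewrite mxE; apply: le_trans (ler_norm_sum _ _ _) _.
apply: (@le_trans _ _ (\sum_(j < n) B)); last by rewrite sumr_const card_ord mulr_natl.
apply: ler_sum => j _; rewrite normrM -[leRHS]mulr1 ler_pM //.
exact: le_trans (coord_le_vnorm k x j) x1.
Qed.

Lemma eqO_nat (f g : nat -> R) (n0 : nat) (K : R) :
  (forall n, (n0 <= n)%N -> `|f n| <= K * `|g n|) ->
  (f : nat -> R^o) =O_\oo (g : nat -> R^o).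
Proof.
move=> H; apply/eqOP; near=> k; near=> n.
apply: le_trans (H n _) _; first by near: n; exact: nbhs_infty_ge.
by rewrite ler_wpM2r //; near: k; exact: nbhs_pinfty_ge.
Unshelve. all: by end_near. Qed.

(** In the 1-norm the matrix is bounded by its column sums and the inverse by
    [n] times its largest entry.  For an arbitrary norm the entries of both are
    bounded, which yields the exponent 4. *)
Theorem Cmx_conditioning (T : R) (p : nat) : 0 < T -> (0 < p)%N ->
  (\forall n \near \oo, Cmx T p n \in unitmx) /\
  (forall k : norm_kind, weakly_well_conditioned k (Cmx T p)) /\
  (fun n : nat => cond_num Norm1 (Cmx T p n) : R^o)
    =O_\oo (fun n : nat => n%:R : R^o).
Proof.
move=> T0 p0; have [n0 [K K0 HK]] := spline_mx_inverse R p0.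
have [B B0 HB] := spline_mx_col_sum R p.
have E n : (n0 + p <= n)%N -> Cmx T p n = spline_mx R p n.
  by move=> nn; rewrite CmxE //; lia.
have U : \forall n \near \oo, Cmx T p n \in unitmx.
  near=> n; have nn : (n0 + p <= n)%N by near: n; exact: nbhs_infty_ge.
  by rewrite E //; apply: (HK n _).1; lia.
split=> //; split=> [k|].
  split=> //; exists 4%:R => //.
  apply: (@eqO_nat _ _ (n0 + p)%N (B * K)) => n nn.
  rewrite /cond_num E // powR_mulrn //.
  have Bij i j : `|spline_mx R p n i j| <= B.
    by apply: le_trans (HB n j); rewrite (bigD1 i) //= lerDl sumr_ge0.
  have Kij := (HK n (leq_trans (leq_addr _ _) nn)).2.
  have /andP[a1 a2] := opnorm_coord_bounds k (ltW B0) Bij.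
  have /andP[b1 b2] := opnorm_coord_bounds k (ltW K0) Kij.
  rewrite ger0_norm ?mulr_ge0 // ger0_norm ?exprn_ge0 //.
  apply: le_trans (ler_pM a1 b1 a2 b2) _.
  by rewrite le_eqVlt; apply/orP; left; apply/eqP; ring.
apply: (@eqO_nat _ _ (n0 + p)%N (B * K)) => n nn.
rewrite /cond_num E //.
have /andP[a1 a2] := opnorm1_bounds (ltW B0) (HB n).
have Kij := (HK n (leq_trans (leq_addr _ _) nn)).2.
have /andP[b1 b2] : 0 <= opnorm Norm1 (invmx (spline_mx R p n)) <= K * n%:R.
  apply: opnorm1_bounds => [|j]; first by rewrite mulr_ge0 // ltW.
  apply: le_trans (ler_sum _ (fun i _ => Kij i j)) _.
  by rewrite sumr_const card_ord mulr_natr.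
rewrite !ger0_norm ?mulr_ge0 //.
by apply: le_trans (ler_pM a1 b1 a2 b2) _; rewrite mulrA.
Unshelve. all: by end_near. Qed.
End Norms.

Theorem proposition3p15 (R : realType) (T : R) (hT : 0 < T)
    (p : nat) (hp : (1 <= p <= 25)%N) :
  (\forall n \near \oo, Cmx T p n \in unitmx) /\
  (forall k : norm_kind, weakly_well_conditioned k (Cmx T p)) /\
  (fun n : nat => cond_num Norm1 (Cmx T p n) : R^o)
    =O_\oo (fun n : nat => n%:R : R^o).
Proof. by apply: Cmx_conditioning => //; case/andP: hp. Qed.
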